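(* There is an absolute constant $C>0$ such that the following holds. For every $\epsilon\in(0,1/4]$ and every $M\in\mathbb{Z}^+$ there is a randomized resizable allocator for the Memory Reallocation problem with $M$ memory slots and load factor $1-\epsilon$ whose worst-case expected overhead against an oblivious adversary is at most $C\log^4(\epsilon^{-1})\cdot(\log\log \epsilon^{-1})^2$. In other words, the problem can be solved with worst-case expected overhead $O(\log^4\epsilon^{-1}\cdot(\log\log\epsilon^{-1})^2)$.
   Context: Memory Reallocation problem: the memory consists of $M$ slots indexed $0,1,\dots,M-1$. There is a dynamically changing set $X$ of (live) objects, each object $x$ having a size $\mu(x)\in\mathbb{Z}^+$. An allocation is a map $\phi\colon X\to\{0,\dots,M-1\}$ with $\phi(x)+\mu(x)\le M$ such that the intervals $[\phi(x),\phi(x)+\mu(x))$, $x\in X$, are pairwise disjoint. Starting from $X=\varnothing$, the allocator receives online a sequence of updates, each either inserting a new object $x$ of given size into $X$ or deleting some $x\in X$; after each update it must output an allocation of the new set $X'$ and may move existing objects. If the update inserts/deletes $x$ and changes the allocation $\phi$ of $X$ to $\phi'$ of $X'$, its overhead factor is $1+\frac{1}{\mu(x)}\sum_{y\in X\cap X',\ \phi(y)\neq\phi'(y)}\mu(y)$. An update sequence has load factor $1-\epsilon$ ($\epsilon>0$, known to the allocator) if at all times $\sum_{x\in X}\mu(x)\le(1-\epsilon)M$. A randomized allocator has worst-case expected overhead at most $f$ against an oblivious adversary if for every update sequence fixed in advance (with the given $M$ and load factor), the overhead factor of each update has expectation at most $f$ over the allocator's randomness. An allocator is resizable if at all times the live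 objects are allocated within the prefix $[0,\frac{1}{1-\epsilon}\sum_{x\in X}\mu(x))$ of memory. Logarithms are base $2$. *)

(* Defs.v *)
From HB Require Import structures.
From mathcomp Require Import all_boot all_order all_algebra finmap.
From mathcomp Require Import all_classical all_reals all_analysis.

Set Implicit Arguments.
Unset Strict Implicit.
Unset Printing Implicit Defensive.

Import Order.TTheory GRing.Theory Num.Theory.

Local Open Scope classical_set_scope.
Local Open Scope ring_scope.

(* Objects are named by natural numbers. A name may be inserted again, possibly
   with another size, after the object bearing it has been deleted. *)
Inductive update :=
| Insert (x size : nat)
| Delete (x : nat).

(* The live objects X together with their sizes: domf X is the set of names. *)
Definition objects := {fmap nat -> nat}.

Definition mu (X : objects) (x : nat) : nat := odflt 0%N X.[? x]%fmap.

Definition total_size (X : objects) : nat := (\sum_(x <- domf X) mu X x)%N.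

Definition legal (X : objects) (u : update) : bool :=
  match u with
  | Insert x m => (x \notin domf X) && (0 < m)%N
  | Delete x => x \in domf X
  end.

Definition apply_update (X : objects) (u : update) : objects :=
  match u with
  | Insert x m => X.[x <- m]%fmap
  | Delete x => X.[~ x]%fmap
  end.

Definition live_after (us : seq update) : objects :=
  foldl apply_update [fmap]%fmap us.

Definition update_size (X : objects) (u : update) : nat :=
  match u with
  | Insert _ m => m
  | Delete x => mu X x
  end.

Fixpoint legal_from (X : objects) (us : seq update) : bool :=
  if us is u :: us' then legal X u && legal_from (apply_update X u) us'
  else true.

Definition has_load_factor (R : realType) (M : nat) (load : R)
    (us : seq update) : Prop :=
  forall t, (total_size (live_after (take t us)))%:R <= load * M%:R.

Definition admissible (R : realType) (M : nat) (load : R)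
    (us : seq update) : Prop :=
  legal_from [fmap]%fmap us /\ has_load_factor M load us.

(* The half-open integer interval [phi(x), phi(x) + mu(x)). *)
Definition slots (X : objects) (phi : nat -> nat) (x : nat) : set nat :=
  [set k | (phi x <= k < phi x + mu X x)%N].

(* Allocations are total functions on names; only values on X matter. *)
Definition is_allocation (M : nat) (X : objects) (phi : nat -> nat) : Prop :=
  (forall x, x \in domf X -> (phi x < M)%N /\ (phi x + mu X x <= M)%N) /\
  trivIset [set x | x \in domf X] (slots X phi).

Definition overhead (R : realType) (X : objects) (u : update)
    (phi phi' : nat -> nat) : R :=
  1 + (update_size X u)%:R^-1 *
      (\sum_(y <- (domf X `&` domf (apply_update X u))%fset
               | phi y != phi' y) mu X y)%:R.

(* A probability distribution over deterministic online algorithms: for the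
   random outcome w, [alloc w us] is the allocation output after the updates us,
   so it cannot depend on later updates. *)
Record rand_allocator (R : realType) := RandAllocator {
  alloc_display : measure_display;
  outcome : measurableType alloc_display;
  alloc_prob : probability outcome R;
  alloc :> outcome -> seq update -> nat -> nat;
  measurable_alloc : forall us x, measurable_fun setT (fun w => alloc w us x)
}.

Definition solves_memory_reallocation (R : realType) (M : nat) (load : R)
    (A : rand_allocator R) : Prop :=
  forall us, admissible M load us ->
  forall w, is_allocation M (live_after us) (A w us).

Definition resizable (R : realType) (M : nat) (load : R)
    (A : rand_allocator R) : Prop :=
  forall us, admissible M load us ->
  forall w x, x \in domf (live_after us) ->
    (A w us x + mu (live_after us) x)%:R
      <= load^-1 * (total_size (live_after us))%:R.

(* Each update u of a sequence us ++ u :: vs fixed in advance has expected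
   overhead factor at most f. *)
Definition worst_case_expected_overhead_le (R : realType) (M : nat) (load : R)
    (A : rand_allocator R) (f : R) : Prop :=
  forall us u vs, admissible M load (us ++ u :: vs) ->
  (expectation (alloc_prob A)
     (fun w => overhead R (live_after us) u (A w us) (A w (rcons us u)))
   <= f%:E)%E.

Definition log2 (R : realType) (x : R) : R := ln x / ln 2.

(* Main.v *)
(** Let e be about log2 (1 / eps). Sizes are rounded up so that each dyadic scale
    carries at most 2^e different sizes. When the total size of the live objects
    is about 2^l, objects of size at least 2^(l - 4 e) form the core, which is
    stored without gaps; the others are tiny.

    The core is a cascade of 4 e + 3 levels, level j and the later ones being
    rebuilt whenever the volume of the updates crosses a multiple of a period of
    order 2^(l - j). Levels consist of cells, sequences of objects of one scale. A
    hole left in a level is filled exactly by a cell of equal scale and equal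
    total size taken from the levels rebuilt more often, which keep enough spare
    cells to last until the next rebuild. Such cells exist because, among
    O(p 2^kap kap^2) integers below 2^(2^kap), there are p disjoint nonempty sets
    with equal sums: this is the spread-approximation proof of the improved
    sunflower theorem (Alweiss, Lovasz, Wu and Zhang), with 2^kap of order e, and
    accounts for the factor (log log (1 / eps))^2.

    Tiny objects of one size share slabs, aligned blocks of dyadic length. Listed
    by decreasing length, each slab takes the first free position in its own
    random permutation of the memory; inserting a slab, or a page of memory, then
    moves in expectation only O(e) times its length.

    All periods are shifted by a random phase independent of the updates, so an
    update of size s triggers a rebuild of period T with probability s / T. *)

Require Import Defs.
From mathcomp Require Import all_boot all_order all_fingroup all_algebra.
From mathcomp Require Import zify ring.

Set Implicit Arguments.
Unset Strict Implicit.
Unset Printing Implicit Defensive.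

Import Order.TTheory GRing.Theory Num.Theory.

(** * Disjoint sets with equal sums *)

(** The obstacle is a deletion inside a level that is seldom rebuilt: closing the hole by shifting
    costs far more than the deleted size, and leaving it open wastes space. A substitute of equal
    key moves only its own mass, but one must be at hand for every deletion until the next rebuild,
    whatever is deleted; so spare cells are reserved for the worst case, and randomness is spent
    only on the timing and on the tiny objects. A rebuild from level [l] on moves O([F * T l]) and
    is triggered with probability s / [T l], so each of the O(e) levels adds O([F]) to the overhead.
    [F] has order e^2 * R with R = [spread_const kap] of order e * kap^2: one factor e for the
    scales cut into cells at one level, one for the earlier levels whose keys need spares. In total
    this is e^4 * kap^2. The threshold a = l - 4 e is what slabs allow: each scale below a has up to
    2^(e + 1) sizes, each size can waste two slabs of length below 2^(a + e + 3), and the sum, at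
    most 2^(a + 2 e + 5), must be small against the free space, of order 2^(l - e). *)

Lemma leq_card_bigcup (I T : finType) (P : pred I) (F : I -> {set T}) :
  #|\bigcup_(i | P i) F i| <= \sum_(i | P i) #|F i|.
Proof.
elim/big_rec2: _ => [|i m A Pi IH]; first by rewrite cards0.
by apply: leq_trans (leq_card_setU _ _) _; rewrite leq_add2l.
Qed.

(** * Spread families: fragments left by successive colour classes *)

Section Fragments.
Variables (X I : finType) (T0 : I -> {set X}) (k0 : nat).

Implicit Type st : {set I} * (I -> {set X}).

(** The set of [i] may be exchanged for that of any surviving [i'] inside its union with [W]; the
    least remainder outside [W] is the minimal fragment of the spread argument. Minimality is what
    allows the fragment to be recovered after it has been merged with [W]. *)
Definition best st (W : {set X}) (i : I) : I :=
  [arg min_(i' < i | (i' \in st.1) && (st.2 i' \subset st.2 i :|: W))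
     #|st.2 i' :\: W|].

Definition shrink (k : nat) st (W : {set X}) : {set I} * (I -> {set X}) :=
  let T i := st.2 (best st W i) :\: W in ([set i in st.1 | #|T i| <= k], T).

(* The classes of [Ws] are listed latest first. *)
Fixpoint frag (Ws : seq {set X}) : {set I} * (I -> {set X}) :=
  if Ws is W :: Ws' then shrink (k0 %/ 2 ^ (size Ws)) (frag Ws') W
  else (setT, T0).

Lemma bestP st W i : i \in st.1 ->
  [/\ best st W i \in st.1, st.2 (best st W i) \subset st.2 i :|: W &
    forall i', i' \in st.1 -> st.2 i' \subset st.2 i :|: W ->
      #|st.2 (best st W i) :\: W| <= #|st.2 i' :\: W|].
Proof.
move=> si; rewrite /best; case: arg_minnP => [|i' /andP[s1 s2] H].
  by rewrite si subsetUl.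
by split=> // j sj js; apply: H; rewrite sj.
Qed.

Lemma shrink_sub k st W i : i \in st.1 -> (shrink k st W).2 i \subset st.2 i.
Proof.
move=> si; have [_ H _] := bestP W si.
by rewrite /= subDset setUC.
Qed.

Hypothesis T0_le : forall i, #|T0 i| <= k0.

Lemma frag_card Ws i : i \in (frag Ws).1 -> #|(frag Ws).2 i| <= k0 %/ 2 ^ size Ws.
Proof. by case: Ws => [|W Ws] /=; [rewrite divn1 | rewrite inE => /andP[]]. Qed.

Lemma frag_sub Ws i : i \in (frag Ws).1 -> (frag Ws).2 i \subset T0 i.
Proof.
elim: Ws => [|W Ws IH] //=; rewrite inE => /andP[si _].
exact: subset_trans (shrink_sub 0 W si) (IH si).
Qed.

Lemma frag_disj Ws i W : i \in (frag Ws).1 -> W \in Ws ->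
  [disjoint (frag Ws).2 i & W].
Proof.
elim: Ws => [|W' Ws IH] //=; rewrite !inE => /andP[si _] /orP[/eqP->|WWs].
  by rewrite -setI_eq0 setIDAC setDIl setDv setI0.
exact: disjointWl (shrink_sub 0 W' si) (IH si WWs).
Qed.

(** Once the fragment is empty, this exhibits a member of the original family inside the union of
    the classes. *)
Lemma frag_cover Ws i : i \in (frag Ws).1 ->
  exists i', T0 i' \subset (frag Ws).2 i :|: \bigcup_(W <- Ws) W.
Proof.
elim: Ws i => [|W Ws IH] i /=; first by exists i; rewrite subsetUl.
rewrite inE => /andP[si _]; have [s1 _ _] := bestP W si.
have [i' H] := IH _ s1; exists i'; rewrite big_cons.
apply: subset_trans H _; rewrite setUA; apply: setSU.
by apply/subsetP=> x xT; rewrite !inE xT andbT orbC; case: (x \in W).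
Qed.

Section Colours.
Variable Col : finType.
Implicit Type c : {ffun X -> Col}.

Definition colour_class c (g : Col) : {set X} := [set x | c x == g].
Definition classes c (gs : seq Col) := [seq colour_class c g | g <- gs].
Definition recolour c (T : {set X}) (g : Col) : {ffun X -> Col} :=
  [ffun x => if x \in T then g else c x].

(** Only the colours of [c] on [T] are lost; [h] keeps exactly these. *)
Lemma card_recolour T g c' : #|[set c | recolour c T g == c']| <= #|Col| ^ #|T|.
Proof.
pose h c : {ffun X -> Col} := [ffun x => if x \in T then c x else g].
rewrite -(@card_in_imset _ _ h); last first.
  move=> c1 c2; rewrite !inE => /eqP E1 /eqP E2 E; apply/ffunP => x.
  have := congr1 (fun f : {ffun X -> Col} => f x) E; rewrite !ffunE.
  case: (boolP (x \in T)) => // xT _.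
  have := congr1 (fun f : {ffun X -> Col} => f x) E1.
  rewrite -E2 !ffunE (negPf xT) //.
have -> : #|Col| ^ #|T| = #|pffun_on g (mem T) (mem Col)|.
  by rewrite card_pffun_on; congr (_ ^ _).
apply: subset_leq_card; apply/subsetP => f /imsetP[c _ ->].
apply/pffun_onP; split=> //; apply/supportP => x.
by rewrite ffunE => /negPf ->.
Qed.

Variable rho : nat.
Let r := 64 * rho * #|Col|.
Hypothesis rho_gt0 : 0 < rho.
Hypothesis spread :
  forall Z : {set X}, #|[set i | Z \subset T0 i]| * r ^ #|Z| <= #|I|.

(* A pair (c, i) whose fragment T is still large is recovered from the
   colouring c' in which T gets colour g, from T, which is a subset of a set
   determined by c' alone, from i among the indices with T <= T0 i, and from
   the colours of c on T. *)
Lemma card_bad gs g : g \notin gs ->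
  #|[set p : {ffun X -> Col} * I |
      (p.2 \in (frag (classes p.1 gs)).1) &&
      (p.2 \notin (frag (classes p.1 (g :: gs))).1)]| * (32 * rho)
  <= #|{ffun X -> Col}| * #|I|.
Proof.
move=> g_gs; set Bd := [set p | _].
set k := k0 %/ 2 ^ size gs; set k' := k0 %/ 2 ^ (size gs).+1.
have kk' : k <= k'.*2.+1.
  rewrite /k /k' expnSr divnMA; have := divn_eq (k0 %/ 2 ^ size gs) 2; lia.
(* The set determined by the new colouring: some surviving fragment contained in its class [g]. *)
pose istar c := [pick i | (i \in (frag (classes c gs)).1) &&
   ((frag (classes c gs)).2 i \subset colour_class c g)].
pose Ts c : {set {set X}} := if istar c is Some i then
  [set T in powerset ((frag (classes c gs)).2 i) | k' < #|T|] else set0.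
pose F c (T : {set X}) := setX [set c1 | recolour c1 T g == c] [set i | T \subset T0 i].
have Bd_sub : Bd \subset \bigcup_c \bigcup_(T in Ts c) F c T.
  apply/subsetP => -[c i]; rewrite inE /= => /andP[si].
  rewrite inE si /= -ltnNge size_map -/k' => kT.
  set st := frag (classes c gs) in si kT *; set W := colour_class c g in kT *.
  set T := st.2 _ :\: W in kT *.
  have [s1 s2 smin] := bestP W si.
  have TTi : T \subset st.2 i := shrink_sub 0 W si.
  (* Fragments avoid the earlier classes, so recolouring [T] changes neither these classes nor the
     current fragments. *)
  have cls : classes (recolour c T g) gs = classes c gs.
    apply/eq_in_map => g' g'gs; apply/setP => x; rewrite !inE ffunE.
    case: ifP => // xT; have [gg'|ngg'] := eqVneq g g'.
      by rewrite gg' g'gs in g_gs.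
    apply/esym/negbTE/negP => /eqP cx.
    have /pred0P/(_ x) := frag_disj si (map_f (colour_class c) g'gs).
    by rewrite /= inE cx eqxx andbT (subsetP TTi).
  have WT : colour_class (recolour c T g) g = W :|: T.
    apply/setP => x; rewrite in_setU ![_ \in colour_class _ _]in_set ffunE; by case: ifP; rewrite ?eqxx ?orbT ?orbF.
  apply/bigcupP; exists (recolour c T g) => //.
  apply/bigcupP; exists T; last first.
    by rewrite !inE /= eqxx (subset_trans TTi (frag_sub si)).
  rewrite /Ts /istar cls WT -/st.
  case: pickP => [j /andP[sj jWT]|]; last first.
    move/(_ (best st W i)); rewrite s1 /= => /negP[].
    by apply/subsetP => x xT; rewrite !in_setU in_setD xT andbT; case: (x \in W).
  rewrite in_set powersetE kT andbT.
  (* [j] is itself a candidate in the minimization for [i]. Its remainder outside [W] lies in [T]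
     and cannot be smaller than [T], so the two are equal and [T] is a subset of [st.2 j]. *)
  have jT : st.2 j :\: W \subset T by rewrite subDset.
  have jc := smin _ sj (subset_trans jWT _).
  have /eqP <- : st.2 j :\: W == T.
    rewrite eqEcard jT jc //.
    by rewrite setUC; apply: setSU.
  by rewrite subDset subsetUr.
have T_le c : #|Ts c| <= 2 ^ k.
  rewrite /Ts /istar; case: pickP => [i /andP[si _]|_]; last by rewrite cards0.
  have := frag_card si; rewrite size_map -/k => ki.
  apply: leq_trans (leq_pexp2l _ ki) => //; rewrite -card_powerset.
  by apply: subset_leq_card; apply/subsetP => T; rewrite inE => /andP[].
have F_le c T : T \in Ts c -> #|F c T| * (32 * rho * 2 ^ k) <= #|I|.
  move=> TT; have kT : k' < #|T|.
    by move: TT; rewrite /Ts; case: (istar c) => [i|]; rewrite inE // => /andP[].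
  (* After the colours on [T] are paid for, a factor (64 rho)^#|T| is left. As [#|T| > k'] and
     [k <= 2 * k' + 1], it absorbs the at most 2^k choices of [T] and the factor 32 rho. *)
  apply: leq_trans (spread T); rewrite cardsX /r expnMn -mulnA mulnCA leq_mul2l.
  apply/orP; right; rewrite mulnC; apply: leq_mul; last exact: card_recolour.
  apply: (@leq_trans ((64 * rho) ^ k'.+1)); last by rewrite leq_pexp2l // muln_gt0.
  apply: (@leq_trans (32 * rho * 2 ^ k'.*2.+1)); first by rewrite leq_mul2l leq_pexp2l ?orbT.
  rewrite !expnS -mul2n expnM mulnA; apply: leq_mul; first lia.
  by case: (k') => // n; rewrite leq_exp2r //; lia.
have H : #|Bd| <= \sum_c \sum_(T in Ts c) #|F c T|.
  apply: leq_trans (subset_leq_card Bd_sub) _.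
  apply: leq_trans (leq_card_bigcup _ _) _; apply: leq_sum => c _.
  exact: leq_card_bigcup.
have k2 : 0 < 2 ^ k by rewrite expn_gt0.
rewrite -(leq_pmul2r k2) -mulnA.
apply: leq_trans (leq_mul H (leqnn _)) _.
rewrite -[X in _ <= X]mulnA -[X in _ <= X]sum_nat_const big_distrl /=; apply: leq_sum => c _.
rewrite big_distrl /=; apply: (@leq_trans (\sum_(T in Ts c) #|I|)).
  by apply: leq_sum => T; apply: F_le.
by rewrite sum_nat_const mulnC leq_mul.
Qed.

End Colours.
End Fragments.

(** A colour is a pair of one of 2 p names and one of kap + 1 rounds. For a fixed name, each round
    halves the admissible fragment size and loses at most a 1 / (32 (kap + 1)) share of the pairs of
    a colouring and an index. Hence a name fails for at most 1/32 of the colourings, and by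
    averaging some colouring has p successful names. *)
Lemma spread_cover (X I : finType) (T0 : I -> {set X}) (kap p : nat) :
    0 < p -> 0 < #|I| -> (forall i, #|T0 i| <= 2 ^ kap) ->
    (forall Z : {set X}, #|[set i | Z \subset T0 i]| *
       (64 * kap.+1 * (p.*2 * kap.+1)) ^ #|Z| <= #|I|) ->
  exists c : X -> 'I_p.*2,
    p <= #|[set b | [exists i, T0 i \subset [set x | c x == b]]]|.
Proof.
move=> p_gt0 I_gt0 T0_le spread.
pose Col := ('I_p.*2 * 'I_kap.+1)%type.
have cardCol : #|{: Col}| = p.*2 * kap.+1 by rewrite card_prod !card_ord.
pose ok (c : {ffun X -> Col}) b := [exists i, T0 i \subset [set x | (c x).1 == b]].
suff [c cP] : exists c : {ffun X -> Col}, p <= #|[set b | ok c b]|.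
  by exists (fun x => (c x).1).
have p2_gt0 : 0 < p.*2 by rewrite double_gt0.
pose c0 : {ffun X -> Col} := [ffun=> (Ordinal p2_gt0, ord0)].
have ff_gt0 : 0 < #|{ffun X -> Col}| by apply/card_gt0P; exists c0.
pose lost b (s : seq 'I_kap.+1) := [set q : {ffun X -> Col} * I |
  q.2 \notin (frag T0 (2 ^ kap) (classes q.1 [seq (b, j) | j <- s])).1].
have lost_le b s : uniq s ->
    #|lost b s| * (32 * kap.+1) <= size s * (#|{ffun X -> Col}| * #|I|).
  elim: s => [_|j s IH /andP[js us]] /=.
    by rewrite (_ : lost b [::] = set0) ?cards0 //; apply/setP => q; rewrite !inE.
  have js' : (b, j) \notin [seq (b, j) | j <- s].
    by apply: contra js => /mapP[j' j's [->]].
  have spread' (Z : {set X}) : #|[set i | Z \subset T0 i]| * (64 * kap.+1 * #|{: Col}|) ^ #|Z| <= #|I|.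
    by rewrite cardCol.
  have := card_bad T0_le (ltn0Sn kap) spread' js'.
  set Bd := [set q | _] => Bd_le.
  have lostU : lost b (j :: s) \subset lost b s :|: Bd.
    apply/subsetP => q; rewrite in_setU in_set => q1.
    rewrite [q \in lost _ _]in_set [q \in Bd]in_set q1 andbT.
    by case: (q.2 \in (frag _ _ (classes q.1 [seq (b, j) | j <- s])).1).
  rewrite [(size s).+1 * _]mulSn [X in _ <= X]addnC; apply: leq_trans _ (leq_add (IH us) Bd_le).
  rewrite -mulnDl leq_mul2r; apply/orP; right.
  exact: leq_trans (subset_leq_card lostU) (leq_card_setU _ _).
have fail_le b : #|[set c | ~~ ok c b]| * 32 <= #|{ffun X -> Col}|.
  have := lost_le b _ (enum_uniq 'I_kap.+1).
  rewrite size_enum_ord => lb0.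
  have lb : #|lost b (enum 'I_kap.+1)| * 32 <= #|{ffun X -> Col}| * #|I|.
    by rewrite -(leq_pmul2r (ltn0Sn kap)) -mulnA [X in _ <= X]mulnC.
  rewrite -(leq_pmul2r I_gt0); apply: leq_trans lb.
  rewrite -mulnA [32 * _]mulnC mulnA leq_mul2r /= -cardsT -cardsX.
  apply: subset_leq_card; apply/subsetP => -[c i]; rewrite !inE andbT /=.
  (* One surviving index makes [b] succeed, since its fragment has size at most 2^kap %/ 2^(kap + 1)
     = 0. So a colouring for which [b] fails loses every index. *)
  apply: contra => si; have [i' H] := frag_cover si; apply/existsP; exists i'.
  have /= := frag_card T0_le si.
  rewrite {2}/classes !size_map -enumT size_enum_ord divn_small ?leqn0 ?cards_eq0; last first.
    by rewrite expnS ltn_Pmull // expn_gt0.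
  move=> /eqP T_0; rewrite T_0 set0U in H.
  apply: subset_trans H _; apply/subsetP => x.
  rewrite big_map big_map; elim/big_rec: _ => [|j A _ IH]; first by rewrite in_set0.
  by rewrite in_setU => /orP[|/IH//]; rewrite /colour_class !inE => /eqP ->.
apply/existsP; apply: contraT; rewrite negb_exists => /forallP bad.
have : \sum_(c : {ffun X -> Col}) p.+1 <= \sum_(c : {ffun X -> Col}) #|[set b | ~~ ok c b]|.
  apply: leq_sum => c _; have := bad c; rewrite -ltnNge.
  have E : #|[set b | ok c b]| + #|[set b | ~~ ok c b]| = p.*2.
    rewrite -[RHS](card_ord p.*2) -(cardsC [set b | ok c b]); congr (_ + _).
    by apply: eq_card => b; rewrite !inE.
  by move: E; lia.
rewrite sum_nat_const.
have -> : \sum_(c : {ffun X -> Col}) #|[set b | ~~ ok c b]| = \sum_(b : 'I_p.*2) #|[set c | ~~ ok c b]|.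
  rewrite (eq_bigr (fun c => \sum_b (~~ ok c b : nat))); last first.
    by move=> c _; rewrite -sum1dep_card big_mkcond; apply: eq_bigr => b _; case: (ok c b).
  rewrite exchange_big; apply: eq_bigr => b _; rewrite -sum1dep_card [RHS]big_mkcond.
  by apply: eq_bigr => c _; case: (ok c b).
move=> H; have : \sum_(b : 'I_p.*2) #|[set c | ~~ ok c b]| * 32 <= \sum_(b : 'I_p.*2) #|{ffun X -> Col}|.
  by apply: leq_sum.
rewrite -big_distrl /= sum_nat_const card_ord => H2.
have := leq_trans (leq_mul H (leqnn 32)) H2; rewrite -mulnA mulnC leq_pmul2r //; lia.
Qed.

Lemma ffact_lb n k : (n.+1 - k) ^ k <= n ^_ k.
Proof.
elim: k n => [|k IH] [|n] //; first by rewrite subSS sub0n exp0n.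
rewrite ffactSS expnS subSS; apply: leq_mul; first exact: leq_subr.
exact: IH.
Qed.

Lemma fact_le_expn k : k`! <= k ^ k.
Proof.
suff H m : k <= m -> k`! <= m ^ k by exact: H.
elim: k => // k IH km; rewrite factS expnS leq_mul // IH //; exact: ltnW.
Qed.

Section EqualSums.
Variables (n N kap p : nat) (a : 'I_n -> nat).
Let k := 2 ^ kap.
Let r := 64 * kap.+1 * (p.*2 * kap.+1).

(** By pigeonhole more than r^k of the k-subsets share a sum [v]. If [Z] maximizes
    [#|FZ Z| * r ^ #|Z|], the sets S :\: Z with S in [FZ Z] form a spread family, in which
    [spread_cover] finds p disjoint members; removing [Z] lowers each sum by the same amount. *)
Lemma equal_sums_ord : 0 < p -> (forall i, a i < N) -> N <= 2 ^ k ->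
    8 * k * r <= n ->
  exists (B : 'I_p -> {set 'I_n}) v,
    [/\ forall q, B q != set0,
        forall q q', q != q' -> [disjoint B q & B q'] &
        forall q, \sum_(x in B q) a x = v].
Proof.
move=> p_gt0 aN Nk rn.
have k_gt0 : 0 < k by rewrite expn_gt0.
have r_gt0 : 0 < r by rewrite /r !muln_gt0 double_gt0 p_gt0.
pose F v := [set S : {set 'I_n} | (#|S| == k) && (\sum_(x in S) a x == v)].
have sumF : \sum_(v < k * N) #|F v| = 'C(n, k).
  have := card_draws 'I_n k; rewrite card_ord => <-.
  have sum_lt (S : {set 'I_n}) : #|S| = k -> \sum_(x in S) a x < k * N.
    move=> Sk; have [x xS] : exists x, x \in S by apply/card_gt0P; rewrite Sk.
    rewrite -Sk -sum_nat_const (bigD1 x) //= [X in _ < X](bigD1 x) //= -addSn.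
    by apply: leq_add (aN x) _; apply: leq_sum => i _; apply: ltnW.
  rewrite -sum1_card (eq_bigr (fun v : 'I_(k * N) => \sum_(S : {set 'I_n} | #|S| == k)
    (\sum_(x in S) a x == v))); last first.
    move=> v _; rewrite -sum1_card [RHS]big_mkcond [LHS]big_mkcond; apply: eq_bigr => S _.
    by rewrite inE; case: (#|S| == k); case: (_ == _).
  rewrite exchange_big /= big_mkcond [RHS]big_mkcond /=; apply: eq_bigr => S _.
  rewrite inE; case: eqP => // /sum_lt lt_v.
  rewrite (bigD1 (Ordinal lt_v)) //= eqxx big1 // => v.
  by rewrite -val_eqE /= eq_sym => /negPf ->.
have Cbig : k * N * r ^ k < 'C(n, k).
  have kN : k * N < 4 ^ k.
    rewrite (_ : 4 = 2 * 2) // expnMn; apply: leq_ltn_trans (leq_mul (leqnn k) Nk) _.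
    by rewrite ltn_pmul2r ?expn_gt0 // ltn_expl.
  apply: (@leq_trans (4 ^ k * r ^ k)); first by rewrite ltn_pmul2r // expn_gt0 r_gt0.
  rewrite -expnMn -(@leq_pmul2r (k ^ k)) ?expn_gt0 ?k_gt0 //.
  apply: (@leq_trans ('C(n, k) * k`!)); last by rewrite leq_mul2l fact_le_expn orbT.
  rewrite bin_ffact -expnMn; apply: leq_trans (ffact_lb n k).
  rewrite leq_exp2r //; have : k <= k * r by rewrite leq_pmulr.
  by move: rn; rewrite [4 * r * k]mulnAC -!mulnA; lia.
have [v Fv] : exists v, r ^ k < #|F v|.
  suff /existsP[v Fv] : [exists v : 'I_(k * N), r ^ k < #|F v|] by exists (nat_of_ord v).
  apply: contraT; rewrite negb_exists => /forallP small.
  move: Cbig; rewrite ltnNge -sumF.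
  have -> : k * N * r ^ k = \sum_(v < k * N) r ^ k by rewrite sum_nat_const card_ord.
  by rewrite leq_sum // => v _; rewrite leqNgt.
pose FZ (Z : {set 'I_n}) := [set S in F v | Z \subset S].
pose Z := [arg max_(Z > set0) (#|FZ Z| * r ^ #|Z|)].
have Zmax Z' : #|FZ Z'| * r ^ #|Z'| <= #|FZ Z| * r ^ #|Z|.
  by rewrite /Z; case: arg_maxnP => // i _ H; apply: H.
have FZ_big : r ^ k < #|FZ Z| * r ^ #|Z|.
  apply: leq_trans Fv _; apply: leq_trans (Zmax set0).
  rewrite cards0 muln1; apply: subset_leq_card; apply/subsetP => S.
  by rewrite [S \in FZ _]inE sub0set andbT.
pose I := {S : {set 'I_n} | S \in FZ Z}.
pose T0 (i : I) := val i :\: Z.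
have iP (i : I) : [/\ #|val i| = k, \sum_(x in val i) a x = v & Z \subset val i].
  by have := valP i; rewrite !inE => /andP[/andP[/eqP-> /eqP->] ->].
have cardI : #|{: I}| = #|FZ Z| by rewrite card_sig; apply: eq_card.
have I_gt0 : 0 < #|{: I}|.
  by rewrite cardI; case: posnP FZ_big => // ->.
have T0_le i : #|T0 i| <= 2 ^ kap.
  have [ik _ _] := iP i; apply: leq_trans (subset_leq_card (subsetDl _ _)) _.
  by rewrite ik.
have spread (Y : {set 'I_n}) : #|[set i | Y \subset T0 i]| * r ^ #|Y| <= #|{: I}|.
  case: (set_0Vmem [set i | Y \subset T0 i]) => [->|[i0]]; first by rewrite cards0.
  rewrite inE => Yi0; have YZ : [disjoint Y & Z].
    by rewrite (disjointWl Yi0) // -setI_eq0 setIDAC setDIl setDv setI0.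
  have := Zmax (Y :|: Z); rewrite cardsU (disjoint_setI0 YZ) cards0 subn0 expnD mulnA leq_pmul2r ?expn_gt0 ?r_gt0 //.
  rewrite cardI; apply: leq_trans; rewrite leq_mul2r; apply/orP; right.
  rewrite -(card_imset _ val_inj); apply: subset_leq_card; apply/subsetP => S /imsetP[i].
  rewrite inE => Yi ->; have [_ _ Zi] := iP i; have := valP i; rewrite [_ \in FZ Z]inE => /andP[iF _].
  by rewrite inE iF subUset Zi andbT /= (subset_trans Yi) // subsetDl.
(* If a member were empty, [Z] would have k elements and [FZ Z] would be a single set, against r^k <
   [#|FZ Z| * r ^ #|Z|]. *)
have T0_n0 i : T0 i != set0.
  apply/negP => /eqP T00; have [ik _ Zi] := iP i.
  have iZ : val i = Z by apply/eqP; rewrite eqEsubset Zi andbT -setD_eq0 -/(T0 i) T00.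
  have Zk : #|Z| = k by rewrite -iZ.
  move: FZ_big; rewrite Zk -{1}(mul1n (r ^ k)) ltn_pmul2r ?expn_gt0 ?r_gt0 //.
  rewrite ltnNge => /negP[]; rewrite -(cards1 Z); apply: subset_leq_card.
  apply/subsetP => S; rewrite !inE => /andP[/andP[/eqP Sk _] ZS].
  by rewrite eq_sym eqEcard ZS Sk Zk leqnn.
have [c] := spread_cover p_gt0 I_gt0 T0_le spread.
set A := [set b | _] => pA.
pose b (q : 'I_p) : 'I_p.*2 := enum_val (widen_ord pA q).
have bA q : [exists i, T0 i \subset [set x | c x == b q]].
  by have := enum_valP (widen_ord pA q); rewrite inE.
have b_inj : injective b by move=> q q' /enum_val_inj [] /val_inj.
pose ii q : I := xchoose (existsP (bA q)).
have iiP q : T0 (ii q) \subset [set x | c x == b q] := xchooseP (existsP (bA q)).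
exists (fun q => T0 (ii q)), (v - \sum_(x in Z) a x); split=> // [q q' qq'|q].
  apply: disjointWl (iiP q) _; apply: disjointWr (iiP q') _.
  rewrite -setI_eq0; apply/eqP/setP => x; rewrite !inE; apply/negP => /andP[/eqP-> /eqP/b_inj E].
  by rewrite E eqxx in qq'.
have [_ <- Zi] := iP (ii q).
by rewrite [X in X - _](big_setID Z) /= (setIidPr Zi) addnC addnK.
Qed.

End EqualSums.

Lemma uniq_flatten_map (S T : eqType) (f : S -> seq T) (s : seq S) :
  (forall x, uniq (f x)) -> pairwise (fun x y => ~~ has (mem (f x)) (f y)) s ->
  uniq (flatten (map f s)).
Proof.
move=> fu; elim: s => //= x s IH /andP[/allP xs /IH us]; rewrite cat_uniq fu us andbT /=.
apply/hasPn => y /flatten_mapP[z zs yz]; apply/negP => /= yx.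
by have /hasP := xs z zs; case; exists y.
Qed.

(** This is 8 * 2^kap * r with r = 64 * (kap + 1) * (2 p * (kap + 1)), the factor p being left
    out. *)
Definition spread_const (kap : nat) := 1024 * 2 ^ kap * kap.+1 ^ 2.

Lemma equal_sums (T : eqType) (a : T -> nat) (s : seq T) (N kap p : nat) :
    uniq s -> 0 < p -> {in s, forall x, a x < N} -> N <= 2 ^ (2 ^ kap) ->
    spread_const kap * p <= size s ->
  exists (Bs : seq (seq T)) v,
    [/\ size Bs = p, uniq (flatten Bs), {subset flatten Bs <= s} &
      forall B, B \in Bs -> B != [::] /\ \sum_(x <- B) a x = v].
Proof.
move=> us p_gt0 aN Nk ps; pose t := in_tuple s.
have ps' : 8 * 2 ^ kap * (64 * kap.+1 * (p.*2 * kap.+1)) <= size s.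
  apply: leq_trans ps; rewrite /spread_const; lia.
have aN' (i : 'I_(size s)) : a (tnth t i) < N by apply: aN; apply: mem_tnth.
have [B [v [B0 Bdisj Bv]]] := equal_sums_ord p_gt0 aN' Nk ps'.
pose f q := [seq tnth t i | i <- enum (B q)].
have t_inj : injective (tnth t) by apply/tuple_uniqP.
exists [seq f q | q <- enum 'I_p], v; split.
- by rewrite size_map size_enum_ord.
- apply: uniq_flatten_map => [q|]; first by rewrite map_inj_uniq ?enum_uniq.
  have := enum_uniq 'I_p; rewrite uniq_pairwise; apply: sub_pairwise => q q' /= qq'.
  apply/hasPn => _ /mapP[i ii ->]; apply/negP => /mapP[j jj /t_inj E].
  have /pred0P/(_ i) := Bdisj _ _ qq'.
  by rewrite /= -(mem_enum (B q)) -(mem_enum (B q')) ii andbT E jj.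
- by move=> x /flatten_mapP[q _ /mapP[i _ ->]]; apply: mem_tnth.
- move=> _ /mapP[q _ ->]; split; last by rewrite big_map big_enum Bv.
  rewrite -size_eq0 size_map -cardE cards_eq0; exact: B0.
Qed.

(** Groups are extracted greedily for as long as [equal_sums] applies to the rest. *)
Lemma equal_sum_groups (T : eqType) (a : T -> nat) (s : seq T) (N kap p : nat) :
    uniq s -> 0 < p -> {in s, forall x, a x < N} -> N <= 2 ^ (2 ^ kap) ->
  exists (Gs : seq (seq (seq T))) (left : seq T),
    [/\ perm_eq s (flatten (flatten Gs) ++ left), size left < spread_const kap * p &
      forall G, G \in Gs -> size G = p /\
        exists v, forall B, B \in G -> B != [::] /\ \sum_(x <- B) a x = v].
Proof.
move=> + p_gt0 + Nk; have [m] := ubnP (size s); elim: m s => // m IH s sm us aN.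
have [ps|ps] := ltnP (size s) (spread_const kap * p); first by exists [::], s.
have [Bs [v [szB uB sB vB]]] := equal_sums us p_gt0 aN Nk ps.
pose s' := [seq x <- s | x \notin flatten Bs].
have ss' : perm_eq s (flatten Bs ++ s').
  apply: uniq_perm => //.
    rewrite cat_uniq uB filter_uniq // andbT; apply/hasPn => x.
    by rewrite mem_filter => /andP[].
  move=> x; rewrite mem_cat mem_filter; case: (boolP (x \in flatten Bs)) => // /sB -> //.
have s'm : size s' < m.
  have := perm_size ss'; rewrite size_cat => E.
  suff : 0 < size (flatten Bs) by move: sm; lia.
  case: (Bs) szB vB => [|B Bs'] /=; first by move=> E0; rewrite -E0 in p_gt0.
  move=> _ /(_ B (mem_head _ _))[+ _]; by case: B.
have us' : uniq s' by rewrite filter_uniq.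
have [|Gs [left [pG szl GP]]] := IH s' s'm us'.
  by move=> x; rewrite mem_filter => /andP[_ /aN].
exists (Bs :: Gs), left; split => //.
  rewrite /= flatten_cat -catA; apply: perm_trans ss' _; by rewrite perm_cat2l.
move=> G; rewrite inE => /orP[/eqP->|/GP//]; split=> //; by exists v.
Qed.

(** * Cells and levels of the core *)

Notation obj := (nat * nat)%type.
Notation layout := (seq (seq (seq obj))).

Definition scale (o : obj) : nat := trunc_log 2 o.2.
Definition mass (s : seq obj) : nat := \sum_(o <- s) o.2.
(* Cells are stored without gaps, so cells with equal keys can replace each other. *)
Definition key (c : seq obj) : nat * nat := (scale (head (0, 0) c), mass c).
Definition homog (c : seq obj) : bool :=
  (c != [::]) && all (fun o => scale o == (key c).1) c.
Definition cnt (k : nat * nat) (cs : seq (seq obj)) : nat := count (fun c => key c == k) cs.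
(** Mass in units of the scale: a reserve of sigma %/ 2^k.1 cells of key [k] has mass at most 2 *
    sigma * [weight k]. *)
Definition weight (k : nat * nat) : nat := k.2 %/ 2 ^ k.1.
Definition rounded (e w : nat) : bool := (0 < w) && (2 ^ (trunc_log 2 w - e) %| w).

Lemma mass_cat s t : mass (s ++ t) = mass s + mass t.
Proof. exact: big_cat. Qed.

Lemma mass_nil : mass [::] = 0.
Proof. exact: big_nil. Qed.

Lemma mass_cons o s : mass (o :: s) = o.2 + mass s.
Proof. exact: big_cons. Qed.

Lemma perm_mass s t : perm_eq s t -> mass s = mass t.
Proof. exact: perm_big. Qed.

Lemma mass_flatten cs : mass (flatten cs) = \sum_(c <- cs) mass c.
Proof. exact: big_flatten. Qed.

Lemma cnt_cat k cs ds : cnt k (cs ++ ds) = cnt k cs + cnt k ds.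
Proof. exact: count_cat. Qed.

Lemma sum_undup_count (f : nat * nat -> nat) (cs : seq (seq obj)) :
  \sum_(k <- undup (map key cs)) cnt k cs * f k = \sum_(c <- cs) f (key c).
Proof.
transitivity (\sum_(k <- map key cs) f k); last by rewrite big_map.
rewrite -(big_undup_iterop_count addn (map key cs)); apply: eq_bigr => k _.
by rewrite (Monoid.iteropE addn) iter_addn addn0 mulnC /cnt count_map.
Qed.

Lemma leq_sum_seq (T : eqType) (s : seq T) (P : pred T) (f g : T -> nat) :
  (forall x, x \in s -> P x -> f x <= g x) ->
  \sum_(x <- s | P x) f x <= \sum_(x <- s | P x) g x.
Proof.
move=> fg; rewrite big_seq_cond [X in _ <= X]big_seq_cond; apply: leq_sum => x /andP[xs Px].
exact: fg.
Qed.

Lemma leq_sum_pred (T : eqType) (s : seq T) (P Q : pred T) (f : T -> nat) :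
  (forall x, P x -> Q x) -> \sum_(x <- s | P x) f x <= \sum_(x <- s | Q x) f x.
Proof.
move=> PQ; rewrite [X in X <= _]big_mkcond [X in _ <= X]big_mkcond.
by apply: leq_sum => x _; case: ifP => // /PQ ->.
Qed.

Lemma leq_sum_sub (T : eqType) (P : pred T) (f : T -> nat) (s t : seq T) :
  uniq s -> {subset s <= t} -> \sum_(x <- s | P x) f x <= \sum_(x <- t | P x) f x.
Proof.
move=> us st; apply: (@leq_trans (\sum_(x <- undup t | P x) f x)).
  have pE : perm_eq (undup t) (s ++ [seq x <- undup t | x \notin s]).
    apply: uniq_perm; rewrite ?undup_uniq // ?cat_uniq ?us ?filter_uniq ?undup_uniq //.
      by rewrite andbT; apply/hasPn => x; rewrite mem_filter => /andP[].
    move=> x; rewrite mem_cat mem_filter mem_undup.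
    by case: (boolP (x \in s)) => // /st ->.
  by rewrite (perm_big _ pE) big_cat leq_addr.
elim: t {st} => //= x t IH; case: ifP => _; rewrite !big_cons; case: (P x) => //.
- exact: leq_trans IH (leq_addl _ _).
- by rewrite leq_add2l.
Qed.

(** Separates the spare cells to be handed down from those that stay in the level. *)
Lemma take_quota (f : nat * nat -> nat) (cs : seq (seq obj)) :
  exists ds es, perm_eq cs (ds ++ es) /\ forall k, cnt k ds = minn (f k) (cnt k cs).
Proof.
elim: cs => [|c cs [ds [es [pE dE]]]].
  by exists [::], [::]; split=> // k; rewrite minn0.
have [lt_f|ge_f] := ltnP (cnt (key c) ds) (f (key c)).
  exists (c :: ds), es; split=> [|k]; first by rewrite /= perm_cons.
  rewrite /cnt /= -!/(cnt _ _) dE; have [E|] := eqVneq (key c) k => //.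
  by move: lt_f; rewrite dE E /=; lia.
exists ds, (c :: es); split=> [|k].
  by rewrite -(cat1s c es) perm_sym perm_catCA /= perm_cons perm_sym.
rewrite /cnt /= -!/(cnt _ _) dE; have [E|] := eqVneq (key c) k => //.
by move: ge_f; rewrite dE E /=; lia.
Qed.

Lemma scaleP (o : obj) : 0 < o.2 -> 2 ^ scale o <= o.2 < 2 ^ (scale o).+1.
Proof. by move=> o0; rewrite /scale trunc_logP //= trunc_log_ltn. Qed.

Lemma mass_lb i s : all (fun o : obj => 0 < o.2) s -> all (fun o => scale o == i) s ->
  size s * 2 ^ i <= mass s.
Proof.
elim: s => //= o s IH /andP[o0 s0] /andP[/eqP oi si]; rewrite mass_cons mulSn.
by apply: leq_add (IH s0 si); case/andP: (scaleP o0) => + _; rewrite oi.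
Qed.

Lemma mass_ub i s : all (fun o : obj => 0 < o.2) s -> all (fun o => scale o == i) s ->
  mass s <= size s * 2 ^ i.+1.
Proof.
elim: s => [|o s IH] /=; first by rewrite /mass big_nil.
move=> /andP[o0 s0] /andP[/eqP oi si]; rewrite mass_cons mulSn.
apply: leq_add (IH s0 si); case/andP: (scaleP o0) => _; rewrite oi; exact: ltnW.
Qed.

(** * Cutting objects into interchangeable cells *)

Section Split.
Variables (e kap : nat).
Hypothesis kapP : e < 2 ^ kap.
Let R := spread_const kap.

Lemma R_gt0 : 0 < R.
Proof. by rewrite /R /spread_const !muln_gt0 !expn_gt0. Qed.

(** With p = size s %/ (8 R), fewer than R p <= size s / 8 objects are left over, hence at most a
    quarter of the mass. Every key occurs at least p times, so the distinct keys weigh at most a 1 /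
    p share of all cells, which is O(R). If [s] is too short for p to reach 2^(t - i), everything is
    left over and the term 64 R 2^t pays for it. *)
Lemma scale_split t i (s : seq obj) :
    uniq s -> all (fun o => rounded e o.2) s -> all (fun o => scale o == i) s -> i < t ->
  exists G left,
    [/\ perm_eq s (flatten G ++ left), all homog G,
        forall c, c \in G -> (key c).1 = i /\ 2 ^ t <= cnt (key c) G * 2 ^ i,
        \sum_(k <- undup (map key G)) weight k <= 32 * R &
        4 * mass left <= mass s + 64 * R * 2 ^ t].
Proof.
move=> us rs si it.
have s0 : all (fun o : obj => 0 < o.2) s by apply: sub_all rs => o /andP[].
have tE : 2 ^ t = 2 ^ (t - i) * 2 ^ i by rewrite -expnD subnK // ltnW.
have R0 := R_gt0.
have [small|big] := ltnP (size s) (8 * R * 2 ^ (t - i)).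
  exists [::], s; split=> //; first by rewrite big_nil.
  have := mass_ub s0 si; rewrite tE expnS => H.
  have : size s * 2 ^ i <= 8 * R * 2 ^ (t - i) * 2 ^ i by rewrite leq_mul2r ltnW ?orbT.
  lia.
pose p := size s %/ (8 * R).
have R8 : 0 < 8 * R by rewrite muln_gt0.
have tp : 2 ^ (t - i) <= p by rewrite /p leq_divRL // mulnC.
have p_gt0 : 0 < p by apply: leq_trans tp; rewrite expn_gt0.
(* Rounded sizes of scale [i] are multiples of [u] with quotient below 2^(e + 1) <= 2^(2^kap), the
   range in which equal sums are available. *)
pose u := 2 ^ (i - e); have u_gt0 : 0 < u by rewrite expn_gt0.
have us2 o : o \in s -> o.2 = o.2 %/ u * u.
  move=> os; rewrite divnK //; have /andP[_] := allP rs o os.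
  by have /eqP := allP si o os; rewrite /scale => ->.
have aN : {in s, forall o, o.2 %/ u < 2 ^ e.+1}.
  move=> o os; rewrite ltn_divLR // -expnD.
  have := scaleP (allP s0 o os); rewrite (eqP (allP si o os)) => /andP[_ H].
  apply: leq_trans H _; rewrite leq_exp2l //; lia.
have [|Gs [left [pG szl GP]]] := equal_sum_groups us p_gt0 aN (kap := kap).
  by rewrite leq_exp2l.
have sub : {subset flatten (flatten Gs) ++ left <= s} by move=> o; rewrite (perm_mem pG).
have hom c : c \in flatten Gs -> c != [::] -> homog c /\ (key c).1 = i.
  move=> cG c0; have sc o : o \in c -> scale o == i.
    by move=> oc; apply: (allP si); apply: sub; rewrite mem_cat; apply/orP; left; apply/flattenP; exists c.
  suff ci : (key c).1 = i by split=> //; rewrite /homog c0 ci; apply/allP.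
  by case: (c) c0 sc => //= o c' _ /(_ o (mem_head _ _)) /eqP.
have keyE G : G \in Gs -> exists v, forall c, c \in G -> c != [::] /\ key c = (i, v).
  move=> GG; have [_ [v vP]] := GP G GG; exists (v * u) => c cG.
  have cGs : c \in flatten Gs by apply/flattenP; exists G.
  have [c0 cv] := vP c cG; split=> //; have [_ ci] := hom c cGs c0.
  rewrite [LHS]surjective_pairing ci /= -cv /mass big_distrl /=; congr (_, _).
  by apply: eq_big_seq => o oc; apply: us2; apply: sub; rewrite mem_cat; apply/orP; left; apply/flattenP; exists c.
have c0 c : c \in flatten Gs -> c != [::].
  by case/flattenP => G GG cG; have [v vP] := keyE G GG; case: (vP c cG).
have cntp c : c \in flatten Gs -> p <= cnt (key c) (flatten Gs).
  case/flattenP => G GG cG; have [v vP] := keyE G GG; have [szG _] := GP G GG.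
  rewrite /cnt count_flatten sumnE big_map (big_rem G) //=.
  apply: leq_trans (leq_addr _ _); rewrite -szG -size_filter.
  rewrite (_ : [seq _ <- G | _] = G) //; apply/all_filterP/allP => d dG.
  by rewrite (vP c cG).2 (vP d dG).2.
exists (flatten Gs), left; split=> //.
- by apply/allP => c cG; case: (hom c cG (c0 c cG)).
- move=> c cG; case: (hom c cG (c0 c cG)) => _ ->; split=> //.
  by rewrite tE leq_mul2r (leq_trans tp (cntp c cG)) orbT.
- rewrite -(leq_pmul2r p_gt0).
  apply: (@leq_trans (\sum_(c <- flatten Gs) weight (key c))).
    rewrite -sum_undup_count big_distrl /=; apply: leq_sum_seq => k; rewrite mem_undup => /mapP[c cG ->] _.
    by rewrite mulnC leq_mul2r cntp // orbT.
  have : (\sum_(c <- flatten Gs) weight (key c)) * 2 ^ i <= size s * 2 ^ i.+1.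
    apply: leq_trans (mass_ub s0 si); rewrite (perm_mass pG) mass_cat mass_flatten.
    apply: leq_trans (leq_addr _ _); rewrite big_distrl /=; apply: leq_sum_seq => c cG _.
    by case: (hom c cG (c0 c cG)) => _ <-; apply: leq_trunc_div.
  have H1 : size s < p.+1 * (8 * R) by rewrite ltn_ceil.
  rewrite expnS mulnA leq_pmul2r ?expn_gt0 // => H2; apply: leq_trans H2 _.
  have H3 : p.+1 * (8 * R) <= (p + p) * (8 * R) by apply: leq_mul => //; move: (p) p_gt0 => q; lia.
  lia.
- have pR : p * (8 * R) <= size s by exact: leq_trunc_div.
  have l0 : all (fun o : obj => 0 < o.2) left.
    by apply/allP => o ol; apply: (allP s0); apply: sub; rewrite mem_cat ol orbT.
  have li : all (fun o => scale o == i) left.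
    by apply/allP => o ol; apply: (allP si); apply: sub; rewrite mem_cat ol orbT.
  have H1 := mass_ub l0 li; have H2 := mass_lb s0 si.
  apply: leq_trans (leq_addr _ _); apply: leq_trans H2.
  apply: leq_trans (leq_mul (leqnn 4) H1) _.
  rewrite (_ : 4 * _ = 8 * size left * 2 ^ i); last first.
    by rewrite expnS !mulnA; congr (_ * _); rewrite mulnAC.
  rewrite leq_mul2r; apply/orP; right; apply: leq_trans pR.
  by rewrite (mulnC p) -mulnA leq_mul2l /= ltnW.
Qed.

Lemma undup_map_cat_sum (P : pred (nat * nat)) (f : nat * nat -> nat) (s t : seq (nat * nat)) :
  \sum_(k <- undup (s ++ t) | P k) f k <=
  \sum_(k <- undup s | P k) f k + \sum_(k <- undup t | P k) f k.
Proof.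
rewrite -big_cat; apply: leq_sum_sub; first exact: undup_uniq.
by move=> k; rewrite mem_cat !mem_undup mem_cat.
Qed.

Lemma homog_seq1 o : homog [:: o].
Proof. by rewrite /homog /key /= eqxx. Qed.

Lemma flatten_seq1 (T : Type) (s : seq T) : flatten [seq [:: o] | o <- s] = s.
Proof. by elim: s => //= o s ->. Qed.

(** Scales from [t] on never need spares, since a slack below 2^t gives them quota zero; their
    objects become cells of one object each. *)
Lemma free_split t (ss : seq nat) (s : seq obj) :
    uniq ss -> uniq s -> all (fun o => rounded e o.2) s -> all (fun o => scale o \in ss) s ->
  exists G left,
    [/\ perm_eq s (flatten G ++ left), all homog G,
        forall c, c \in G -> (key c).1 < t -> 2 ^ t <= cnt (key c) G * 2 ^ (key c).1,
        \sum_(k <- undup (map key G) | k.1 < t) weight k <= 32 * R * count (fun i => i < t) ss &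
        4 * mass left <= mass s + 64 * R * 2 ^ t * count (fun i => i < t) ss].
Proof.
elim: ss s => [|i ss IH] s /=.
  move=> _ _ _; case: s => // _; exists [::], [::]; split=> //=.
  - by rewrite big_nil.
  - by rewrite /mass big_nil.
move=> /andP[i_ss uss] us rs sis.
pose s1 := [seq o <- s | scale o == i]; pose s2 := [seq o <- s | scale o != i].
have s12 : perm_eq s (s1 ++ s2) by rewrite perm_sym perm_filterC.
have rs1 : all (fun o => rounded e o.2) s1 by apply/allP => o; rewrite mem_filter => /andP[_ /(allP rs)].
have rs2 : all (fun o => rounded e o.2) s2 by apply/allP => o; rewrite mem_filter => /andP[_ /(allP rs)].
have sis2 : all (fun o => scale o \in ss) s2.
  apply/allP => o; rewrite mem_filter => /andP[oi /(allP sis)].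
  by rewrite inE (negPf oi).
have [G2 [l2 [p2 h2 c2 w2 m2]]] := IH s2 uss (filter_uniq _ us) rs2 sis2.
have [G1 [l1 [p1 h1 c1 w1 m1]]] : exists G1 l1,
    [/\ perm_eq s1 (flatten G1 ++ l1), all homog G1,
        forall c, c \in G1 -> (key c).1 < t -> 2 ^ t <= cnt (key c) G1 * 2 ^ (key c).1,
        \sum_(k <- undup (map key G1) | k.1 < t) weight k <= 32 * R * (i < t) &
        4 * mass l1 <= mass s1 + 64 * R * 2 ^ t * (i < t)].
  have si : all (fun o => scale o == i) s1 by apply/allP => o; rewrite mem_filter => /andP[].
  have [it|ti] := ltnP i t.
    have [G [left [pG hG cG wG mG]]] := scale_split (filter_uniq _ us) rs1 si it.
    exists G, left; split=> //; rewrite ?muln1 //.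
      by move=> c /cG[-> + _].
    apply: leq_trans _ wG; rewrite big_mkcond; apply: leq_sum => k _; by case: ifP.
  exists [seq [:: o] | o <- s1], [::]; split.
  - by rewrite flatten_seq1 cats0.
  - by apply/allP => _ /mapP[o _ ->]; apply: homog_seq1.
  - move=> _ /mapP[o os ->]; rewrite /= ltnNge => /negP[].
    by rewrite (eqP (allP si o os)).
  - rewrite big_seq_cond big1 // => k /andP[]; rewrite mem_undup => /mapP[_ /mapP[o os ->] ->].
    by rewrite /= ltnNge (eqP (allP si o os)) ti.
  - by rewrite /mass big_nil.
exists (G1 ++ G2), (l1 ++ l2); split.
- apply: perm_trans s12 _; rewrite flatten_cat -catA.
  apply: perm_trans (perm_cat p1 p2) _; rewrite -!catA perm_cat2l.
  by rewrite perm_catCA.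
- by rewrite all_cat h1.
- move=> c; rewrite mem_cat cnt_cat mulnDl => /orP[cG|cG] ct.
    exact: leq_trans (c1 c cG ct) (leq_addr _ _).
  exact: leq_trans (c2 c cG ct) (leq_addl _ _).
- rewrite map_cat; apply: leq_trans (undup_map_cat_sum _ _ _ _) _.
  by rewrite mulnDr leq_add.
- rewrite mass_cat (perm_mass s12) mass_cat; move: m1 m2; rewrite !mulnDr => m1 m2.
  by have := leq_add m1 m2; rewrite addnACA.
Qed.

(** * Periods, slacks and the construction of the levels *)

Variables (a m : nat).
Definition period j := 2 ^ (a + (m - j)).
Definition slack tau j := (period j).-1 - tau %% period j.
Definition key_bound := 32 * R * m.
(** The terms pay for the spare cells handed down, for the objects that fit no cell and for
    insertions before the next rebuild. With them the bound [F * T j] reproduces itself when [T]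
    halves. *)
Definition cost_const := 8 * m * key_bound + 64 * R * m + 4.
Let T := period.
Let W := key_bound.
Let F := cost_const.
(** Only keys with 2^k.1 < [period j] can have a positive quota at level [j]. *)
Definition level_weight j (K : seq (nat * nat)) :=
  \sum_(k <- undup K | k.1 < a + (m - j)) weight k.

Lemma period_gt0 j : 0 < period j. Proof. by rewrite expn_gt0. Qed.

Lemma slack_lt tau j : slack tau j < period j.
Proof. by apply: leq_ltn_trans (leq_subr _ _) _; rewrite ltn_predL period_gt0. Qed.

Lemma period_mul j l : j <= l -> l <= m -> period j = 2 ^ (l - j) * period l.
Proof. by move=> jl lm; rewrite -expnD; congr (2 ^ _); lia. Qed.

(** Each multiple of a longer period is one of the shorter periods, so later levels are due no
    later. *)
Lemma slack_mono tau j l : j <= l -> l <= m -> slack tau l <= slack tau j.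
Proof.
have aux u v x z t : u + t <= v -> x = u + z -> z < t -> t.-1 - z <= v.-1 - x by lia.
move=> jl lm; rewrite /slack (period_mul jl lm); set q := 2 ^ _; set t := period l.
have t0 : 0 < t by apply: period_gt0.
have q0 : 0 < q by rewrite expn_gt0.
have -> : tau %% t = (tau %% (q * t)) %% t by rewrite modn_dvdm // dvdn_mull.
have qt0 : 0 < q * t by rewrite muln_gt0 q0.
have := ltn_pmod tau qt0; set x := tau %% _ => xlt; have xE := divn_eq x t; have := ltn_pmod x t0.
have : x %/ t < q by rewrite ltn_divLR.
move: xE; set y := x %/ t; set z := x %% t => xE yq zt.
have : (y + 1) * t <= q * t by rewrite leq_mul2r addn1 yq orbT.
by rewrite mulnDl mul1n => H; exact: aux H xE zt.
Qed.

Lemma slack_step tau s j : tau %/ period j = (tau + s) %/ period j ->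
  s <= slack tau j /\ slack (tau + s) j = slack tau j - s.
Proof.
move=> E; have t0 := period_gt0 j; rewrite /slack.
have H1 := divn_eq tau (period j); have H2 := divn_eq (tau + s) (period j).
have := ltn_pmod (tau + s) t0; move: H1 H2; rewrite -E.
move: (tau %% _) ((tau + s) %% _) (tau %/ _ * _) => x y z; lia.
Qed.

Definition good_obj (o : obj) := rounded e o.2 && (2 ^ a <= o.2).

Lemma good_scale o : good_obj o -> a <= scale o.
Proof. by case/andP => /andP[o0 _] H; rewrite -(trunc_expnK a (leqnn 2)) leq_trunc_log. Qed.

Lemma good_gt0 o : good_obj o -> 0 < o.2.
Proof. by case/andP => /andP[]. Qed.

Lemma homog_key_mass c : homog c -> all good_obj c -> 2 ^ (key c).1 <= (key c).2.
Proof.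
case: c => // o c _ /= /andP[/good_gt0 o0 _]; rewrite mass_cons.
by apply: leq_trans (leq_addr _ _); case/andP: (scaleP o0).
Qed.

Lemma homog_key_scale c : homog c -> all good_obj c -> a <= (key c).1.
Proof. by case: c => // o c _ /= /andP[/good_scale o0 _]. Qed.

(** [P] holds cells with keys [K] in use in earlier levels, which must survive as spares; [Fr] may
    be cut at will. At level [j] new cells are cut from [Fr], the quota of every old and new key is
    handed down, surplus cells stay, and uncut objects remain free. What is handed down has mass at
    most [2 * T j * (m * W)] plus about a quarter of the free mass, which fits [F * T j.+1] with
    [T j] to spare for insertions. *)
Lemma rebuild n j (K : seq (nat * nat)) (P : seq (seq obj)) (Fr : seq obj) tau :
    j + n = m -> uniq (flatten P ++ Fr) -> all good_obj (flatten P ++ Fr) -> all homog P ->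
    {in K, forall k, a <= k.1} -> {subset map key P <= K} ->
    {in K, forall k, slack tau j %/ 2 ^ k.1 <= cnt k P} ->
    level_weight j K <= j * W ->
    mass (flatten P ++ Fr) <= F * T j ->
  exists V : seq (seq (seq obj)),
    [/\ size V = n.+1,
        perm_eq (flatten (flatten V)) (flatten P ++ Fr) /\ all homog (flatten V),
        {in K, forall k, cnt k P <= cnt k (flatten V)},
        forall l k, l <= n -> k \in K ++ map key (flatten (take l.+1 V)) ->
          slack tau (j + l) %/ 2 ^ k.1 <= cnt k (flatten (drop l.+1 V)) &
        (forall l, l < n -> mass (flatten (flatten (drop l.+1 V))) + T (j + l) <= F * T (j + l).+1) /\
        (forall l, l <= n -> level_weight (j + l) (K ++ map key (flatten (take l V))) <= (j + l) * W)].
Proof.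
have aux x y z t u v : u <= 2 * x -> 4 * v <= z + y -> z = 8 * x + y + 4 * t ->
  4 * (u + v + t) <= 2 * z by lia.
have aux2 m' w r t : (8 * m' * w + 64 * r * m' + 4) * t =
  8 * (t * (m' * w)) + 64 * r * t * m' + 4 * t by lia.
elim: n j K P Fr => [|n IH] j K P Fr jn uPF gPF hP aK PK qK wK mPF.
  (* The last period is 2^a and all scales are at least [a], so every quota is zero and free objects
     can be cells by themselves. *)
  rewrite addn0 in jn; exists [:: P ++ [seq [:: o] | o <- Fr]]; split=> //=.
  - by rewrite cats0 flatten_cat flatten_seq1 all_cat hP; split=> //; apply/allP => _ /mapP[o _ ->]; apply: homog_seq1.
  - by move=> k kK; rewrite cats0 cnt_cat leq_addr.
  - move=> l k; rewrite leqn0 => /eqP-> /= kK; rewrite addn0 divn_small //.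
    apply: leq_trans (slack_lt tau j) _; rewrite /period jn subnn addn0 leq_exp2l //.
    move: kK; rewrite mem_cat => /orP[/aK//|]; rewrite cats0 => /mapP[c].
    rewrite mem_cat => /orP[cP|/mapP[o oF ->]] ->; first by apply: aK; apply: PK; apply: map_f.
    by apply: good_scale; apply: (allP gPF); rewrite mem_cat oF orbT.
  - split=> // l; rewrite leqn0 => /eqP->; rewrite addn0 take0 /= cats0.
    exact: wK.
have jm : j < m by rewrite -jn addnS ltnS leq_addr.
pose t := a + (m - j); have tE : 2 ^ t = T j by [].
have TE : T j = 2 * T j.+1 by rewrite /T (period_mul (leqnSn j) jm) subSnn.
have rFr : all (fun o => rounded e o.2) Fr.
  by apply/allP => o oF; have /andP[] : good_obj o by apply: (allP gPF); rewrite mem_cat oF orbT.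
have uFr : uniq Fr by move: uPF; rewrite cat_uniq => /and3P[].
pose ss := undup (map scale Fr).
have sFr : all (fun o => scale o \in ss) Fr by apply/allP => o oF; rewrite mem_undup map_f.
have [G [left [pG hG cG wG mG]]] := free_split t (undup_uniq _) uFr rFr sFr.
have ss_m : count (fun i => i < t) ss <= m.
  rewrite -size_filter -[X in _ <= X](size_iota a m); apply: uniq_leq_size.
    by rewrite filter_uniq ?undup_uniq.
  move=> i; rewrite mem_filter mem_undup mem_iota => /andP[it /mapP[o oF iE]].
  rewrite {1}iE good_scale ?(allP gPF) ?mem_cat ?oF ?orbT //=; apply: leq_trans it _.
  by rewrite leq_add2l leq_subr.
have [P1 [P2 [pP12 cP1]]] := take_quota (fun k => slack tau j %/ 2 ^ k.1) (P ++ G).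
pose K' := K ++ map key G.
have gG c : c \in G -> all good_obj c.
  move=> cG0; apply/allP => o oc; apply: (allP gPF); rewrite mem_cat (perm_mem pG) mem_cat.
  by apply/orP; right; apply/orP; left; apply/flattenP; exists c.
have gP c : c \in P -> all good_obj c.
  move=> cP; apply/allP => o oc; apply: (allP gPF); rewrite mem_cat.
  by apply/orP; left; apply/flattenP; exists c.
have aK' : {in K', forall k, a <= k.1}.
  move=> k; rewrite mem_cat => /orP[/aK//|/mapP[c cG0 ->]].
  by apply: homog_key_scale (allP hG _ cG0) (gG _ cG0).
(* A new key of scale below [t] comes with at least 2^t / 2^k.1 cells, more than any slack at level
   [j] requires; for larger scales the quota is zero. *)
have qK' : {in K', forall k, slack tau j %/ 2 ^ k.1 <= cnt k (P ++ G)}.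
  move=> k; rewrite mem_cat cnt_cat => /orP[/qK H|/mapP[c cG0 ->]].
    exact: leq_trans H (leq_addr _ _).
  have [lt_t|ge_t] := ltnP (key c).1 t; last first.
    rewrite divn_small //; apply: leq_trans (slack_lt tau j) _.
    by rewrite leq_exp2l.
  apply: leq_trans (leq_addl _ _).
  rewrite -(@leq_pmul2r (2 ^ (key c).1)) ?expn_gt0 //.
  apply: leq_trans (cG c cG0 lt_t); apply: leq_trans (leq_trunc_div _ _) _.
  exact: ltnW (slack_lt tau j).
have P1E : {in K', forall k, cnt k P1 = slack tau j %/ 2 ^ k.1}.
  by move=> k /qK' H; rewrite cP1; apply/minn_idPl.
have P12_mem c : c \in P1 ++ P2 -> c \in P ++ G by rewrite (perm_mem pP12).
have P12_K c : c \in P1 ++ P2 -> key c \in K'.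
  move/P12_mem; rewrite [c \in _]mem_cat => /orP[cP|cG0]; rewrite mem_cat; apply/orP.
    by left; apply: PK; apply: map_f.
  by right; apply: map_f.
have hP12 : all homog (P1 ++ P2) by rewrite -(perm_all _ pP12) all_cat hP.
have pall : perm_eq (flatten P ++ Fr) (flatten P2 ++ (flatten P1 ++ left)).
  rewrite perm_sym perm_catCA catA -flatten_cat.
  apply: (@perm_trans _ (flatten (P ++ G) ++ left)).
    by rewrite perm_cat2r; apply: perm_flatten; rewrite perm_sym.
  by rewrite flatten_cat -catA perm_cat2l perm_sym.
have wK' : level_weight j K' <= j.+1 * W.
  rewrite mulSn addnC; apply: leq_trans (undup_map_cat_sum _ _ _ _) _.
  apply: leq_add => //; apply: leq_trans wG _; by rewrite leq_mul2l ss_m orbT.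
(* A cell of key [k] has mass at most 2 * [weight k] * 2^k.1 and [slack tau j %/ 2 ^ k.1] of them
   are taken, so [k] contributes at most [2 * T j * weight k]. *)
have P1_0 : mass (flatten P1) <= 2 * T j * (m * W).
  rewrite mass_flatten.
  apply: (@leq_trans (\sum_(c <- P1) (key c).2)); first by [].
  rewrite -(sum_undup_count (fun k => k.2)).
  apply: (@leq_trans (\sum_(k <- undup (map key P1) | k.1 < t) 2 * T j * weight k)).
    rewrite [X in _ <= X]big_mkcond; apply: leq_sum_seq => k; rewrite mem_undup => /mapP[c cP1' ->] _.
    have cP12 : c \in P1 ++ P2 by rewrite mem_cat cP1'.
    rewrite P1E ?P12_K //.
    have [lt_t|ge_t] := ltnP (key c).1 t; last first.
      rewrite divn_small //; apply: leq_trans (slack_lt tau j) _; by rewrite leq_exp2l.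
    set x := 2 ^ _; have x0 : 0 < x by rewrite expn_gt0.
    have gc : all good_obj c by move: (P12_mem _ cP12); rewrite mem_cat => /orP[/gP|/gG].
    have := homog_key_mass (allP hP12 _ cP12) gc; rewrite -/x /weight -/x => xv.
    have H1 := ltn_ceil (key c).2 x0; set q := _ %/ x in H1 *.
    have q0 : 0 < q by rewrite divn_gt0.
    have H2 : (key c).2 <= x * (2 * q).
      apply: leq_trans (ltnW H1) _; rewrite mulnC leq_mul2l; apply/orP; right.
      by rewrite -addn1 mul2n -addnn leq_add2l.
    apply: leq_trans (leq_mul (leqnn _) H2) _; rewrite -(mulnA 2) (mulnCA 2) mulnA leq_mul //.
    exact: leq_trans (leq_trunc_div _ _) (ltnW (slack_lt tau j)).
  rewrite -big_distrr leq_mul2l /=; apply/orP; right.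
  apply: leq_trans (leq_mul jm (leqnn W)); apply: leq_trans wK'.
  apply: leq_sum_sub; first exact: undup_uniq.
  move=> k; rewrite !mem_undup => /mapP[c cP1' ->]; apply: P12_K.
  by rewrite mem_cat cP1'.
have mnew : mass (flatten P1 ++ left) + T j <= F * T j.+1.
  have mFr : mass Fr <= F * T j by apply: leq_trans mPF; rewrite mass_cat leq_addl.
  have mG' : 4 * mass left <= F * T j + 64 * R * T j * m.
    by apply: leq_trans mG _; apply: leq_add => //; rewrite tE leq_mul2l ss_m orbT.
  rewrite mass_cat -(@leq_pmul2l 4) //.
  have -> : 4 * (F * T j.+1) = 2 * (F * T j) by rewrite TE (mulnCA F 2) [RHS]mulnA.
  have : F * T j = 8 * (T j * (m * W)) + 64 * R * T j * m + 4 * T j.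
    exact: aux2.
  move: P1_0 mG'; rewrite -mulnA; exact: aux.
have P1K' : {subset map key P1 <= K'}.
  by move=> k /mapP[c cP1' ->]; apply: P12_K; rewrite mem_cat cP1'.
have u1 : uniq (flatten P1 ++ left).
  by move: uPF; rewrite (perm_uniq pall) cat_uniq => /and3P[].
have g1 : all good_obj (flatten P1 ++ left).
  by move: gPF; rewrite (perm_all _ pall) all_cat => /andP[].
have h1 : all homog P1 by move: hP12; rewrite all_cat => /andP[].
have q1 : {in K', forall k, slack tau j.+1 %/ 2 ^ k.1 <= cnt k P1}.
  by move=> k kK; rewrite P1E // leq_div2r // slack_mono.
have w1 : level_weight j.+1 K' <= j.+1 * W.
  apply: leq_trans wK'; apply: leq_sum_pred => k H; apply: leq_trans H _.
  by rewrite leq_add2l leq_sub2l.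
have m1 : mass (flatten P1 ++ left) <= F * T j.+1 by apply: leq_trans mnew; apply: leq_addr.
have jn' : j.+1 + n = m by rewrite -jn addnS addSn.
have [V [szV [pV hV] cV qV [mV wV]]] := IH j.+1 K' P1 left jn' u1 g1 h1 aK' P1K' q1 w1 m1.
have KK' k : k \in K -> k \in K' by rewrite mem_cat => ->.
exists (P2 :: V); split=> /=.
- by rewrite szV.
- split; last by rewrite all_cat hV andbT; move: hP12; rewrite all_cat => /andP[].
  rewrite flatten_cat perm_sym; apply: perm_trans pall _; by rewrite perm_cat2l perm_sym.
- move=> k kK; apply: (@leq_trans (cnt k (P ++ G))); first by rewrite cnt_cat leq_addr.
  rewrite /cnt (seq.permP pP12) count_cat addnC -/(cnt k P1) count_cat leq_add2l.
  exact: cV (KK' _ kK).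
- case=> [|l] k ln kK.
    rewrite drop0 addn0; have kK' : k \in K'.
      move: kK; rewrite take0 /= cats0 mem_cat => /orP[/KK'//|/mapP[c cP2 ->]].
      by apply: P12_K; rewrite mem_cat cP2 orbT.
    by rewrite -P1E //; apply: cV.
  rewrite addnS -addSn; apply: qV => //.
  move: kK; rewrite map_cat catA mem_cat => /orP[|kV]; last by rewrite mem_cat kV orbT.
  rewrite !mem_cat => /orP[->//|/mapP[c cP2 ->]].
  have := P12_K c; rewrite !mem_cat cP2 orbT => /(_ isT); by case/orP => ->; rewrite ?orbT.
- split=> [[|l] ln|[|l] ln].
  + rewrite addn0 drop0 (perm_mass pV); exact: mnew.
  + by rewrite addnS -addSn; apply: mV.
  + by rewrite addn0 /= cats0.
  + rewrite addnS -addSn; apply: leq_trans (wV l ln).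
    apply: leq_sum_sub; first exact: undup_uniq.
    move=> k; rewrite !mem_undup /= map_cat catA !mem_cat => /orP[/orP[->//|/mapP[c cP2 ->]]|->]; last by rewrite orbT.
    have := P12_K c; rewrite !mem_cat cP2 orbT => /(_ isT); by case/orP => ->; rewrite ?orbT.
Qed.

(** * The invariant of the core under one update *)

Definition flat (st : layout) : seq obj := flatten (flatten st).

(* [slack tau l] is the volume of updates that remains before level [l] is next
   rebuilt. Removing an object of scale i consumes at least 2^i of it and one cell
   of that scale, which explains the quota. *)
Record core_inv (st : layout) (tau : nat) (O : seq obj) : Prop := CoreInv {
  inv_size : size st = m.+1;
  inv_uniq : uniq O;
  inv_good : all good_obj O;
  inv_perm : perm_eq (flat st) O;
  inv_homog : all homog (flatten st);
  inv_quota : forall l k, l <= m -> k \in map key (flatten (take l.+1 st)) ->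
    slack tau l %/ 2 ^ k.1 <= cnt k (flatten (drop l.+1 st));
  inv_mass : forall l, l < m -> mass (flat (drop l.+1 st)) + slack tau l <= F * T l.+1;
  inv_weight : forall l, l <= m -> level_weight l (map key (flatten (take l st))) <= l * W
}.

Lemma core_init O tau : uniq O -> all good_obj O -> mass O <= F * T 0 ->
  exists st, core_inv st tau O.
Proof.
move=> uO gO mO.
have [] // := @rebuild m 0 [::] [::] O tau (add0n m) uO gO isT.
  by rewrite /level_weight /= big_nil.
move=> V [szV [pV hV] _ qV [mV wV]]; exists V; split=> // l lm; apply: leq_trans (mV l lm); rewrite leq_add2l.
exact: ltnW (slack_lt tau l).
Qed.

Lemma flatten_take_drop (st : layout) n : flatten st = flatten (take n st) ++ flatten (drop n st).
Proof. by rewrite -flatten_cat cat_take_drop. Qed.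

Lemma mass_flat_key (cs ds : seq (seq obj)) : map key cs = map key ds ->
  mass (flatten cs) = mass (flatten ds).
Proof.
rewrite !mass_flatten => E.
transitivity (\sum_(k <- map key cs) k.2); first by rewrite big_map.
by rewrite E big_map.
Qed.

Lemma cnt_key k (cs ds : seq (seq obj)) : map key cs = map key ds -> cnt k cs = cnt k ds.
Proof.
have cntE es : cnt k es = count_mem k (map key es) by rewrite count_map.
by rewrite !cntE => ->.
Qed.

Lemma map_key_flatten (st : layout) : map key (flatten st) = flatten (map (map key) st).
Proof. by rewrite map_flatten. Qed.

(** The levels before [js] may exchange only cells of equal key, so their key weights are unchanged.
    Cells of the pool [L] whose key occurs there are kept whole as spares; the others are dissolved,
    since only keys in use may count towards the weight bound. *)
Lemma core_rebuild js (st U : layout) (L : seq (seq obj)) (Fr O O' : seq obj) tau tau' :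
    js <= m -> core_inv st tau O -> map (map key) U = map (map key) (take js st) ->
    uniq O' -> all good_obj O' -> perm_eq (flat U ++ flatten L ++ Fr) O' ->
    all homog (flatten U ++ L) -> mass O' <= F * T 0 ->
    (forall l k, l < js -> k \in map key (flatten (take l.+1 U)) ->
      slack tau' l %/ 2 ^ k.1 <= cnt k (flatten (drop l.+1 U) ++ L)) ->
    (forall l, l < js ->
      mass (flat (drop l.+1 U)) + mass (flatten L ++ Fr) + slack tau' l <= F * T l.+1) ->
  exists V, core_inv (U ++ V) tau' O'.
Proof.
move=> jsm I keyU uO' gO' pO' hUL mO' qU mU.
have szU : size U = js.
  by have := congr1 size keyU; rewrite !size_map size_take (inv_size I) ltnS jsm.
pose K := map key (flatten U).
pose P := [seq c <- L | key c \in K]; pose N := [seq c <- L | key c \notin K].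
pose Fr' := Fr ++ flatten N.
have pL : perm_eq (flatten P ++ Fr') (flatten L ++ Fr).
  rewrite /Fr' perm_catCA perm_catC -flatten_cat perm_cat2r; apply: perm_flatten.
  by rewrite perm_filterC.
have pO2 : perm_eq (flat U ++ (flatten P ++ Fr')) O'.
  by apply: perm_trans pO'; rewrite perm_cat2l.
have uP : uniq (flatten P ++ Fr').
  by move: uO'; rewrite -(perm_uniq pO2) cat_uniq => /and3P[].
have [gU gP] : all good_obj (flat U) /\ all good_obj (flatten P ++ Fr').
  by apply/andP; rewrite -all_cat (perm_all _ pO2).
have [hU hL] : all homog (flatten U) /\ all homog L by apply/andP; rewrite -all_cat.
have hP : all homog P by apply/allP => c; rewrite mem_filter => /andP[_ /(allP hL)].
have aK : {in K, forall k, a <= k.1}.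
  move=> k /mapP[c cU ->]; apply: homog_key_scale (allP hU c cU) _.
  by apply/allP => o oc; apply: (allP gU); apply/flattenP; exists c.
have PK : {subset map key P <= K}.
  by move=> k /mapP[c + ->]; rewrite mem_filter => /andP[].
have cntP : {in K, forall k, cnt k P = cnt k L}.
  move=> k kK; rewrite /cnt count_filter; apply: eq_count => c /=.
  by case: eqP => // ->; rewrite kK.
have qK : {in K, forall k, slack tau' js %/ 2 ^ k.1 <= cnt k P}.
  move=> k kK; rewrite cntP //; case: (posnP js) => [js0|js0].
    by move: kK; rewrite /K (size0nil (etrans szU js0)).
  have := qU js.-1 k; rewrite prednK // take_oversize ?szU // drop_oversize ?szU // => H.
  apply: leq_trans (H (leqnn _) kK); apply: leq_div2r; apply: slack_mono => //; exact: leq_pred.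
have keyUl l : l <= js -> map key (flatten (take l U)) = map key (flatten (take l st)).
  move=> ljs; by rewrite !map_key_flatten ![map _ (take l _)]map_take keyU map_take take_takel.
have wK : level_weight js K <= js * W.
  have := keyUl js (leqnn js); rewrite take_oversize ?szU // => E.
  by rewrite /K E; apply: inv_weight I _ jsm.
have mP : mass (flatten P ++ Fr') <= F * T js.
  rewrite (perm_mass pL); case: (posnP js) => [js0|js0].
    rewrite js0; apply: leq_trans mO'; rewrite -(perm_mass pO') [X in _ <= X]mass_cat; exact: leq_addl.
  have := mU js.-1; rewrite prednK // => /(_ (leqnn _)); apply: leq_trans.
  by rewrite -addnA addnCA leq_addr.
have jn : js + (m - js) = m by rewrite subnKC.
have [V [szV [pV hV] cV qV [mV wV]]] := rebuild jn uP gP hP aK PK qK wK mP.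
exists V; split=> //.
- by rewrite size_cat szU szV addnS jn.
- by rewrite /flat !flatten_cat; apply: perm_trans pO2; rewrite perm_cat2l.
- by rewrite flatten_cat all_cat hU.
- move=> l k lm; have [|jsl] := ltnP l js.
    rewrite leq_eqVlt take_cat drop_cat szU => /predU1P[E|ljs].
      rewrite E ltnn subnn take0 drop0 cats0 => kK.
      apply: leq_trans (cV k kK); rewrite cntP //.
      by have := qU l k; rewrite E leqnn take_oversize ?szU // drop_oversize ?szU //; apply.
    rewrite ljs => kU; rewrite flatten_cat cnt_cat; apply: leq_trans (qU l k (ltnW ljs) kU) _.
    have kK : k \in K.
      by move: kU => /mapP[c cU ->]; apply: map_f; rewrite (flatten_take_drop _ l.+1) mem_cat cU.
    by rewrite cnt_cat leq_add2l -cntP // cV.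
  rewrite take_cat drop_cat szU ltnNge (leqW jsl) /= flatten_cat map_cat.
  rewrite subSn // => kU; have := qV (l - js) k; rewrite subnKC //; apply => //.
  by rewrite leq_sub2r.
- move=> l lm; have [|jsl] := ltnP l js.
    rewrite leq_eqVlt /flat drop_cat szU => /predU1P[E|ljs].
      rewrite E ltnn subnn drop0; have := mU l; rewrite E leqnn => /(_ isT); apply: leq_trans.
      by rewrite leq_add2r (perm_mass pV) (perm_mass pL) leq_addl.
    rewrite ljs !flatten_cat mass_cat; apply: leq_trans (mU l (ltnW ljs)).
    by rewrite (perm_mass pV) (perm_mass pL).
  rewrite /flat drop_cat szU ltnNge (leqW jsl) /= subSn //.
  have := mV (l - js); rewrite subnKC // ltn_sub2r ?(leq_ltn_trans jsl lm) // => /(_ isT).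
  by apply: leq_trans; rewrite leq_add2l; apply: ltnW; apply: slack_lt.
- move=> l lm; have [ljs|jsl] := leqP l js.
    have -> : take l (U ++ V) = take l U.
      rewrite take_cat szU; move: ljs; rewrite leq_eqVlt => /predU1P[->|-> //].
      by rewrite ltnn subnn take0 cats0 take_oversize // szU.
    rewrite keyUl //; exact: inv_weight I _ lm.
  rewrite take_cat szU ltnNge (ltnW jsl) /= flatten_cat map_cat.
  by have := wV (l - js) (leq_sub2r js lm); rewrite subnKC // ltnW.
Qed.

Lemma rem_mass (o : obj) c : o \in c -> mass c = o.2 + mass (rem o c).
Proof. by move=> oc; rewrite (perm_mass (perm_to_rem oc)) mass_cons. Qed.

Lemma cnt_rem k (c : seq obj) (L : seq (seq obj)) : c \in L ->
  cnt k L = (key c == k) + cnt k (rem c L).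
Proof. by move=> cL; rewrite /cnt (seq.permP (perm_to_rem cL)). Qed.

Lemma flat_take_drop st n : flat st = flat (take n st) ++ flat (drop n st).
Proof. by rewrite /flat (flatten_take_drop st n) flatten_cat. Qed.

Lemma homog_scale c o : homog c -> o \in c -> scale o = (key c).1.
Proof. by case/andP => _ /allP H /H /eqP. Qed.

Lemma uniq_flatten_mem (cs : seq (seq obj)) c : uniq (flatten cs) -> c \in cs -> c != [::] ->
  exists A B, [/\ cs = A ++ c :: B, c \notin A & c \notin B].
Proof.
move=> ucs cC c0; case/splitPr: cC ucs => A B; rewrite flatten_cat /= => ucs.
have [o oc] : exists o, o \in c by case: (c) c0 => // o c' _; exists o; apply: mem_head.
have := ucs; rewrite cat_uniq => /and3P[_ /hasPn nA].
rewrite cat_uniq => /and3P[_ /hasPn nB _].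
exists A, B; split=> //; apply/negP => cX.
  have := nA o; rewrite mem_cat oc => /(_ isT) /negP[].
  by apply/flattenP; exists c.
have /nB/negP[] // : o \in flatten B by apply/flattenP; exists c.
Qed.

(** The inserted object, or the rest of the cell hit by a deletion, joins the levels from [js] on,
    which are rebuilt anyway. If the hit cell lies before [js], a cell of equal key is taken from
    the rebuilt part; equal mass keeps the rest of the prefix in place, so that only one cell and
    the suffix [D] can move. *)
Lemma core_step js (st : layout) (O O' : seq obj) o tau :
    js <= m -> core_inv st tau O -> good_obj o ->
    (perm_eq O' (o :: O) /\ o \notin O) \/ (o \in O /\ perm_eq O' (rem o O)) ->
    (forall l, l < js -> tau %/ period l = (tau + o.2) %/ period l) ->
    mass O <= F * T 0 -> mass O' <= F * T 0 ->
  exists2 st', core_inv st' (tau + o.2) O' &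
    exists A c c' B D D', [/\ flat st = A ++ c ++ B ++ D, flat st' = A ++ c' ++ B ++ D',
      mass c = mass c' & mass c + mass D <= 2 * (F * T js)].
Proof.
have aux0 x y s z w : x + y + z <= w -> s <= z -> x + (y + s) + (z - s) <= w by lia.
have aux3 x y s r z w : x + (s + r + y) + z <= w -> s <= z -> x + (y + r) + (z - s) <= w.
  by lia.
have aux1 u l cc r q1 o1 O1 R1 : u + l = O1 -> cc = o1 + r -> O1 = o1 + R1 -> l = cc + q1 ->
  u + (q1 + r) = R1 by lia.
have aux2 fa fb l cc c1 r q1 o1 O1 R1 : fa + (cc + fb) + l = O1 -> cc = o1 + r ->
  O1 = o1 + R1 -> l = c1 + q1 -> fa + (c1 + fb) + (q1 + r) = R1 by lia.
move=> jsm I go op noc mO mO'.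
have uO := inv_uniq I; have gO := inv_good I; have pO := inv_perm I; have hst := inv_homog I.
pose U := take js st; pose L0 := flatten (drop js st).
have uO' : uniq O'.
  case: op => [[p oO]|[oO p]]; first by rewrite (perm_uniq p) /= oO.
  by rewrite (perm_uniq p) rem_uniq.
have gO' : all good_obj O'.
  case: op => [[p oO]|[oO p]]; first by rewrite (perm_all _ p) /= go.
  by rewrite (perm_all _ p); apply/allP => x /mem_rem /(allP gO).
have sl l : l < js -> o.2 <= slack tau l /\ slack (tau + o.2) l = slack tau l - o.2.
  by move/noc/slack_step.
have mD : mass (flat (drop js st)) <= F * T js.
  case: (posnP js) => [->|js0]; first by rewrite drop0 (perm_mass pO).
  have := inv_mass I (l := js.-1); rewrite prednK // => /(_ jsm); apply: leq_trans; exact: leq_addr.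
have szU : size U = js by rewrite size_takel // (inv_size I) leqW.
have dropU l : l < js -> flatten (drop l.+1 st) = flatten (drop l.+1 U) ++ L0.
  rewrite -{1}(cat_take_drop js st) drop_cat -/U szU leq_eqVlt => /predU1P[->|->].
    by rewrite ltnn subnn drop0 (@drop_oversize _ js U) ?szU.
  exact: flatten_cat.
have takeU l : l < js -> take l.+1 U = take l.+1 st by move=> ljs; rewrite take_takel.
have qst l k : l < js -> k \in map key (flatten (take l.+1 U)) ->
    slack tau l %/ 2 ^ k.1 <= cnt k (flatten (drop l.+1 U) ++ L0).
  move=> ljs; rewrite takeU // => kU; rewrite -dropU //; apply: (inv_quota I) kU.
  by apply: leq_trans (ltnW ljs) jsm.
have mst l : l < js -> mass (flat (drop l.+1 U)) + mass (flatten L0) + slack tau l <= F * T l.+1.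
  move=> ljs; have := inv_mass I (l := l) (leq_trans ljs jsm); rewrite /flat dropU //.
  by rewrite flatten_cat mass_cat.
have hU0 : all homog (flatten U) /\ all homog L0.
  by apply/andP; rewrite -all_cat -flatten_take_drop.
have uflat : uniq (flat st) by rewrite (perm_uniq pO).
have gflat : all good_obj (flat st) by rewrite (perm_all _ pO).
case: op => [[p oO]|[oO p]].
  have [] := @core_rebuild js st U L0 [:: o] O O' tau (tau + o.2) jsm I erefl uO' gO' _ _ mO'.
  - rewrite perm_sym; apply: perm_trans p _; rewrite perm_sym catA -(flat_take_drop st js).
    by rewrite perm_catC /= perm_cons.
  - by rewrite all_cat; apply/andP.
  - move=> l k ljs kU; apply: leq_trans (qst l k ljs kU); apply: leq_div2r.
    by have [_ ->] := sl l ljs; apply: leq_subr.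
  - move=> l ljs; have [H1 ->] := sl l ljs; move: (mst l ljs) H1.
    by rewrite [mass (_ ++ _)]mass_cat mass_cons mass_nil addn0; apply: aux0.
  move=> V IV; exists (U ++ V) => //.
  exists (flat U), [::], [::], [::], (flat (drop js st)), (flat V); split=> //=.
  - by rewrite -(flat_take_drop st js).
  - by rewrite /flat !flatten_cat.
  - by rewrite mass_nil add0n; apply: leq_trans mD _; rewrite leq_pmull.
have [cl ccl ocl] : exists2 c, c \in flatten st & o \in c.
  by apply/flattenP; rewrite -/(flat st) (perm_mem pO).
have hc := allP hst cl ccl; have sc := homog_scale hc ocl.
have o0 := good_gt0 go; have c0 : cl != [::] by case: (cl) ocl.
have two_o : 2 ^ (key cl).1 <= o.2 by rewrite -sc; case/andP: (scaleP o0).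
(* Using up one cell of the key of [cl] is matched by a loss of slack of [o.2], at least 2^(key
   cl).1, which lowers the quota for this key by at least one. *)
have drop1 l k n0 n1 : l < js -> n1 + ((key cl) == k) = n0 -> slack tau l %/ 2 ^ k.1 <= n0 ->
    slack (tau + o.2) l %/ 2 ^ k.1 <= n1.
  move=> ljs <-; have [H1 ->] := sl l ljs; case: eqP => [<-|_] /=; last first.
    by rewrite addn0; apply: leq_trans; apply: leq_div2r; apply: leq_subr.
  rewrite addn1 => H; have : (slack tau l - 2 ^ (key cl).1) %/ 2 ^ (key cl).1 <= n1.
    have := leq_trans two_o H1 => H2; have := divnDr (slack tau l - 2 ^ (key cl).1) (dvdnn (2 ^ (key cl).1)).
    by rewrite subnK // divnn expn_gt0 /= => E; move: H; rewrite E addn1 ltnS.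
  by apply: leq_trans; apply: leq_div2r; apply: leq_sub2l.
have pcl q : count q cl = q o + count q (rem o cl) := seq.permP (perm_to_rem ocl) q.
have pOo q : count q O = q o + count q (rem o O) := seq.permP (perm_to_rem oO) q.
have pst q : count q (flat U) + count q (flatten L0) = count q O.
  by rewrite -(seq.permP pO) (flat_take_drop st js) count_cat.
have pO' q : count q O' = count q (rem o O) := seq.permP p q.
have mcl := rem_mass ocl.
have pL0 c' q : c' \in L0 -> count q (flatten L0) = count q c' + count q (flatten (rem c' L0)).
  by move=> c'L; rewrite (seq.permP (perm_flatten (perm_to_rem c'L))) /= count_cat.
have mL0 c' : c' \in L0 -> mass (flatten L0) = mass c' + mass (flatten (rem c' L0)).
  by move=> c'L; rewrite (perm_mass (perm_flatten (perm_to_rem c'L))) /= mass_cat.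
have hL0 c' : all homog (rem c' L0).
  by apply/allP => c /mem_rem cL; case: hU0 => _ /allP; apply.
have := ccl; rewrite (flatten_take_drop st js) mem_cat => /orP[cU|cL]; last first.
  have [] := @core_rebuild js st U (rem cl L0) (rem o cl) O O' tau (tau + o.2) jsm I erefl uO' gO' _ _ mO'.
  - apply/seq.permP => q; rewrite !count_cat pO'.
    exact: aux1 (pst q) (pcl q) (pOo q) (pL0 cl q cL).
  - by rewrite all_cat hL0 andbT; case: hU0.
  - move=> l k ljs kU; apply: drop1 ljs _ (qst l k ljs kU).
    by rewrite !cnt_cat (cnt_rem k cL) -addnA (addnC (cnt k (rem cl L0))).
  - move=> l ljs; have [H1 ->] := sl l ljs; have := mst l ljs.
    by rewrite (mL0 cl cL) mcl [mass (_ ++ _)]mass_cat => H; apply: aux3 H H1.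
  move=> V IV; exists (U ++ V) => //.
  exists (flat U), [::], [::], [::], (flat (drop js st)), (flat V); split=> //=.
  - by rewrite -(flat_take_drop st js).
  - by rewrite /flat !flatten_cat.
  - by rewrite mass_nil add0n; apply: leq_trans mD _; rewrite leq_pmull.
have js0 : 0 < js by case: posnP cU => // js0; rewrite js0 take0.
have ltjs : js.-1 < js by rewrite prednK.
(* [js.-1] is the last level that is not rebuilt. Its slack is still at least [o.2], so its quota
   for this key is positive, and the levels after it are exactly those collected in [L0]. *)
have [c' c'L kc'] : exists2 c', c' \in L0 & key c' = key cl.
  have := qst js.-1 (key cl) ltjs; rewrite prednK // [take _ U]take_oversize ?drop_oversize ?size_take_min ?geq_minl //.
  move=> /(_ (map_f key cU)) H.
  have [H1 _] := sl js.-1 ltjs.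
  have : 0 < cnt (key cl) L0.
    by apply: leq_trans H; rewrite divn_gt0 ?expn_gt0 // (leq_trans two_o).
  rewrite -has_count => /hasP[c' c'L /eqP E].
  by exists c'.
pose f c := if c == cl then c' else c.
pose U' := map (map f) U.
have kf c : key (f c) = key c by rewrite /f; case: eqP => // ->.
have keyU' : map (map key) U' = map (map key) U.
  by rewrite -map_comp; apply: eq_map => cs /=; rewrite -map_comp; apply: eq_map => c /=.
have mapU' (X : layout) : map key (flatten (map (map f) X)) = map key (flatten X).
  by rewrite -map_flatten -map_comp; apply: eq_map => c /=.
have uU : uniq (flatten (flatten U)).
  by move: uflat; rewrite (flat_take_drop st js) cat_uniq => /andP[].
have [A [B [UE nA nB]]] := uniq_flatten_mem uU cU c0.
have U'E : flatten U' = A ++ c' :: B.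
  rewrite /U' -map_flatten UE map_cat /= /f eqxx; congr (_ ++ _ :: _); rewrite -[RHS]map_id; apply/eq_in_map => c cX.
    by case: eqP cX nA => // -> ->.
  by case: eqP cX nB => // -> ->.
have mc' : mass c' = mass cl by have := congr1 snd kc'.
have [] := @core_rebuild js st U' (rem c' L0) (rem o cl) O O' tau (tau + o.2) jsm I keyU' uO' gO' _ _ mO'.
- apply/seq.permP => q; rewrite !count_cat pO' /flat U'E flatten_cat count_cat /= count_cat.
  have := pst q; rewrite /flat UE flatten_cat count_cat /= count_cat => E.
  exact: aux2 E (pcl q) (pOo q) (pL0 c' q c'L).
- rewrite all_cat hL0 andbT U'E; case: hU0; rewrite UE !all_cat /= => /and3P[-> _ ->] /allP H.
  by rewrite H.
- move=> l k ljs kU; apply: drop1 ljs _ (qst l k ljs _).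
    rewrite !cnt_cat (cnt_rem k c'L) kc' -addnA (addnC (cnt k (rem c' L0))).
    by congr (_ + _); rewrite -map_drop; apply: cnt_key.
  by move: kU; rewrite -map_take mapU'.
- move=> l ljs; have [H1 ->] := sl l ljs; have := mst l ljs.
  have -> : mass (flat (drop l.+1 U')) = mass (flat (drop l.+1 U)).
    by rewrite -map_drop; apply: mass_flat_key.
  by rewrite (mL0 c' c'L) mc' mcl [mass (_ ++ _)]mass_cat => H; apply: aux3 H H1.
move=> V IV; exists (U' ++ V) => //.
exists (flatten A), cl, c', (flatten B), (flat (drop js st)), (flat V); split=> //=.
- by rewrite (flat_take_drop st js) /flat UE flatten_cat /= -!catA.
- by rewrite /flat flatten_cat U'E !flatten_cat /= -!catA.
- rewrite mul2n -addnn leq_add // -mc'; apply: leq_trans mD.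
  by rewrite -/L0 /flat -/L0 (mL0 c' c'L) leq_addr.
Qed.

End Split.

(** * Priority hashing of aligned blocks *)

Section Hash.
Variables (D' : nat) (K : finType) (bs : K -> nat).
Let D := D'.+1.
Implicit Types (p : 'S_D) (O : {set 'I_D}) (w : {ffun K -> 'S_D}).

Definition block_cell (z : 'I_D) (b : nat) : {set 'I_D} := [set z' : 'I_D | z' %/ b == z %/ b].

(** The free position of least rank under [p]; [ord0] is returned only when [O] is full. *)
Definition first (p : 'S_D) O : 'I_D :=
  [arg min_(z < odflt ord0 [pick z | z \notin O] | z \notin O) (p z : nat)].

Lemma firstP p O : O != setT ->
  first p O \notin O /\ forall z, z \notin O -> p (first p O) <= p z.
Proof.
move=> OT; rewrite /first; case: arg_minnP => [|z zO H]; last by split=> // z' /H.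
case: pickP => [z //|/= H]; case/negP: OT; apply/eqP/setP => z.
by rewrite inE; exact: negbFE (H z).
Qed.

Lemma first_uniq p O z : O != setT -> z \notin O -> (forall z', z' \notin O -> p z <= p z') ->
  first p O = z.
Proof.
move=> OT zO zmin; have [fO fmin] := firstP p OT.
apply: (@perm_inj _ p); apply/val_inj/eqP; rewrite eqn_leq; apply/andP; split; [exact: fmin | exact: zmin].
Qed.

(** Composition with the transposition of two free positions exchanges the permutations that choose
    them, so the choice is uniform on the complement of [O]. *)
Lemma card_first O (E : {set 'I_D}) : O != setT -> [disjoint E & O] ->
  #|[set p : 'S_D | first p O \in E]| * #|~: O| = #|{: 'S_D}| * #|E|.
Proof.
move=> OT EO; pose N z := #|[set p : 'S_D | first p O == z]|.
have N_eq z z' : z \notin O -> z' \notin O -> N z = N z'.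
  move=> zO z'O; rewrite /N -(card_imset _ (mulgI (tperm z z'))); apply: eq_card => p.
  have mem_tperm y : (tperm z z' y \in O) = (y \in O).
    by case: tpermP => // ->; rewrite (negPf zO) (negPf z'O).
  have first_t q : first (tperm z z' * q)%g O = tperm z z' (first q O).
    have [fO fmin] := firstP q OT; apply: first_uniq => //; first by rewrite mem_tperm.
    by move=> y yO; rewrite !permM tpermK fmin // mem_tperm.
  apply/imsetP/idP => [[q + ->]|]; rewrite !inE => /eqP pz.
    by rewrite first_t pz tpermL.
  exists (tperm z z' * p)%g; last by rewrite mulgA tperm2 mul1g.
  by rewrite inE first_t pz tpermR.
have sumN (A : {set 'I_D}) : #|[set p : 'S_D | first p O \in A]| = \sum_(z in A) N z.
  rewrite -sum1dep_card (partition_big (fun p => first p O) (mem A)) //=.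
  apply: eq_bigr => z zA; rewrite /N -sum1dep_card; apply: eq_bigl => p.
  by case: eqP => [->|]; rewrite ?zA ?andbF.
have [z0 z0O] : exists z, z \notin O.
  by have [fO _] := firstP 1%g OT; exists (first 1%g O).
have sumC (A : {set 'I_D}) : [disjoint A & O] -> #|[set p : 'S_D | first p O \in A]| = #|A| * N z0.
  move=> AO; rewrite sumN (eq_bigr (fun _ => N z0)) ?sum_nat_const // => z zA.
  by apply: N_eq => //; apply: contraL zA => zO; apply/negP => zA; have /pred0P/(_ z) := AO; rewrite /= zA zO.
rewrite (sumC E EO); have := sumC (~: O); rewrite disjoint_sym -setI_eq0 setICr eqxx => /(_ isT).
rewrite (_ : [set p | _] = setT); first by rewrite cardsT => ->; lia.
by apply/setP => p; rewrite !inE; have [-> _] := firstP p OT.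
Qed.

Fixpoint pos w O (ys : seq K) (y : K) : nat :=
  if ys is y0 :: ys' then
    let z := first (w y0) O in
    if y == y0 then (z %/ bs y0) * bs y0 else pos w (O :|: block_cell z (bs y0)) ys' y
  else 0.

(** Equivalently, [O] is a union of cells of length [b], so that a free position lies in a free
    cell. *)
Definition aligned b O := forall z z' : 'I_D, z %/ b = z' %/ b -> z \in O -> z' \in O.

Lemma aligned_dvd b b' O : 0 < b -> b %| b' -> aligned b' O -> aligned b O.
Proof.
move=> b0 /dvdnP[q ->] H z z' E; apply: H.
by rewrite mulnC !divnMA E.
Qed.

Lemma aligned_cell b z : aligned b (block_cell z b).
Proof. by move=> x x' E; rewrite !inE E. Qed.

Lemma aligned_setU b O O' : aligned b O -> aligned b O' -> aligned b (O :|: O').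
Proof.
by move=> H H' z z' E; rewrite !inE => /orP[/(H _ _ E)->|/(H' _ _ E)->] //; rewrite orbT.
Qed.

Lemma cell_disj b O z : aligned b O -> z \notin O -> [disjoint block_cell z b & O].
Proof.
move=> al zO; apply/pred0P => x /=; apply/negP => /andP[]; rewrite inE => /eqP E xO.
by rewrite (al _ _ E xO) in zO.
Qed.

Lemma card_block_cell z b : 0 < b -> b %| D -> #|block_cell z b| = b.
Proof.
move=> b0 bD; rewrite -[RHS]card_ord.
have lt (i : 'I_b) : z %/ b * b + i < D.
  have : z %/ b < D %/ b by rewrite ltn_divLR // divnK.
  move=> H; have : (z %/ b).+1 * b <= D by rewrite -leq_divRL.
  by apply: leq_trans; rewrite mulSn addnC ltn_add2r.
pose f (i : 'I_b) : 'I_D := Ordinal (lt i).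
have f_inj : injective f by move=> i j /(congr1 val) /= /addnI /val_inj.
rewrite -(card_imset _ f_inj); apply: eq_card => x; apply/idP/imsetP => [|[i _ ->]].
  rewrite inE => /eqP E; exists (Ordinal (ltn_pmod x b0)) => //; apply/val_inj => /=.
  by rewrite -E -divn_eq.
by rewrite inE /= divnMDl // (divn_small (ltn_ord i)) addn0.
Qed.

Lemma card_setU_cell b O z : 0 < b -> b %| D -> aligned b O -> z \notin O ->
  #|O :|: block_cell z b| = #|O| + b.
Proof.
move=> b0 bD al zO; rewrite cardsU setIC (disjoint_setI0 (cell_disj al zO)) cards0 subn0.
by rewrite card_block_cell.
Qed.

Lemma setT_neq O n : 0 < n -> #|O| + n <= D -> O != setT.
Proof. by move=> n0 H; apply/eqP => E; move: H; rewrite E cardsT card_ord; lia. Qed.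

(* Sizes decrease along the list, so that a free slot always has a free cell. *)
Definition decreasing (ys : seq K) :=
  [&& all (fun y => (0 < bs y) && (bs y %| D)) ys & pairwise (fun y y' => bs y' %| bs y) ys].

Definition total (ys : seq K) := \sum_(y <- ys) bs y.

Lemma total_cons y ys : total (y :: ys) = bs y + total ys. Proof. exact: big_cons. Qed.

Definition aligned_all (ys : seq K) O := forall y, y \in ys -> aligned (bs y) O.

Lemma decreasing_cons y ys : decreasing (y :: ys) ->
  [/\ 0 < bs y, bs y %| D, forall y', y' \in ys -> 0 < bs y' /\ bs y' %| bs y & decreasing ys].
Proof.
rewrite /decreasing /= => /andP[/andP[/andP[-> ->] H1] /andP[/allP H2 H3]]; split=> //.
  by move=> y' y'ys; split; [case/andP: (allP H1 y' y'ys) | apply: H2].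
by rewrite H1.
Qed.

Lemma aligned_step y ys O z : decreasing (y :: ys) -> aligned_all (y :: ys) O ->
  aligned_all ys (O :|: block_cell z (bs y)).
Proof.
move=> /decreasing_cons[_ _ H _] al y' y'ys; apply: aligned_setU.
  by apply: al; rewrite inE y'ys orbT.
by have [b0 bb] := H _ y'ys; apply: aligned_dvd b0 bb _; apply: aligned_cell.
Qed.

Lemma pos_valid w O ys : uniq ys -> decreasing ys -> aligned_all ys O ->
    #|O| + total ys <= D ->
  (forall y, y \in ys -> [/\ bs y %| pos w O ys y, pos w O ys y < D &
     forall z : 'I_D, z %/ bs y = pos w O ys y %/ bs y -> z \notin O]) /\
  (forall y y' (z : 'I_D), y \in ys -> y' \in ys -> z %/ bs y = pos w O ys y %/ bs y ->
     z %/ bs y' = pos w O ys y' %/ bs y' -> y = y').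
Proof.
elim: ys O => [|y0 ys IH] O //= /andP[y0ys uys] dec al le_D.
have [b0 bD _ dec'] := decreasing_cons dec.
move: le_D; rewrite total_cons => le_D.
have al0 : aligned (bs y0) O by apply: al; rewrite mem_head.
have OT : O != setT by apply: (setT_neq b0); apply: leq_trans le_D; rewrite leq_add2l leq_addr.
have [zO _] := firstP (w y0) OT; set z0 := first _ _ in zO *.
have al' := aligned_step (z := z0) dec al.
have [] := IH _ uys dec' al'; first by rewrite card_setU_cell // -addnA.
move=> I1 I2; split=> [y|y y' z].
  rewrite inE; case: eqP => [-> _|_ /= yys].
    split; first exact: dvdn_mull.
      exact: leq_ltn_trans (leq_trunc_div _ _) (ltn_ord z0).
    move=> z; rewrite mulnK // => E; have := cell_disj al0 zO => /pred0P/(_ z) /=.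
    by rewrite inE E eqxx /= => ->.
  have [H1 H2 H3] := I1 y yys; split=> // z /H3; by rewrite inE negb_or => /andP[].
have key1 (y1 : K) (x : 'I_D) : y1 \in ys -> x %/ bs y1 = pos w (O :|: block_cell z0 (bs y0)) ys y1 %/ bs y1 ->
    x %/ bs y0 <> z0 %/ bs y0.
  move=> y1ys; have [_ _ H] := I1 y1 y1ys => /H; rewrite !inE negb_or => /andP[_ /eqP].
  by [].
rewrite !inE; case: (eqVneq y y0) => [->|ny]; case: (eqVneq y' y0) => [->|ny'] //=.
- by move=> _ y'ys; rewrite mulnK // => E /(key1 _ _ y'ys).
- by move=> yys _ E; rewrite mulnK // => /(key1 _ _ yys E).
- by move=> yys y'ys; apply: I2.
Qed.

Lemma pos_ext w w' O ys y : {in ys, w =1 w'} -> pos w O ys y = pos w' O ys y.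
Proof.
elim: ys O => //= y0 ys IH O ww'; rewrite ww' ?mem_head // IH // => y' y'ys.
by apply: ww'; rewrite inE y'ys orbT.
Qed.

Definition moved w O O' (ys : seq K) : nat :=
  \sum_(y <- ys) bs y * (pos w O ys y != pos w O' ys y).

Lemma moved_ext w w' O O' ys : {in ys, w =1 w'} -> moved w O O' ys = moved w' O O' ys.
Proof.
by move=> E; apply: eq_bigr => y _; rewrite !(pos_ext _ _ E).
Qed.

Definition next w y O := O :|: block_cell (first (w y) O) (bs y).

Lemma first_sub p O O' : O \subset O' -> O' != setT -> first p O \notin O' -> first p O' = first p O.
Proof.
move=> OO' O'T fO'; apply: first_uniq => // z zO'.
have OT : O != setT.
  by apply: contra O'T => /eqP E; rewrite -subTset -E.
by have [_ H] := firstP p OT; apply: H; apply: contra zO'; apply: (subsetP OO').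
Qed.

(** A first choice under [O] that is still free under [O'] is the first choice there too, so [y]
    moves only if its choice falls into the difference. *)
Lemma moved_cons w O O' y ys : y \notin ys ->
    O \subset O' -> O' != setT ->
  moved w O O' (y :: ys) <= bs y * (first (w y) O \in O' :\: O) + moved w (next w y O) (next w y O') ys.
Proof.
move=> yys OO' O'T; rewrite /moved big_cons /= eqxx; apply: leq_add; last first.
  rewrite leq_eqVlt; apply/orP; left; apply/eqP; apply: eq_big_seq => y' y'ys.
  by rewrite (negPf (memPn yys y' y'ys)).
have OT : O != setT by apply: contra O'T => /eqP E; rewrite -subTset -E.
rewrite leq_mul2l; apply/orP; right; rewrite inE; have [fO _] := firstP (w y) OT.
case: (boolP (first (w y) O \in O')) => fO'; first by rewrite fO; case: (_ != _).
by rewrite (first_sub OO') // eqxx.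
Qed.

(** Alignment enters here: if the choice under [O] is occupied in [O'], its whole cell is. *)
Lemma next_sub w O O' y : O \subset O' -> O' != setT -> aligned (bs y) O' ->
  next w y O \subset next w y O'.
Proof.
move=> OO' O'T al; rewrite /next subUset (subset_trans OO' (subsetUl _ _)) /=.
case: (boolP (first (w y) O \in O')) => fO'; last by rewrite (first_sub OO') // subsetUr.
apply: subset_trans (subsetUl _ _); apply/subsetP => z; rewrite inE => /eqP E.
exact: al (esym E) fO'.
Qed.

(** * Expected volume of moved blocks *)

Section Expectation.
Variable R : realFieldType.
Local Open Scope ring_scope.

(** Independence of [w y] from the other coordinates: exchanging [p] with the value of [w] at [y] is
    an involution on the pairs. *)
Lemma sum_coordinate (y : K) (f : 'S_D -> {ffun K -> 'S_D} -> R) :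
    (forall p w w', (forall y', y' != y -> w y' = w' y') -> f p w = f p w') ->
  #|{: 'S_D}|%:R * (\sum_(w : {ffun K -> 'S_D}) f (w y) w) = \sum_(p : 'S_D) \sum_(w : {ffun K -> 'S_D}) f p w.
Proof.
move=> fE; rewrite pair_bigA /=.
pose h (q : 'S_D * {ffun K -> 'S_D}) : 'S_D * {ffun K -> 'S_D} :=
  (q.2 y, [ffun y' => if y' == y then q.1 else q.2 y']).
have hK : involutive h.
  move=> [p w]; rewrite /h /= ffunE eqxx; congr (_, _); apply/ffunP => y'.
  by rewrite !ffunE; case: eqP => // ->.
rewrite (reindex_inj (inv_inj hK)) /=.
rewrite (eq_bigr (fun q : 'S_D * {ffun K -> 'S_D} => f (q.2 y) q.2)); last first.
  by move=> q _; apply: fE => y' ny; rewrite ffunE (negPf ny).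
by rewrite -(pair_bigA _ (fun _ w => f (w y) w)) /= sumr_const mulr_natl.
Qed.

(** Bounds the expected volume moved per position in which the occupied sets differ; [F] is the free
    space when the block is placed. *)
Fixpoint harm (F : R) (ys : seq K) : R :=
  if ys is y :: ys' then (bs y)%:R / F + harm (F - (bs y)%:R) ys' else 0.

(** Both sets gain [bs y], so they stay nested with a difference of constant size. Each block
    chooses a position in this difference with probability [#|O' :\: O|] / [#|~: O|]. *)
Lemma sum_moved ys O O' : uniq ys -> decreasing ys -> aligned_all ys O -> aligned_all ys O' ->
    O \subset O' -> (#|O'| + total ys <= D)%N ->
  \sum_(w : {ffun K -> 'S_D}) (moved w O O' ys)%:R <=
    #|{: {ffun K -> 'S_D}}|%:R * (#|O'| - #|O|)%:R * harm (D%:R - #|O|%:R) ys.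
Proof.
elim: ys O O' => [|y ys IH] O O'.
  by move=> *; rewrite /= mulr0 big1 // => w _; rewrite /moved big_nil.
move=> /andP[yys uys] dec al al' OO' leD.
have [b0 bD _ dec'] := decreasing_cons dec.
have aly : aligned (bs y) O by apply: al; rewrite mem_head.
have aly' : aligned (bs y) O' by apply: al'; rewrite mem_head.
rewrite total_cons in leD.
have leO'b : (#|O'| + bs y <= D)%N by apply: leq_trans leD; rewrite leq_add2l leq_addr.
have O'T : O' != setT := setT_neq b0 leO'b.
have OT : O != setT by apply: contra O'T => /eqP E; rewrite -subTset -E.
have S0 : 0 < #|{: 'S_D}|%:R :> R.
  by rewrite ltr0n; apply/card_gt0P; exists 1%g.
set nS := #|{: 'S_D}|; set nW := #|{: {ffun K -> 'S_D}}|.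
have cO : (#|O'| <= D)%N by apply: leq_trans leO'b; apply: leq_addr.
have OO'c : (#|O| <= #|O'|)%N := subset_leq_card OO'.
have cD : D%:R - #|O|%:R = #|~: O|%:R :> R.
  by rewrite -{1}(card_ord D) -(cardsC O) natrD addrC addKr.
have cC0 : 0 < #|~: O|%:R :> R.
  rewrite -cD subr_gt0 ltr_nat; apply: leq_ltn_trans OO'c _.
  by apply: leq_trans leO'b; rewrite -addn1 leq_add2l.
have part1 : nS%:R * \sum_(w : {ffun K -> 'S_D}) ((bs y)%:R * (first (w y) O \in O' :\: O)%:R) =
    nS%:R * (nW%:R * (#|O'| - #|O|)%:R * ((bs y)%:R / (D%:R - #|O|%:R))) :> R.
  rewrite (sum_coordinate (f := fun p w => (bs y)%:R * (first p O \in O' :\: O)%:R)) //.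
  rewrite (eq_bigr (fun p : 'S_D => (bs y)%:R * (first p O \in O' :\: O)%:R * nW%:R)); last first.
    by move=> p _; rewrite sumr_const [RHS]mulr_natr.
  rewrite -mulr_suml -mulr_sumr -natr_sum.
  have -> : (\sum_p (first p O \in O' :\: O) = #|[set p : 'S_D | first p O \in O' :\: O]|)%N.
    by rewrite -sum1dep_card [RHS]big_mkcond; apply: eq_bigr => p _; case: (_ \in _).
  have H := card_first OT (_ : [disjoint O' :\: O & O]).
  have {}H : (#|[set p : 'S_D | first p O \in O' :\: O]| * #|~: O| = nS * (#|O'| - #|O|))%N.
    by rewrite H ?cardsDS // -setI_eq0 setIDAC setDIl setDv setI0.
  have {}H : #|[set p : 'S_D | first p O \in O' :\: O]|%:R = nS%:R * (#|O'| - #|O|)%:R / #|~: O|%:R :> R.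
    by rewrite -natrM -H natrM mulfK ?gt_eqF.
  by rewrite H cD; move: (bs y)%:R (nS%:R) (_ - _)%:R (nW%:R) (_^-1) => u v x t c; ring.
pose g p w' := (moved w' (O :|: block_cell (first p O) (bs y)) (O' :|: block_cell (first p O') (bs y)) ys)%:R : R.
have part2 : nS%:R * \sum_(w : {ffun K -> 'S_D}) (moved w (next w y O) (next w y O') ys)%:R <=
    nS%:R * (nW%:R * (#|O'| - #|O|)%:R * harm (D%:R - #|O|%:R - (bs y)%:R) ys) :> R.
  rewrite (sum_coordinate (f := g)); last first.
    move=> p w w' E; congr (_%:R); apply: moved_ext => y' y'ys; apply: E.
    exact: (memPn yys).
  have -> : nS%:R * (nW%:R * (#|O'| - #|O|)%:R * harm (D%:R - #|O|%:R - (bs y)%:R) ys) =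
     \sum_(p : 'S_D) (nW%:R * (#|O'| - #|O|)%:R * harm (D%:R - #|O|%:R - (bs y)%:R) ys) :> R.
    by rewrite sumr_const mulr_natl.
  apply: ler_sum => p _; rewrite /g.
  pose w := [ffun _ : K => p]; have wy : w y = p by rewrite ffunE.
  have [fO _] := firstP p OT; have [fO' _] := firstP p O'T.
  have := IH (next w y O) (next w y O') uys dec' (aligned_step dec al) (aligned_step dec al').
  rewrite next_sub // /next wy !card_setU_cell // => /(_ isT).
  rewrite -addnA => /(_ leD); rewrite subnDr natrD opprD addrA; exact.
rewrite -(ler_pM2l S0); apply: le_trans (_ : _ <= nS%:R * (\sum_(w : {ffun K -> 'S_D}) ((bs y)%:R * (first (w y) O \in O' :\: O)%:R)) +
  nS%:R * \sum_(w : {ffun K -> 'S_D}) (moved w (next w y O) (next w y O') ys)%:R) _.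
  rewrite -mulrDr ler_pM2l // -big_split; apply: ler_sum => w _ /=.
  by rewrite -natrM -natrD ler_nat; apply: moved_cons.
by rewrite part1 /= mulrDr mulrDr lerD2l; exact: part2.
Qed.

Definition moved_insert w O ys x zs : nat :=
  (\sum_(y <- ys ++ zs) bs y * (pos w O (ys ++ zs) y != pos w O (ys ++ x :: zs) y))%N.

(** The blocks before [x] do not see it. For those after it, [x] is a cell of length [bs x] added to
    the occupied set, so [sum_moved] applies. *)
Lemma sum_moved_insert ys x zs O : uniq (ys ++ x :: zs) -> decreasing (ys ++ x :: zs) ->
    aligned_all (ys ++ x :: zs) O -> (#|O| + total (ys ++ x :: zs) <= D)%N ->
  \sum_(w : {ffun K -> 'S_D}) (moved_insert w O ys x zs)%:R <=
    #|{: {ffun K -> 'S_D}}|%:R * (bs x)%:R * harm (D%:R - #|O|%:R - (total ys)%:R) zs.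
Proof.
have S0 : 0 < #|{: 'S_D}|%:R :> R.
  by rewrite ltr0n; apply/card_gt0P; exists 1%g.
elim: ys O => [|y ys IH] O /= /andP[yys uys] dec al leD; rewrite total_cons in leD.
  have [b0 bD xzs dec'] := decreasing_cons dec.
  have alx : aligned (bs x) O by apply: al; rewrite mem_head.
  have leOb : (#|O| + bs x <= D)%N by apply: leq_trans leD; rewrite leq_add2l leq_addr.
  have OT : O != setT := setT_neq b0 leOb.
  rewrite /total big_nil subr0 -(ler_pM2l S0).
  pose g p w' := (moved w' O (O :|: block_cell (first p O) (bs x)) zs)%:R : R.
  have -> : \sum_(w : {ffun K -> 'S_D}) (moved_insert w O [::] x zs)%:R = \sum_(w : {ffun K -> 'S_D}) g (w x) w.
    apply: eq_bigr => w _; congr (_%:R); apply: eq_big_seq => y yzs /=.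
    by rewrite (negPf (memPn yys y yzs)).
  rewrite sum_coordinate; last first.
    move=> p w w' E; congr (_%:R); apply: moved_ext => y' y'ys; apply: E.
    exact: (memPn yys).
  set B := _ * harm _ _; have -> : #|{: 'S_D}|%:R * B = \sum_(p : 'S_D) B.
    by rewrite sumr_const mulr_natl.
  apply: ler_sum => p _; have [fO _] := firstP p OT.
  have alz : aligned_all zs O by move=> y yzs; apply: al; rewrite inE yzs orbT.
  have := sum_moved uys dec' alz (aligned_step (z := first p O) dec al) (subsetUl _ _).
  by rewrite card_setU_cell // -addnA addKn => /(_ leD).
have [b0 bD xzs dec'] := decreasing_cons dec.
have aly : aligned (bs y) O by apply: al; rewrite mem_head.
have leOb : (#|O| + bs y <= D)%N by apply: leq_trans leD; rewrite leq_add2l leq_addr.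
have OT : O != setT := setT_neq b0 leOb.
rewrite total_cons natrD opprD addrA -(ler_pM2l S0).
pose g p w' := (moved_insert w' (O :|: block_cell (first p O) (bs y)) ys x zs)%:R : R.
have sub : {subset ys ++ zs <= ys ++ x :: zs}.
  by move=> z; rewrite !mem_cat inE => /orP[->//|->]; rewrite !orbT.
have -> : \sum_(w : {ffun K -> 'S_D}) (moved_insert w O (y :: ys) x zs)%:R = \sum_(w : {ffun K -> 'S_D}) g (w y) w.
  apply: eq_bigr => w _; congr (_%:R); rewrite /moved_insert /= big_cons /= !eqxx muln0 add0n.
  apply: eq_big_seq => z /sub zz /=.
  by rewrite (negPf (memPn yys z zz)).
rewrite sum_coordinate; last first.
  move=> p w w' E; congr (_%:R); apply: eq_big_seq => z zz.
  by congr (_ * (_ != _))%N; apply: pos_ext => z' /[dup] z'z; [move/sub| ] => z'zz; apply: E; apply: (memPn yys).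
set B := _ * harm _ _; have -> : #|{: 'S_D}|%:R * B = \sum_(p : 'S_D) B.
  by rewrite sumr_const mulr_natl.
apply: ler_sum => p _; have [fO _] := firstP p OT.
have := IH (O :|: block_cell (first p O) (bs y)) uys dec' (aligned_step (z := first p O) dec al).
rewrite card_setU_cell // -addnA => /(_ leD).
by rewrite natrD opprD addrA.
Qed.

End Expectation.
End Hash.

(** * Rounding and random phases *)

Section Rounding.
Variable e : nat.

Definition unit_of (w : nat) := 2 ^ (trunc_log 2 w - e).
Definition rup (w : nat) := (w + (unit_of w).-1) %/ unit_of w * unit_of w.

Lemma unit_gt0 w : 0 < unit_of w. Proof. by rewrite expn_gt0. Qed.

Lemma rup_ge w : w <= rup w.
Proof.
have := unit_gt0 w; rewrite /rup; move: (unit_of w) => u u0.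
have := ltn_ceil (w + u.-1) u0; rewrite mulSn; lia.
Qed.

Lemma rup_lt w : rup w < w + unit_of w.
Proof.
have u0 := unit_gt0 w; have := leq_trunc_div (w + (unit_of w).-1) (unit_of w).
rewrite -/(rup w) => H; apply: leq_ltn_trans H _; by rewrite ltn_add2l ltn_predL.
Qed.

Lemma rup_gt0 w : 0 < w -> 0 < rup w.
Proof. by move=> w0; apply: leq_trans (rup_ge w). Qed.

Lemma rup_excess w : 0 < w -> (rup w - w) * 2 ^ e <= w.
Proof.
move=> w0; have := rup_lt w; rewrite /unit_of; have [le|lt] := leqP (trunc_log 2 w) e.
  have -> : trunc_log 2 w - e = 0 by apply/eqP; rewrite subn_eq0.
  by rewrite addn1 ltnS -subn_eq0 => /eqP ->.
move=> H; apply: leq_trans (trunc_logP (leqnn 2) w0).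
rewrite -{1}(subnK (ltnW lt)) expnD leq_mul2r; apply/orP; right.
by rewrite leq_subLR ltnW.
Qed.

Lemma rup_le2 w : 0 < w -> rup w <= w + w.
Proof.
move=> w0; have := rup_excess w0; have : 0 < 2 ^ e by rewrite expn_gt0.
have : w <= rup w := rup_ge w. move: (rup w) (2 ^ e) => r p wr p0 H.
have : (r - w) * 1 <= (r - w) * p by rewrite leq_mul2l p0 orbT.
lia.
Qed.

(** Rounding up may reach the next power of two, where the unit can double; the power itself is
    still divisible by it. *)
Lemma rup_rounded w : 0 < w -> rounded e (rup w).
Proof.
move=> w0; rewrite /rounded rup_gt0 //=.
have := trunc_log_bounds (leqnn 2) w0 => /andP[lo hi].
have up : rup w <= 2 ^ (trunc_log 2 w).+1.
  have d : unit_of w %| 2 ^ (trunc_log 2 w).+1.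
    by rewrite /unit_of dvdn_exp2l // (leq_trans (leq_subr _ _)).
  have /dvdnP[k kE] := d; rewrite kE /rup leq_mul2r; apply/orP; right.
  rewrite -ltnS ltn_divLR ?unit_gt0 // mulSn -kE; have := unit_gt0 w; move: hi; move: (2 ^ _) (unit_of w); lia.
have [lt|ge] := ltnP (rup w) (2 ^ (trunc_log 2 w).+1).
  have -> : trunc_log 2 (rup w) = trunc_log 2 w.
    by apply: trunc_log_eq => //; rewrite lt (leq_trans lo) // rup_ge.
  exact: dvdn_mull.
have -> : rup w = 2 ^ (trunc_log 2 w).+1 by apply/eqP; rewrite eqn_leq up ge.
by rewrite trunc_expnK // dvdn_exp2l // leq_subr.
Qed.

End Rounding.

(** * Crossings of multiples under a random shift *)

Definition crossings (T x s theta : nat) := (x + s + theta) %/ T - (x + theta) %/ T.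

Lemma crossings_mod T x s theta :
  (x + s + theta %% T) %/ T - (x + theta %% T) %/ T = crossings T x s theta.
Proof.
have [->|T0] := posnP T; first by rewrite /crossings !divn0.
rewrite /crossings {3 4}(divn_eq theta T) (addnCA (x + s)) (addnCA x) !divnMDl //.
by rewrite subnDl.
Qed.

(** Raising y by one exchanges the term y %/ T of [S y] for (y + Theta) %/ T, a gain of Theta %/ T
    that does not depend on y. *)
Lemma sum_crossings T x s Theta : 0 < T -> T %| Theta ->
  (\sum_(theta < Theta) crossings T x s theta) * T = Theta * s.
Proof.
move=> T0 TT; pose S y := \sum_(0 <= theta < Theta) (y + theta) %/ T.
have SS y : S y.+1 = S y + Theta %/ T.
  have H : S y.+1 + y %/ T = S y + (y + Theta) %/ T.
    rewrite /S -(big_nat_recr Theta 0 (fun t => (y + t) %/ T)) //= big_nat_recl //.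
    rewrite addn0 addnC; congr (_ + _); apply: eq_bigr => i _; by rewrite addSnnS.
  have E : (y + Theta) %/ T = y %/ T + Theta %/ T by rewrite divnDr.
  move: H; rewrite E; lia.
have Sadd n : S (x + n) = S x + n * (Theta %/ T).
  elim: n => [|n IH]; first by rewrite addn0 mul0n addn0.
  by rewrite addnS SS IH mulSn; lia.
have : \sum_(theta < Theta) crossings T x s theta = S (x + s) - S x.
  rewrite /S !big_mkord -sumnB // => i _; apply: leq_div2r; lia.
rewrite Sadd addKn => ->; by rewrite -mulnA divnK // mulnC.
Qed.

(* The random threshold between phases makes an update of size s change the phase
   with probability O(s / L). *)
Definition phase (L theta : nat) :=
  let l := trunc_log 2 L in if 2 ^ l.+1 <= L + theta %% 2 ^ l then l else l.-1.

Lemma phase_near L theta : phase L theta = trunc_log 2 L \/ phase L theta = (trunc_log 2 L).-1.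
Proof. by rewrite /phase; case: ifP; [left|right]. Qed.

Lemma phase_bounds L theta : 0 < L -> 2 ^ phase L theta <= L < 2 ^ (phase L theta + 2).
Proof.
move=> L0; have := trunc_log_bounds (leqnn 2) L0 => /andP[lo hi]; rewrite /phase.
case: ifP => H; apply/andP; split=> //.
- by apply: leq_trans hi _; rewrite leq_exp2l // addn2.
- by apply: leq_trans lo; rewrite leq_exp2l // leq_pred.
move: lo hi H; case: (trunc_log 2 L) => [|l] lo hi H; last by rewrite addn2.
by apply: leq_trans hi _; rewrite leq_exp2l.
Qed.

Lemma crossing_of_reach T x s theta k : 0 < T ->
  x + theta %% T < k * T -> k * T <= x + s + theta %% T -> 0 < crossings T x s theta.
Proof.
move=> T0 H1 H2; rewrite -crossings_mod subn_gt0.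
apply: (@leq_trans k); first by rewrite ltn_divLR.
by rewrite leq_divRL.
Qed.

(** After the shift by theta, the threshold of [phase] at scale l is 2 * 2^l, a multiple of 2^l. If
    [L] is already in phase l, a change can only occur at the threshold of the next scale, which is
    a multiple of 2^(l + 1). *)
Lemma phase_change L s theta : s < L -> phase L theta != phase (L + s) theta ->
  0 < crossings (2 ^ trunc_log 2 L) L s theta + crossings (2 ^ (trunc_log 2 L).+1) L s theta.
Proof.
move=> sL; have L0 : 0 < L by case: L sL.
have Ls0 : 0 < L + s by rewrite addn_gt0 L0.
have := trunc_log_bounds (leqnn 2) L0 => /andP[]; set l := trunc_log 2 L => lo hi.
have := trunc_log_bounds (leqnn 2) Ls0 => /andP[]; rewrite /phase -/l; set l' := trunc_log 2 (L + s) => lo' hi'.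
have E2 k : 2 ^ k.+1 = 2 * 2 ^ k by rewrite expnS.
have p0 k : 0 < 2 ^ k by rewrite expn_gt0.
have ll' : l <= l' by apply: leq_trunc_log; apply: leq_addr.
have l'l : l' <= l.+1.
  rewrite -ltnS -(@ltn_exp2l 2) //; apply: leq_ltn_trans lo' _.
  rewrite E2; move: (2 ^ l.+1) hi; lia.
rewrite addn_gt0; have [l'E|ne] := eqVneq l' l.
  rewrite l'E; case: ifP => H1; case: ifP => H2; rewrite ?eqxx // => _.
    by move: H2; rewrite (leq_trans H1) // leq_add2r leq_addr.
  apply/orP; left; apply: (@crossing_of_reach _ _ _ _ 2) => //; first by rewrite -E2 ltnNge H1.
  by rewrite -E2.
have l'E : l' = l.+1 by apply/eqP; rewrite eqn_leq l'l ltn_neqAle eq_sym ne.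
rewrite l'E; case: ifP => H1; last first.
  move=> _; apply/orP; left; apply: (@crossing_of_reach _ _ _ _ 2) => //; first by rewrite -E2 ltnNge H1.
  by rewrite -E2 -l'E (leq_trans lo') // leq_addr.
case: ifP => H2; rewrite ?eqxx // => _.
apply/orP; right; apply: (@crossing_of_reach _ _ _ _ 2) => //.
by rewrite mul2n -addnn -addSn leq_add // ltnW // ltn_pmod.
Qed.

(* The last item takes the place of [x]: at most one other index changes. *)
Definition swap_del (T : eqType) (x : T) (s : seq T) : seq T :=
  if rev s is y :: s' then [seq if z == x then y else z | z <- rev s'] else [::].

Lemma swap_del_rcons (T : eqType) (x y : T) s :
  swap_del x (rcons s y) = [seq if z == x then y else z | z <- s].
Proof. by rewrite /swap_del rev_rcons revK. Qed.

Lemma swap_delP (T : eqType) (x : T) s : uniq s -> x \in s ->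
  [/\ uniq (swap_del x s), swap_del x s =i [pred z in s | z != x], size s = (size (swap_del x s)).+1 &
    exists y, forall z, z \in s -> z != x -> z != y -> index z (swap_del x s) = index z s].
Proof.
case/lastP: s => [//|s y]; rewrite swap_del_rcons rcons_uniq => /andP[ys us] xs.
have mem z : (z \in [seq if z == x then y else z | z <- s]) = (z \in rcons s y) && (z != x).
  rewrite mem_rcons inE; apply/mapP/andP => [[t ts ->]|[/orP[/eqP->|zs] zx]].
  - case: (eqVneq t x) => [tx|->]; last by rewrite ts orbT.
    by rewrite eqxx; split=> //; apply: contraNneq ys => ->; rewrite -tx.
  - move: xs; rewrite mem_rcons inE eq_sym (negPf zx) /= => xs; exists x => //; by rewrite eqxx.
  - by exists z => //; rewrite (negPf zx).
split.
- rewrite map_inj_in_uniq // => t t' ts t's; case: eqP => [->|_]; case: eqP => [->|_] //= E.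
    by move: t's; rewrite -E (negPf ys).
  by move: ts; rewrite E (negPf ys).
- by move=> z; rewrite mem inE.
- by rewrite size_rcons size_map.
exists y => z; rewrite mem_rcons inE => /orP[/eqP->|zs] zx zy; first by rewrite eqxx in zy.
rewrite -cats1 index_cat zs; elim: s zs {ys us xs mem} => //= t s IH.
rewrite inE; have [->|tz] := eqVneq t z; first by rewrite (negPf zx) eqxx.
move=> /= zs; rewrite IH //.
by have -> : ((if t == x then y else t) == z) = false by
  case: ifP => _; [rewrite eq_sym (negPf zy)|rewrite (negPf tz)].
Qed.
From mathcomp Require Import finmap.
From Stdlib Require Import ClassicalEpsilon.

(** * Positions in a list stored without gaps *)

Definition lpos (s : seq obj) (x : nat) : nat := mass (take (find (fun o => o.1 == x) s) s).

Lemma lpos_cons o s x : lpos (o :: s) x = if o.1 == x then 0 else o.2 + lpos s x.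
Proof. by rewrite /lpos /=; case: ifP => _; rewrite ?mass_nil ?mass_cons. Qed.

Lemma lpos_catl s t x : x \in map fst s -> lpos (s ++ t) x = lpos s x.
Proof.
elim: s => //= o s IH; rewrite inE !lpos_cons eq_sym; case: eqP => //= _ xs.
by rewrite IH.
Qed.

Lemma lpos_catr s t x : x \notin map fst s -> lpos (s ++ t) x = mass s + lpos t x.
Proof.
elim: s => [|o s IH] /=; first by rewrite mass_nil.
rewrite inE negb_or eq_sym lpos_cons mass_cons => /andP[/negPf-> xs].
by rewrite IH // addnA.
Qed.

Lemma lpos_le s (o : obj) : uniq (map fst s) -> o \in s -> lpos s o.1 + o.2 <= mass s.
Proof.
elim: s => //= o' s IH /andP[o's us]; rewrite inE lpos_cons mass_cons => /predU1P[->|os].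
  by rewrite eqxx leq_addr.
by case: eqP => [E|_]; [rewrite E map_f in o's | rewrite -addnA leq_add2l IH].
Qed.

Lemma lpos_disjoint s (o o' : obj) : uniq (map fst s) -> o \in s -> o' \in s -> o.1 != o'.1 ->
  (lpos s o.1 + o.2 <= lpos s o'.1) || (lpos s o'.1 + o'.2 <= lpos s o.1).
Proof.
elim: s => //= h s IH /andP[hs us]; rewrite !inE !lpos_cons.
move=> /predU1P[->|os] /predU1P[->|o's] ne; rewrite ?eqxx ?(negPf ne) //.
- by rewrite eqxx in ne.
- by rewrite add0n leq_addr.
- by rewrite eq_sym (negPf ne) add0n leq_addr orbT.
case: eqP => [E|_]; first by rewrite E map_f in hs.
case: eqP => [E|_]; first by rewrite E map_f in hs.
by rewrite -!addnA !leq_add2l IH.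
Qed.

(** Objects of [A] and [B] are preceded by equal masses in both lists, because [c] and [c'] have
    equal mass. *)
Lemma lpos_moved (A c c' B D D' : seq obj) :
    uniq (map fst (A ++ c ++ B ++ D)) -> uniq (map fst (A ++ c' ++ B ++ D')) -> mass c = mass c' ->
  \sum_(o <- A ++ c ++ B ++ D | lpos (A ++ c ++ B ++ D) o.1 != lpos (A ++ c' ++ B ++ D') o.1) o.2
    <= mass c + mass D.
Proof.
move=> u u' cc'; rewrite !big_cat /=.
have leP (P : pred obj) s : \sum_(o <- s | P o) o.2 <= mass s.
  by rewrite big_mkcond; apply: leq_sum => o _; case: ifP.
have notin s (X Y : seq obj) : uniq (map fst (X ++ Y)) -> s \in map fst Y -> s \notin map fst X.
  rewrite map_cat cat_uniq => /and3P[_ /hasPn H _] /H; exact.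
rewrite [X in X + _]big_seq_cond big1 => [|o /andP[oA]]; last first.
  by rewrite !lpos_catl ?map_f // eqxx.
rewrite add0n; apply: leq_add => //.
rewrite [X in X + _]big_seq_cond big1 => [|o /andP[oB]]; first by rewrite add0n.
have H X Y Z : uniq (map fst (X ++ Y ++ B ++ Z)) -> lpos (X ++ Y ++ B ++ Z) o.1 = mass X + (mass Y + lpos B o.1).
  move=> uX; have ob : o.1 \in map fst B by apply: map_f.
  rewrite lpos_catr; last by apply: notin uX _; rewrite !map_cat !mem_cat ob /= orbT.
  rewrite lpos_catr ?lpos_catl //; move: uX; rewrite map_cat cat_uniq => /and3P[_ _ uX].
  by apply: notin uX _; rewrite map_cat mem_cat ob.
by rewrite !H // cc' eqxx.
Qed.

(** * Live objects and the layout of the core *)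

Section Live.
Variable e : nat.
Implicit Types X Y : objects.

Definition cls X x := rup e (mu X x).
Definition load X := \sum_(x <- domf X) cls X x.
Definition core X a : seq obj := [seq (x, cls X x) | x <- domf X & 2 ^ a <= cls X x].

(** Read from left to right an insertion, from right to left a deletion: both kinds of update are
    analysed through this one relation. *)
Record extends X x Y : Prop := Extends {
  ext_new : x \notin domf X;
  ext_perm : perm_eq (domf Y) (x :: domf X);
  ext_mu : forall y, y \in domf X -> mu Y y = mu X y;
  ext_gt0 : 0 < mu Y x
}.

Definition positive X := forall x, x \in domf X -> 0 < mu X x.

Lemma mem_dom_set X x s y : (y \in domf X.[x <- s]%fmap) = (y == x) || (y \in domf X).
Proof. exact: mem_setf. Qed.

Lemma mem_dom_rem X x y : (y \in domf X.[~ x]%fmap) = (y != x) && (y \in domf X).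
Proof. exact: mem_remf1. Qed.

Lemma extends_insert X x s : x \notin domf X -> 0 < s -> extends X x X.[x <- s]%fmap.
Proof.
move=> xX s0; split=> //.
- apply: uniq_perm => [||y]; first exact: fset_uniq.
    by rewrite cons_uniq xX fset_uniq.
  by rewrite mem_dom_set inE.
- by move=> y yX; rewrite /mu fnd_set; case: eqP => // E; rewrite -E yX in xX.
- by rewrite /mu fnd_set eqxx.
Qed.

Lemma extends_delete X x : x \in domf X -> positive X -> extends X.[~ x]%fmap x X.
Proof.
move=> xX pX; have xn : x \notin domf X.[~ x]%fmap by rewrite mem_dom_rem eqxx.
split=> //; last exact: pX.
- apply: uniq_perm => [||y]; first exact: fset_uniq.
    by rewrite cons_uniq xn fset_uniq.
  by rewrite inE mem_dom_rem; case: eqP => // ->.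
- by move=> y; rewrite mem_dom_rem => /andP[yx _]; rewrite /mu fnd_rem1 yx.
Qed.

Lemma legal_extends X u : positive X -> legal X u ->
  exists x, (extends X x (apply_update X u) /\ update_size X u = mu (apply_update X u) x) \/
            (extends (apply_update X u) x X /\ update_size X u = mu X x).
Proof.
move=> pX; case: u => [x s|x] /=.
  by move=> /andP[xX s0]; exists x; left; split; [apply: extends_insert|rewrite /mu fnd_set eqxx].
by move=> xX; exists x; right; split => //; apply: extends_delete.
Qed.

Lemma extends_positive X x Y : extends X x Y -> positive X -> positive Y.
Proof.
move=> E pX y; rewrite (perm_mem (ext_perm E)) inE => /predU1P[->|yX]; first exact: ext_gt0 E.
by rewrite (ext_mu E) // pX.
Qed.

Lemma extends_positive' X x Y : extends X x Y -> positive Y -> positive X.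
Proof.
by move=> E pY y yX; rewrite -(ext_mu E) // pY // (perm_mem (ext_perm E)) inE yX orbT.
Qed.

Lemma extends_cls X x Y y : extends X x Y -> y \in domf X -> cls Y y = cls X y.
Proof. by move=> E yX; rewrite /cls (ext_mu E). Qed.

Lemma extends_load X x Y : extends X x Y -> load Y = cls Y x + load X.
Proof.
move=> E; rewrite /load (perm_big _ (ext_perm E)) big_cons; congr (_ + _).
by apply: eq_big_seq => y yX; rewrite (extends_cls E).
Qed.

Lemma extends_core X x Y a : extends X x Y ->
  perm_eq (core Y a) (if 2 ^ a <= cls Y x then (x, cls Y x) :: core X a else core X a).
Proof.
move=> E; have p := perm_filter (fun y => 2 ^ a <= cls Y y) (ext_perm E).
have -> : core X a = [seq (y, cls Y y) | y <- domf X & 2 ^ a <= cls Y y].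
  have fE : [seq y <- domf X | 2 ^ a <= cls X y] = [seq y <- domf X | 2 ^ a <= cls Y y].
    by apply: eq_in_filter => y yX; rewrite (extends_cls E).
  rewrite /core fE; apply/eq_in_map => y; rewrite mem_filter => /andP[_ yX].
  by rewrite (extends_cls E).
by apply: perm_trans (perm_map _ p) _; rewrite /=; case: ifP.
Qed.

Lemma core_names_uniq X a : uniq (map fst (core X a)).
Proof. by rewrite /core -map_comp map_id filter_uniq // fset_uniq. Qed.

Lemma core_mass X a : mass (core X a) <= load X.
Proof. by rewrite /mass /core big_map big_filter big_mkcond; apply: leq_sum => x _; case: ifP. Qed.

Lemma core_good X a : positive X -> all (good_obj e a) (core X a).
Proof.
move=> pX; apply/allP => o /mapP[x]; rewrite mem_filter => /andP[ax xX] ->.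
by rewrite /good_obj ax andbT rup_rounded // pX.
Qed.

Lemma legal_from_rcons X us u :
  legal_from X (rcons us u) = legal_from X us && legal (foldl apply_update X us) u.
Proof. by elim: us X => [|v us IH] X /=; rewrite ?andbT // IH andbA. Qed.

Lemma live_rcons us u : live_after (rcons us u) = apply_update (live_after us) u.
Proof. by rewrite /live_after foldl_rcons. Qed.

Lemma live_positive us : legal_from [fmap]%fmap us -> positive (live_after us).
Proof.
elim/last_ind: us => [_ x|us u IH]; first by rewrite /live_after /= inE.
rewrite legal_from_rcons live_rcons => /andP[/IH pX lu].
have [x [[E _]|[E _]]] := legal_extends pX lu.
  exact: extends_positive E pX.
exact: extends_positive' E pX.
Qed.

End Live.

Lemma core_inv_perm e kap a m st tau O O' : perm_eq O O' ->
  core_inv e kap a m st tau O -> core_inv e kap a m st tau O'.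
Proof.
move=> p [s u g pe h q ms w]; split=> //.
- by rewrite -(perm_uniq p).
- by rewrite -(perm_all _ p).
- exact: perm_trans pe p.
Qed.

(** * The core along an update sequence *)

Section Run.
Variables e kap : nat.
Hypothesis kapP : e < 2 ^ kap.
(** With a = l - 4 e, the longest period 2^(a + levels) is at least 2^(l + 2), which bounds the load
    in phase l. *)
Definition levels := 4 * e + 2.
Let m := levels.
Let F := cost_const kap m.
Implicit Types (us : seq update) (theta a : nat) (st : layout).

Definition update_class us u := rup e (update_size (live_after us) u).

(** The clock of the core. For fixed [a] it is a function of the updates alone, which is what makes
    a uniform shift by [theta] effective. *)
Fixpoint wsum a (rus : seq update) : nat :=
  if rus is u :: rus' then
    wsum a rus' + (if 2 ^ a <= update_class (rev rus') u then update_class (rev rus') u else 0)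
  else 0.

Definition lvl theta us := phase (load e (live_after us)) theta - 4 * e.

Definition cinv theta us st :=
  core_inv e kap (lvl theta us) m st (wsum (lvl theta us) (rev us) + theta)
    (core e (live_after us) (lvl theta us)).

Definition core_cost a x w theta :=
  if 2 ^ a <= w then \sum_(l < m.+1) 2 * (F * period a m l) * crossings (period a m l) x w theta
  else 0.

Definition core_moved a us u st st' :=
  \sum_(o <- core e (live_after us) a |
     (o.1 \in domf (live_after (rcons us u))) && (lpos (flat st) o.1 != lpos (flat st') o.1)) o.2.

(** When [lvl] changes, the core may be built from scratch; that cost is charged to the change of
    phase instead. *)
Record next_ok theta us u st st' : Prop := NextOk {
  next_inv : cinv theta (rcons us u) st';
  next_cost : lvl theta us = lvl theta (rcons us u) ->
    core_moved (lvl theta us) us u st st' <=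
      core_cost (lvl theta us) (wsum (lvl theta us) (rev us)) (update_class us u) theta
}.

Lemma core_mass_le theta us :
  mass (core e (live_after us) (lvl theta us)) <= F * period (lvl theta us) m 0.
Proof.
set X := live_after us; apply: leq_trans (core_mass e X _) _.
have [->//|L0] := posnP (load e X).
have /andP[_ /ltnW H] := phase_bounds theta L0; apply: leq_trans H _.
apply: (@leq_trans (1 * period (lvl theta us) m 0)).
  rewrite mul1n leq_exp2l // /lvl -/X /m /levels; lia.
by rewrite leq_mul2r /F /cost_const addn4 orbT.
Qed.

Lemma cinv_exists theta us : legal_from [fmap]%fmap us -> exists st, cinv theta us st.
Proof.
move=> lus; apply: core_init => //.
- exact: map_uniq (core_names_uniq e _ _).
- exact: core_good (live_positive lus).
- exact: core_mass_le.
Qed.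

Lemma next_exists theta us u st : legal_from [fmap]%fmap (rcons us u) -> cinv theta us st ->
  exists st', next_ok theta us u st st'.
Proof.
move=> lusu I; have := lusu; rewrite legal_from_rcons -/(live_after us) => /andP[lus lu].
have [eq_a|ne_a] := eqVneq (lvl theta us) (lvl theta (rcons us u)); last first.
  have [st' I'] := cinv_exists theta lusu; exists st'; split=> // E.
  by rewrite E eqxx in ne_a.
have [x ext] := legal_extends (live_positive lus) lu.
set a := lvl theta us in eq_a *; set X := live_after us in lu ext *.
set Y := apply_update X u in ext *.
have YE : live_after (rcons us u) = Y by rewrite live_rcons.
pose w := update_class us u.
have wE : if x \in domf X then extends Y x X /\ w = cls e X x else extends X x Y /\ w = cls e Y x.
  rewrite /w /update_class -/X; case: ext => [[E ->]|[E ->]].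
    by rewrite (negPf (ext_new E)).
  by rewrite (perm_mem (ext_perm E)) mem_head.
have mO := core_mass_le theta us; have mO' := core_mass_le theta (rcons us u).
have I0 : core_inv e kap a m st (wsum a (rev us) + theta) (core e X a) := I.
have [aw|aw] := leqP (2 ^ a) w; last first.
  have pc : perm_eq (core e X a) (core e Y a).
    move: wE; case: ifP => _ [E wx]; have := @extends_core e _ _ _ a E; rewrite -wx leqNgt aw /= => //.
    by rewrite perm_sym.
  exists st; split.
    rewrite /cinv -eq_a YE rev_rcons /= revK -/w leqNgt aw /= addn0.
    exact: core_inv_perm pc I0.
  by rewrite /core_moved big_pred0 // => o; rewrite eqxx andbF.
pose o : obj := (x, w).
have w0 : 0 < w by apply: leq_trans aw; rewrite expn_gt0.
have go : good_obj e a o.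
  rewrite /good_obj aw andbT /=; move: wE; case: ifP => _ [E ->]; rewrite rup_rounded //; exact: ext_gt0 E.
have op : (perm_eq (core e Y a) (o :: core e X a) /\ o \notin core e X a) \/
   (o \in core e X a /\ perm_eq (core e Y a) (rem o (core e X a))).
  move: wE; case: (boolP (x \in domf X)) => xX [E wx]; have := @extends_core e _ _ _ a E; rewrite -wx aw -/o => p.
    right; have oX : o \in core e X a by rewrite (perm_mem p) mem_head.
    by split=> //; rewrite -(perm_cons o) perm_sym; apply: perm_trans p; rewrite perm_sym perm_to_rem.
  left; split=> //; apply: contra xX => /mapP[y]; rewrite mem_filter => /andP[_ yX] [-> _].
  exact: yX.
set tau := wsum a (rev us) + theta in I0.
(* A core update has size at least 2^a, the last period, so some level is always due and a first one
   [js] exists. *)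
have exm : tau %/ period a m m != (tau + w) %/ period a m m.
  rewrite /period subnn addn0 neq_ltn; apply/orP; left.
  have p0 : 0 < 2 ^ a by rewrite expn_gt0.
  have <- : (tau + 2 ^ a) %/ 2 ^ a = (tau %/ 2 ^ a).+1 by rewrite divnDr // divnn p0 addn1.
  by apply: leq_div2r; rewrite leq_add2l.
have ex : exists l, tau %/ period a m l != (tau + w) %/ period a m l by exists m.
have [js jsP jsmin] := ex_minnP ex; have jsm : js <= m := jsmin m exm.
have noc l : l < js -> tau %/ period a m l = (tau + w) %/ period a m l.
  by move=> ljs; apply/eqP; apply: contraLR ljs => /jsmin; rewrite -leqNgt.
rewrite -/a -/X in mO; rewrite -eq_a YE in mO'.
have [st' I' [A [c [c' [B [D [D' [stE st'E cc' cost]]]]]]]] := core_step kapP jsm I0 go op noc mO mO'.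
exists st'; split.
  rewrite /cinv -eq_a YE rev_rcons /= revK -/w aw.
  by move: I'; rewrite /tau addnAC.
move=> _; rewrite /core_moved -/X YE /core_cost -/w aw.
have un Z st0 tau0 : core_inv e kap a m st0 tau0 (core e Z a) -> uniq (map fst (flat st0)).
  by move=> I1; rewrite (perm_uniq (perm_map _ (inv_perm I1))) core_names_uniq.
have := @lpos_moved A c c' B D D'; rewrite -stE -st'E (un _ _ _ I0) (un _ _ _ I') => /(_ isT isT cc') H.
apply: (@leq_trans (mass c + mass D)).
  apply: leq_trans H; rewrite -(perm_big _ (inv_perm I0)) /=.
  by apply: leq_sum_pred => z /andP[].
(* Level [js] is crossed at least once, so its term of the sum alone covers the cost. *)
apply: leq_trans cost _; rewrite (bigD1 (Ordinal (jsm : js < m.+1))) //=.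
apply: leq_trans (leq_addr _ _); rewrite leq_pmulr // /crossings subn_gt0 ltn_neqAle.
rewrite addnAC jsP /=; apply: leq_div2r; exact: leq_addr.
Qed.

(** The layout is a choice depending only on the phase, the past updates and the previous layout, so
    the algorithm stays online. *)
Definition run_next theta us u st := epsilon (inhabits ([::] : layout)) (next_ok theta us u st).

Fixpoint run theta (rus : seq update) : layout :=
  if rus is u :: rus' then run_next theta (rev rus') u (run theta rus')
  else epsilon (inhabits ([::] : layout)) (cinv theta [::]).

Definition layout_after theta us := run theta (rev us).

Lemma layout_inv theta us : legal_from [fmap]%fmap us -> cinv theta us (layout_after theta us).
Proof.
rewrite /layout_after; elim/last_ind: us => [|us u IH] lus.
  by apply: epsilon_spec; apply: cinv_exists.
rewrite rev_rcons /= revK; have lus' : legal_from [fmap]%fmap us.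
  by move: lus; rewrite legal_from_rcons => /andP[].
apply: next_inv; exact: epsilon_spec (next_exists lus (IH lus')).
Qed.

Lemma layout_cost theta us u : legal_from [fmap]%fmap (rcons us u) ->
  lvl theta us = lvl theta (rcons us u) ->
  core_moved (lvl theta us) us u (layout_after theta us) (layout_after theta (rcons us u)) <=
    core_cost (lvl theta us) (wsum (lvl theta us) (rev us)) (update_class us u) theta.
Proof.
move=> lus; have lus' : legal_from [fmap]%fmap us.
  by move: lus; rewrite legal_from_rcons => /andP[].
apply: next_cost; rewrite {2}/layout_after rev_rcons /= revK.
exact: epsilon_spec (next_exists lus (layout_inv theta lus')).
Qed.

End Run.

(** * Slabs of tiny objects *)

Section Roster.
Variable e : nat.
Implicit Types (us : seq update).

(** The order of the names in a class depends on the updates alone; randomness enters later, through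
    a shift of the slots. *)
Fixpoint roster_rev (rus : seq update) (v : nat) : seq nat :=
  if rus is u :: rus' then
    match u with
    | Insert x s => if v == rup e s then rcons (roster_rev rus' v) x else roster_rev rus' v
    | Delete x => if v == cls e (live_after (rev rus')) x then swap_del x (roster_rev rus' v)
                  else roster_rev rus' v
    end
  else [::].

Definition roster us := roster_rev (rev us).

Record roster_ok X (ros : nat -> seq nat) : Prop := RosterOk {
  roster_uniq : forall v, uniq (ros v);
  roster_mem : forall v x, (x \in ros v) = (x \in domf X) && (cls e X x == v)
}.

(** The exceptional [y] is the new name for an insertion and the name moved into the gap for a
    deletion. *)
Record roster_extends X ros x Y ros' : Prop := RosterExtends {
  rext : extends X x Y;
  rext_same : forall v, v != cls e Y x -> ros' v = ros v;
  rext_size : size (ros' (cls e Y x)) = (size (ros (cls e Y x))).+1;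
  rext_index : exists y : nat, forall v z : nat, z \in ros v -> z != y -> index z (ros' v) = index z (ros v)
}.

Lemma roster_insert X ros x s : x \notin domf X -> 0 < s -> roster_ok X ros ->
  let ros' v := if v == rup e s then rcons (ros v) x else ros v in
  roster_ok X.[x <- s]%fmap ros' /\ roster_extends X ros x X.[x <- s]%fmap ros'.
Proof.
move=> xX s0 [u m] ros'; have E := extends_insert xX s0.
have cx : cls e X.[x <- s]%fmap x = rup e s by rewrite /cls /mu fnd_set eqxx.
have nx v : x \notin ros v by rewrite m (negPf xX).
split.
  split=> [v|v y]; first by rewrite /ros'; case: ifP => // _; rewrite rcons_uniq nx u.
  rewrite mem_dom_set /ros'; have [->|yx] := eqVneq y x.
    rewrite cx /= [rup e s == v]eq_sym; case: ifP => _; first by rewrite mem_rcons mem_head.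
    exact: negbTE (nx v).
  have -> : (y \in (if v == rup e s then rcons (ros v) x else ros v)) = (y \in ros v).
    by case: ifP => // _; rewrite mem_rcons inE (negPf yx).
  rewrite m /=; case: (boolP (y \in domf X)) => //= yX.
  by rewrite (extends_cls e E).
split=> //.
- by move=> v; rewrite cx /ros' => /negPf ->.
- by rewrite cx /ros' eqxx size_rcons.
- exists x => v z zr _; rewrite /ros'; case: ifP => // _.
  by rewrite -cats1 index_cat zr.
Qed.

Lemma roster_delete X ros x : x \in domf X -> positive X -> roster_ok X ros ->
  let ros' v := if v == cls e X x then swap_del x (ros v) else ros v in
  roster_ok X.[~ x]%fmap ros' /\ roster_extends X.[~ x]%fmap ros' x X ros.
Proof.
move=> xX pX [u m] ros'; have E := extends_delete xX pX.
have xr : x \in ros (cls e X x) by rewrite m xX eqxx.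
have [us mem sz [y yP]] := swap_delP (u _) xr.
split.
  split=> [v|v z]; first by rewrite /ros'; case: eqP => [->|_].
  rewrite mem_dom_rem /ros'.
  have -> : (z \in (if v == cls e X x then swap_del x (ros v) else ros v)) = (z \in ros v) && (z != x).
    case: eqP => [->|ne]; first by rewrite mem inE.
    have [->|] := eqVneq z x; last by rewrite andbT.
    by rewrite andbF m; apply/negbTE/negP => /andP[_ /eqP E1]; apply: ne.
  rewrite m andbC andbA; have [->|zx] //= := eqVneq z x.
  case: (boolP (z \in domf X)) => //= zX; congr (_ == _).
  by apply: extends_cls E _; rewrite mem_dom_rem zx.
split=> //.
- by move=> v ne; rewrite /ros' (negPf ne).
- by rewrite /ros' eqxx.
- exists y => v z; rewrite /ros'; case: eqP => [-> zr zy|//].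
  move: zr; rewrite mem inE => /andP[zr zx]; by rewrite yP.
Qed.

Lemma roster_step us u : legal_from [fmap]%fmap (rcons us u) -> roster_ok (live_after us) (roster us) ->
  roster_ok (live_after (rcons us u)) (roster (rcons us u)) /\
  exists x, (roster_extends (live_after us) (roster us) x (live_after (rcons us u)) (roster (rcons us u)) /\
             update_size (live_after us) u = mu (live_after (rcons us u)) x) \/
            (roster_extends (live_after (rcons us u)) (roster (rcons us u)) x (live_after us) (roster us) /\
             update_size (live_after us) u = mu (live_after us) x).
Proof.
rewrite legal_from_rcons -/(live_after us) => /andP[lus lu] ok.
rewrite live_rcons /roster rev_rcons /= revK; have pX := live_positive lus.
case: u lu => [x s|x] /= => [/andP[xX s0]|xX].
  have [H1 H2] := roster_insert xX s0 ok; split=> //; exists x; left; split=> //.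
  by rewrite /mu fnd_set eqxx.
have [H1 H2] := roster_delete xX pX ok; split=> //; exists x; right; split=> //.
Qed.

Lemma roster_live us : legal_from [fmap]%fmap us -> roster_ok (live_after us) (roster us).
Proof.
elim/last_ind: us => [_|us u IH lusu]; first by split=> // v x; rewrite /live_after /= inE.
have := lusu; rewrite legal_from_rcons => /andP[/IH ok _].
by case: (roster_step lusu ok).
Qed.

Lemma roster_sum X ros (vs : seq nat) : roster_ok X ros -> uniq vs ->
  \sum_(v <- vs) size (ros v) * v = \sum_(x <- domf X | cls e X x \in vs) cls e X x.
Proof.
move=> [u m]; have one v : size (ros v) * v = \sum_(x <- domf X | cls e X x == v) cls e X x.
  have /perm_size -> : perm_eq (ros v) [seq x <- domf X | cls e X x == v].
    apply: uniq_perm => [||x]; rewrite ?filter_uniq ?fset_uniq //.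
    by rewrite mem_filter andbC -m.
  rewrite -big_filter -sum1_size big_distrl /= big_seq_cond [RHS]big_seq_cond.
  by apply: eq_bigr => x; rewrite mem_filter mul1n => /andP[/andP[/eqP]].
elim: vs => [_|v vs IH /= /andP[vvs uvs]]; first by rewrite big_nil big_pred0.
rewrite big_cons IH // (bigID (fun x => cls e X x == v) (fun x => cls e X x \in v :: vs)) /= one.
congr (_ + _); apply: eq_bigl => x; rewrite inE.
  by case: (cls e X x == v); rewrite ?andbF.
by have [->|_] := eqVneq (cls e X x) v; rewrite ?(negPf vvs) ?andbT.
Qed.

End Roster.

(** * Blocks that hold the slabs *)

Section Slabs.
Variables (e B' : nat).
Notation K := ('I_B'.+1 * 'I_B'.+1)%type.
Implicit Types (n : nat -> nat) (theta a w t : nat).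

(** A block holds at least 2^(e + 2) objects, so the space lost at its end is at most a 2^-(e + 2)
    fraction of the space used. *)
Definition block_size w := 2 ^ (trunc_log 2 w + e + 3).
Definition per_block w := block_size w %/ w.
(** The slots start at [theta %% per_block w], so an insertion opens a new block with probability 1
    / [per_block w]. *)
Definition nblocks n theta w := ((n w + theta %% per_block w) %/ per_block w).+1.
Definition tiny_classes a := rev [seq w <- iota 1 (2 ^ a).-1 | rounded e w].
Definition bkey w t : K := (inord w, inord t).
Definition class_blocks n theta w : seq K := map (bkey w) (iota 0 (nblocks n theta w)).
Definition blocks n theta a : seq K :=
  flatten [seq class_blocks n theta w | w <- tiny_classes a].
Definition bsize (k : K) := block_size k.1.

Lemma mem_tiny_classes a w : (w \in tiny_classes a) = rounded e w && (w < 2 ^ a).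
Proof.
rewrite mem_rev mem_filter mem_iota; case: (boolP (rounded e w)) => //= /andP[w0 _].
by rewrite w0 add1n prednK // expn_gt0.
Qed.

Lemma tiny_classes_sorted a : pairwise (fun w w' => w' < w) (tiny_classes a).
Proof.
rewrite -sorted_pairwise; last by move=> x y z /= H1 H2; apply: ltn_trans H2 H1.
rewrite rev_sorted /=; apply: sorted_filter; first exact: ltn_trans.
exact: iota_ltn_sorted.
Qed.

Lemma tiny_classes_uniq a : uniq (tiny_classes a).
Proof. by rewrite rev_uniq filter_uniq ?iota_uniq. Qed.

Lemma block_size_gt0 w : 0 < block_size w. Proof. by rewrite expn_gt0. Qed.

Lemma per_block_ge w : 0 < w -> 2 ^ (e + 2) <= per_block w.
Proof.
move=> w0; rewrite /per_block leq_divRL // /block_size.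
have /ltnW H := trunc_log_ltn w (isT : 1 < 2).
apply: leq_trans (leq_mul (leqnn _) H) _; rewrite -expnD leq_exp2l //; lia.
Qed.

Lemma per_block_gt0 w : 0 < w -> 0 < per_block w.
Proof. by move=> w0; apply: leq_trans (per_block_ge w0); rewrite expn_gt0. Qed.

Lemma per_block_le w : per_block w * w <= block_size w.
Proof. exact: leq_trunc_div. Qed.

Lemma block_size_le w : 0 < w -> block_size w <= (per_block w).+1 * w.
Proof. by move=> w0; rewrite ltnW // ltn_ceil. Qed.

Lemma block_size_le2 w : 0 < w -> block_size w <= per_block w * (2 * w).
Proof.
move=> w0; apply: leq_trans (block_size_le w0) _; rewrite mulnCA mulnA leq_mul2r.
by rewrite mul2n -addnn -addn1 leq_add2l per_block_gt0 ?orbT.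
Qed.

Lemma block_size_dvd w w' : w' <= w -> block_size w' %| block_size w.
Proof. by move=> ww; rewrite dvdn_exp2l // !leq_add2r leq_trunc_log. Qed.

Lemma block_size_tiny a w : w < 2 ^ a -> block_size w %| 2 ^ (a + e + 3).
Proof.
move=> wa; rewrite dvdn_exp2l // !leq_add2r; case: w wa => // w wa.
by rewrite -(trunc_expnK a (isT : 1 < 2)) leq_trunc_log // ltnW.
Qed.

Lemma nblocks_crossings n n' theta w : 0 < w -> n' w = (n w).+1 ->
  nblocks n' theta w = nblocks n theta w + crossings (per_block w) (n w) 1 theta /\
  crossings (per_block w) (n w) 1 theta <= 1.
Proof.
move=> w0 E; rewrite /nblocks E -crossings_mod addn1.
have q0 := per_block_gt0 w0; move: (per_block w) q0 => q q0.
have H : (n w + theta %% q) %/ q <= ((n w).+1 + theta %% q) %/ q by apply: leq_div2r; rewrite addSn.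
split; first by rewrite [RHS]addSn subnKC.
rewrite leq_subLR; have -> : (n w + theta %% q) %/ q + 1 = (n w + theta %% q + q) %/ q.
  by rewrite (divnDr _ (dvdnn q)) divnn q0.
by apply: leq_div2r; rewrite addSn -addn1 leq_add2l.
Qed.

Arguments class_blocks : simpl never.
Variable a : nat.
Hypothesis aB : 2 ^ a <= B'.+1.

Lemma bkey1 w t : w < 2 ^ a -> (bkey w t).1 = w :> nat.
Proof. by move=> wa; rewrite /= inordK // (leq_trans wa). Qed.

Lemma bsize_bkey w t : w < 2 ^ a -> bsize (bkey w t) = block_size w.
Proof. by move=> wa; rewrite /bsize bkey1. Qed.

Lemma bkey_inj w w' t t' : w < 2 ^ a -> w' < 2 ^ a -> t < B'.+1 -> t' < B'.+1 ->
  bkey w t = bkey w' t' -> w = w' /\ t = t'.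
Proof.
move=> wa wa' tB tB' E; split; first by rewrite -(bkey1 t wa) E bkey1.
by have := congr1 (fun k : K => nat_of_ord k.2) E; rewrite /= !inordK.
Qed.

Lemma mem_class_blocks n theta w k :
  reflect (exists2 t, t < nblocks n theta w & k = bkey w t) (k \in class_blocks n theta w).
Proof.
by apply: (iffP mapP) => -[t]; rewrite ?mem_iota => H ->; exists t; rewrite ?mem_iota.
Qed.

Lemma mem_blocks n theta k : reflect (exists w t,
    [/\ rounded e w, w < 2 ^ a, t < nblocks n theta w & k = bkey w t]) (k \in blocks n theta a).
Proof.
apply: (iffP flatten_mapP) => [[w]|[w [t [rw wa tn ->]]]].
  rewrite mem_tiny_classes => /andP[rw wa] /mem_class_blocks[t tn ->].
  by exists w, t.
exists w; first by rewrite mem_tiny_classes rw.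
by apply/mem_class_blocks; exists t.
Qed.

Lemma blocks_uniq n theta : (forall w, w < 2 ^ a -> nblocks n theta w <= B'.+1) ->
  uniq (blocks n theta a).
Proof.
move=> nB; rewrite /blocks.
have wa w : w \in tiny_classes a -> w < 2 ^ a by rewrite mem_tiny_classes => /andP[].
have := tiny_classes_uniq a; elim: (tiny_classes a) wa => // w ws IH wa; rewrite cons_uniq => /andP[wws uws].
have -> : flatten [seq class_blocks n theta w | w <- w :: ws] =
  class_blocks n theta w ++ flatten [seq class_blocks n theta w | w <- ws] by [].
have wa0 : w < 2 ^ a by apply: wa; rewrite mem_head.
have wa1 w' : w' \in ws -> w' < 2 ^ a by move=> H; apply: wa; rewrite inE H orbT.
have u1 : uniq (class_blocks n theta w).
  rewrite map_inj_in_uniq ?iota_uniq // => t t'; rewrite !mem_iota !add0n => tn t'n /bkey_inj[] //.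
  - exact: leq_trans tn (nB _ wa0).
  - exact: leq_trans t'n (nB _ wa0).
rewrite cat_uniq u1 (IH wa1 uws) andbT.
apply/hasPn => k /flatten_mapP[w' w'ws /mem_class_blocks[t' t'n ->]].
apply/negP => /mem_class_blocks[t tn E].
have /bkey_inj[] := E => //; [exact: wa1|exact: leq_trans t'n (nB _ (wa1 _ w'ws))|exact: leq_trans tn (nB _ wa0)|].
by move=> E'; rewrite -E' w'ws in wws.
Qed.

Lemma blocks_decreasing n theta D' : 2 ^ (a + e + 3) %| D'.+1 ->
  decreasing D' bsize (blocks n theta a).
Proof.
move=> aD; apply/andP; split.
  apply/allP => k /mem_blocks[w [t [rw wa _ ->]]]; rewrite bsize_bkey // block_size_gt0 /=.
  exact: dvdn_trans (block_size_tiny wa) aD.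
rewrite /blocks; have wa w : w \in tiny_classes a -> w < 2 ^ a by rewrite mem_tiny_classes => /andP[].
have := tiny_classes_sorted a; elim: (tiny_classes a) wa => // w ws IH wa.
rewrite pairwise_cons => /andP[/allP wws uws].
have -> : flatten [seq class_blocks n theta w | w <- w :: ws] =
  class_blocks n theta w ++ flatten [seq class_blocks n theta w | w <- ws] by [].
have wa0 : w < 2 ^ a by apply: wa; rewrite mem_head.
have wa1 w' : w' \in ws -> w' < 2 ^ a by move=> H; apply: wa; rewrite inE H orbT.
rewrite pairwise_cat (IH wa1 uws) andbT; apply/andP; split.
  apply/allrelP => k k' /mem_class_blocks[t _ ->] /flatten_mapP[w' w'ws /mem_class_blocks[t' _ ->]].
  rewrite !bsize_bkey //; last exact: wa1.
  by rewrite block_size_dvd // ltnW // wws.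
rewrite /class_blocks pairwise_map; elim: (iota _ _) => //= t ts ->; rewrite andbT; apply/allP => t' _ /=.
by rewrite !bsize_bkey.
Qed.

Lemma total_blocks n theta :
  total bsize (blocks n theta a) = \sum_(w <- tiny_classes a) nblocks n theta w * block_size w.
Proof.
rewrite /total /blocks big_flatten big_map /= big_seq_cond [RHS]big_seq_cond.
apply: eq_bigr => w; rewrite andbT mem_tiny_classes => /andP[_ wa].
rewrite /class_blocks big_map (eq_bigr (fun=> block_size w)); last by move=> t _; rewrite bsize_bkey.
by rewrite big_const_seq count_predT size_iota iter_addn_0 mulnC.
Qed.

(** A rounded size is given by its scale i and a quotient below 2^(e + 1), so scale i contributes at
    most 2^(e + 1) blocks of length 2^(i + e + 3), and the sum over i is geometric. *)
Lemma sum_block_size : \sum_(w <- tiny_classes a) block_size w <= 2 ^ (a + 2 * e + 4).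
Proof.
pose code w := (trunc_log 2 w, w %/ 2 ^ (trunc_log 2 w - e)).
have codeK w : w \in tiny_classes a -> w = (code w).2 * 2 ^ ((code w).1 - e).
  by rewrite mem_tiny_classes => /andP[/andP[_ H] _]; rewrite /= divnK.
have -> : \sum_(w <- tiny_classes a) block_size w =
    \sum_(c <- [seq code w | w <- tiny_classes a]) 2 ^ (c.1 + e + 3) by rewrite big_map.
apply: (@leq_trans (\sum_(c <- [seq (i, j) | i <- iota 0 a, j <- iota 0 (2 ^ e.+1)]) 2 ^ (c.1 + e + 3))).
  apply: leq_sum_sub.
    rewrite map_inj_in_uniq ?tiny_classes_uniq // => w w' ws w's E.
    by rewrite (codeK w ws) (codeK w' w's) E.
  move=> c /mapP[w]; rewrite mem_tiny_classes => /andP[/andP[w0 dw] wa] ->.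
  have /andP[lo hi] := trunc_log_bounds (isT : 1 < 2) w0.
  apply/allpairsP; exists (code w); rewrite !mem_iota /= !add0n; split=> //.
    by rewrite -(@ltn_exp2l 2) //; apply: leq_ltn_trans lo wa.
  rewrite ltn_divLR ?expn_gt0 // -expnD; apply: leq_trans hi _; rewrite leq_exp2l //; lia.
rewrite big_allpairs /= (eq_bigr (fun i => 2 ^ i * 2 ^ (2 * e + 4))); last first.
  move=> i _; rewrite big_const_seq count_predT size_iota iter_addn_0 -!expnD; congr (2 ^ _); lia.
rewrite -big_distrl -addnA (expnD 2 a) /= leq_mul2r; apply/orP; right.
elim: a => [|b IH]; first by rewrite big_nil.
by rewrite -{1}addn1 iotaD big_cat /= big_seq1 add0n expnS mul2n -addnn leq_add2r.
Qed.

(** Full blocks waste a 2^-(e + 2) fraction; the shift and the last block cost at most two further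
    blocks per class. *)
Lemma total_blocks_le n theta :
  2 ^ (e + 2) * total bsize (blocks n theta a) <=
  (2 ^ (e + 2)).+1 * \sum_(w <- tiny_classes a) n w * w + 2 ^ (a + 3 * e + 7).
Proof.
have -> : 2 ^ (a + 3 * e + 7) = 2 ^ (e + 2) * (2 * 2 ^ (a + 2 * e + 4)).
  by rewrite -expnS -expnD; congr (2 ^ _); lia.
rewrite total_blocks.
apply: (@leq_trans (\sum_(w <- tiny_classes a) ((2 ^ (e + 2)).+1 * (n w * w) + 2 ^ (e + 2) * (2 * block_size w)))); last first.
  by rewrite big_split /= -!big_distrr leq_add2l /= !leq_mul2l sum_block_size !orbT.
rewrite big_distrr; apply: leq_sum_seq => w; rewrite mem_tiny_classes => /andP[/andP[w0 _] _] _ /=.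
have q0 := per_block_gt0 w0; have qe := per_block_ge w0; have bq := block_size_le w0.
set q := per_block w in q0 qe bq *; set x := n w.
have nb : nblocks n theta w <= x %/ q + 2.
  rewrite /nblocks -/q -/x addn2 ltnS; apply: (@leq_trans ((x + q) %/ q)).
    by apply: leq_div2r; rewrite leq_add2l ltnW // ltn_pmod.
  by rewrite divnDr // divnn q0 addn1.
apply: leq_trans (leq_mul (leqnn _) (leq_mul nb (leqnn _))) _.
rewrite mulnDl mulnDr leq_add2r.
apply: leq_trans (leq_mul (leqnn _) (leq_mul (leqnn _) bq)) _.
have xq : x %/ q * q <= x := leq_trunc_div x q.
rewrite !mulnA leq_mul2r; apply/orP; right; rewrite mulnS [X in _ <= X]mulSn leq_add //.
  by rewrite mulnC; apply: leq_trans xq; rewrite leq_mul2l qe orbT.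
by rewrite -mulnA leq_mul2l xq orbT.
Qed.

Lemma blocks_insert n n' theta w0 : (forall w, w != w0 -> n' w = n w) -> n' w0 = (n w0).+1 ->
  rounded e w0 -> w0 < 2 ^ a ->
  (crossings (per_block w0) (n w0) 1 theta = 0 /\ blocks n' theta a = blocks n theta a) \/
  (crossings (per_block w0) (n w0) 1 theta = 1 /\
   exists ys zs t, blocks n theta a = ys ++ zs /\ blocks n' theta a = ys ++ bkey w0 t :: zs).
Proof.
move=> nn' nw0 /[dup] rw0 /andP[w0_gt0 _] wa0.
have [nbE c1] := nblocks_crossings theta w0_gt0 nw0.
have nb_same w : w != w0 -> nblocks n' theta w = nblocks n theta w.
  by move=> ne; rewrite /nblocks nn'.
have w0c : w0 \in tiny_classes a by rewrite mem_tiny_classes rw0.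
have [ws1 [ws2 [wsE w01 w02]]] : exists ws1 ws2, [/\ tiny_classes a = ws1 ++ w0 :: ws2, w0 \notin ws1 & w0 \notin ws2].
  have := tiny_classes_uniq a; case/splitPr: w0c => ws1 ws2 u; exists ws1, ws2; split=> //.
    by move: u; rewrite cat_uniq => /and3P[_ /norP[]].
  by move: u; rewrite cat_uniq => /and3P[_ _ /andP[]].
have mapE ws : w0 \notin ws -> [seq class_blocks n' theta w | w <- ws] =
    [seq class_blocks n theta w | w <- ws].
  move=> w0ws; apply/eq_in_map => w wws; rewrite /class_blocks nb_same //.
  by apply: contra w0ws => /eqP <-.
have blocksE n0 : blocks n0 theta a = flatten [seq class_blocks n0 theta w | w <- ws1] ++
    class_blocks n0 theta w0 ++ flatten [seq class_blocks n0 theta w | w <- ws2].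
  by rewrite /blocks wsE map_cat flatten_cat.
rewrite !blocksE !mapE //.
case: (crossings _ _ _ _) nbE c1 => [|[|//]] nbE _; [left|right]; split=> //.
  by rewrite /class_blocks nbE addn0.
have -> : class_blocks n' theta w0 = class_blocks n theta w0 ++ [:: bkey w0 (nblocks n theta w0)].
  by rewrite /class_blocks nbE iotaD map_cat.
exists (flatten [seq class_blocks n theta w | w <- ws1] ++ class_blocks n theta w0),
  (flatten [seq class_blocks n theta w | w <- ws2]), (nblocks n theta w0).
by rewrite -!catA.
Qed.

End Slabs.

Lemma leq_sum_cond (T : eqType) (s : seq T) (P Q : pred T) (f g : T -> nat) :
  (forall x, x \in s -> P x -> Q x && (f x <= g x)) ->
  \sum_(x <- s | P x) f x <= \sum_(x <- s | Q x) g x.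
Proof.
move=> H; rewrite [X in X <= _]big_mkcond [X in _ <= X]big_mkcond; apply: leq_sum_seq => x xs _.
by case: ifP => // /(H x xs) /andP[->].
Qed.

(** * Addresses inside the slabs *)

Section TinyAddress.
Variables (e B' a theta : nat).
Notation K := ('I_B'.+1 * 'I_B'.+1)%type.
Implicit Types (X Y : objects) (ros : nat -> seq nat) (P : K -> nat).

Definition tiny_slot ros w x := index x (ros w) + theta %% per_block e w.
Definition tiny_key ros w x : K := bkey B' w (tiny_slot ros w x %/ per_block e w).
Definition tiny_offset ros w x := tiny_slot ros w x %% per_block e w * w.
Definition tiny_address P ros w x := P (tiny_key ros w x) + tiny_offset ros w x.
Definition counts ros w := size (ros w).
Let blks ros := blocks e B' (counts ros) theta a.

Hypothesis aB : 2 ^ a <= B'.+1.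

Lemma tiny_slot_lt ros w x : x \in ros w ->
  tiny_slot ros w x %/ per_block e w < nblocks e (counts ros) theta w.
Proof.
by move=> xr; rewrite ltnS; apply: leq_div2r; rewrite leq_add2r ltnW // index_mem.
Qed.

Lemma tiny_key_mem ros w x : x \in ros w -> rounded e w -> w < 2 ^ a -> tiny_key ros w x \in blks ros.
Proof.
move=> xr rw wa; apply/mem_blocks => //; exists w, (tiny_slot ros w x %/ per_block e w).
by split=> //; apply: tiny_slot_lt.
Qed.

Lemma tiny_offset_le ros w x : 0 < w -> tiny_offset ros w x + w <= block_size e w.
Proof.
move=> w0; apply: leq_trans (per_block_le e w); rewrite addnC -mulSn leq_mul2r.
by rewrite ltn_pmod ?per_block_gt0 ?orbT.
Qed.

Lemma tiny_slot_inj ros w x y : x \in ros w -> y \in ros w ->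
  tiny_slot ros w x = tiny_slot ros w y -> x = y.
Proof.
move=> xr yr /addIn E; have := nth_index x xr; rewrite E => <-.
by rewrite nth_index.
Qed.

(** Objects of one block have distinct slots modulo [per_block], so their sizes add up to at most
    its length. With [f] the indicator of moved blocks, moved objects are charged to moved
    blocks. *)
Lemma slab_packing X ros (f : K -> nat) : positive X -> roster_ok e X ros ->
    (forall w, w < 2 ^ a -> nblocks e (counts ros) theta w <= B'.+1) ->
  \sum_(y <- domf X | cls e X y < 2 ^ a) cls e X y * f (tiny_key ros (cls e X y) y) <=
  \sum_(k <- blks ros) bsize e k * f k.
Proof.
move=> pX ok nB; have rX y : y \in domf X -> rounded e (cls e X y).
  by move=> yX; rewrite rup_rounded // pX.
have inr y : y \in domf X -> y \in ros (cls e X y) by move=> yX; rewrite (roster_mem ok) yX eqxx.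
have ub := blocks_uniq aB nB.
apply: (@leq_trans (\sum_(y <- domf X | cls e X y < 2 ^ a)
    \sum_(k <- blks ros | tiny_key ros (cls e X y) y == k) cls e X y * f k)).
  apply: leq_sum_seq => y yX ya; rewrite (big_rem (tiny_key ros (cls e X y) y)) ?eqxx ?leq_addr //.
  exact: tiny_key_mem (inr y yX) (rX y yX) ya.
rewrite (exchange_big_dep predT) //=; apply: leq_sum_seq => k /mem_blocks [w [t [rw wa tn ->]]] _.
have /andP[w0 _] := rw.
rewrite -big_distrl /= leq_mul2r; apply/orP; right; rewrite (bsize_bkey e aB) //.
rewrite -big_filter; set s := [seq y <- _ | _].
have sP y : y \in s -> [/\ cls e X y = w, y \in ros w & tiny_slot ros w y %/ per_block e w = t].
  rewrite mem_filter => /andP[/andP[ya /eqP E] yX].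
  have [] := bkey_inj aB _ _ _ _ E => //.
  - exact: leq_trans (tiny_slot_lt (inr y yX)) (nB _ ya).
  - exact: leq_trans tn (nB _ wa).
  by move=> cw tE; rewrite -cw; split=> //; apply: inr.
have -> : \sum_(y <- s) cls e X y = size s * w.
  rewrite -sum1_size big_distrl /=; apply: eq_big_seq => y /sP[-> _ _]; by rewrite mul1n.
apply: leq_trans (per_block_le e w); rewrite leq_mul2r; apply/orP; right.
rewrite -(size_map (fun y => tiny_slot ros w y %% per_block e w)) -[X in _ <= X](size_iota 0).
apply: uniq_leq_size.
  rewrite map_inj_in_uniq ?filter_uniq ?fset_uniq // => y y' /sP[_ yr yt] /sP[_ y'r y't] E.
  apply: (@tiny_slot_inj ros w) => //.
  by rewrite (divn_eq (tiny_slot ros w y) (per_block e w)) yt E -y't -divn_eq.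
by move=> z /mapP[y _ ->]; rewrite mem_iota /= add0n ltn_pmod // per_block_gt0.
Qed.

(** Only one object can change its slot, and it then has the class of [x]; every other tiny object
    moves only together with its block. *)
Lemma tiny_moved_le X ros x Y ros' P P' : positive X -> roster_ok e X ros ->
    roster_extends e X ros x Y ros' ->
    (forall w, w < 2 ^ a -> nblocks e (counts ros) theta w <= B'.+1) ->
  \sum_(y <- domf X | (cls e X y < 2 ^ a) &&
     (tiny_address P ros (cls e X y) y != tiny_address P' ros' (cls e Y y) y)) cls e X y <=
  (if cls e Y x < 2 ^ a then cls e Y x else 0) +
  \sum_(k <- blks ros) bsize e k * (P k != P' k).
Proof.
move=> pX ok ext nB; have [y0 y0P] := rext_index ext; have E := rext ext.
apply: leq_trans (leq_add (leqnn _) (slab_packing (fun k => P k != P' k : nat) pX ok nB)).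
rewrite (bigID (fun y => (y == y0) && (cls e X y == cls e Y x))) /=; apply: leq_add.
  apply: (@leq_trans (\sum_(y <- domf X | (y == y0) && (cls e Y x < 2 ^ a)) cls e Y x)).
    rewrite big_mkcond [X in _ <= X]big_mkcond; apply: leq_sum => y _.
    by case: ifP => // /andP[/andP[ya _] /andP[-> /eqP E1]]; rewrite -E1 ya.
  case: ifP => wa; last by rewrite big_pred0 // => y; rewrite andbF.
  rewrite (eq_bigl (pred1 y0)); last by move=> y; rewrite andbT.
  rewrite -big_filter; have : size (filter (pred1 y0) (domf X)) <= 1.
    by rewrite size_filter count_uniq_mem ?fset_uniq //; case: (_ \in _).
  by case: (filter _ _) => [|y [|//]] _; rewrite ?big_nil ?big_seq1.
apply: leq_sum_cond => y yX /andP[/andP[ya /eqP ne] exc]; rewrite ya /=.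
have yr : y \in ros (cls e X y) by rewrite (roster_mem ok) yX eqxx.
have idx : index y (ros' (cls e X y)) = index y (ros (cls e X y)).
  case: (eqVneq y y0) exc => [yy0|yy0 _] /=; last exact: y0P.
  by move=> ne'; rewrite (rext_same ext).
have cE : cls e Y y = cls e X y := extends_cls e E yX.
have kE : tiny_key ros' (cls e X y) y = tiny_key ros (cls e X y) y by rewrite /tiny_key /tiny_slot idx.
rewrite leq_pmulr //; case: eqP => // PE; case: ne.
by rewrite cE /tiny_address kE PE /tiny_offset /tiny_slot idx.
Qed.

End TinyAddress.

(** * Changing the window and the list of blocks *)

Section HashStep.
Variables (D' : nat) (K : finType) (bs : K -> nat).
Let D := D'.+1.
Implicit Types (O : {set 'I_D}).

Definition window (b p p' : nat) : {set 'I_D} := [set z : 'I_D | p * b <= z < p' * b].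
(** Everything outside the window counts as occupied, so a shift of the window is a change of the
    occupied set. *)
Definition region (b p p' : nat) : {set 'I_D} := ~: window b p p'.

Lemma card_window_le b p p' : #|window b p p'| <= (p' - p) * b.
Proof.
have -> : #|window b p p'| = size [seq val z | z <- enum (window b p p')] by rewrite size_map -cardE.
rewrite -[X in _ <= X](size_iota (p * b)); apply: uniq_leq_size.
  by rewrite map_inj_uniq ?enum_uniq //; apply: val_inj.
move=> z /mapP[x]; rewrite mem_enum inE => /andP[lo hi] -> /=.
rewrite mem_iota lo /= mulnBl; apply: leq_trans hi _; rewrite -leq_subLR //.
Qed.

Lemma card_window b p p' : p <= p' -> p' * b <= D -> #|window b p p'| = (p' - p) * b.
Proof.
move=> pp' leD; apply/eqP; rewrite eqn_leq card_window_le /=.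
have -> : #|window b p p'| = size [seq val z | z <- enum (window b p p')] by rewrite size_map -cardE.
rewrite -[X in X <= _](size_iota (p * b)); apply: uniq_leq_size; first exact: iota_uniq.
move=> z; rewrite mem_iota mulnBl subnKC ?leq_mul2r ?pp' ?orbT // => /andP[lo hi].
have zD : z < D := leq_trans hi leD.
by apply/mapP; exists (Ordinal zD) => //; rewrite mem_enum inE /= lo.
Qed.

Lemma card_region b p p' : p <= p' -> p' * b <= D -> #|region b p p'| = D - (p' - p) * b.
Proof. by move=> pp' leD; rewrite cardsCs setCK card_ord card_window. Qed.

Lemma region_aligned b b' p p' : 0 < b' -> b' %| b -> aligned b' (region b p p').
Proof.
move=> b0 /dvdnP[q ->] z z' E; rewrite !inE; apply: contra.
have lo x : (p * q * b' <= x) = (p * q <= x %/ b') by rewrite leq_divRL.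
have hi x : (x < p' * q * b') = (x %/ b' < p' * q) by rewrite ltn_divLR.
by rewrite !mulnA !lo !hi E.
Qed.

(** Two windows differ only between their left ends and between their right ends. *)
Lemma card_regionD b p p' q q' : p <= q -> p' <= q' ->
  #|region b p p'| - #|region b p p' :&: region b q q'| +
  (#|region b q q'| - #|region b p p' :&: region b q q'|) <= (q - p + (q' - p')) * b.
Proof.
move=> pq pq'; rewrite addnC mulnDl.
have diff (A B C : {set 'I_D}) : A :\: B \subset C -> #|A| - #|A :&: B| <= #|C|.
  move=> H; apply: leq_trans (subset_leq_card H); rewrite -(cardsID B A); lia.
apply: leq_add.
  rewrite setIC; apply: leq_trans (card_window_le b p q); apply: diff.
  apply/subsetP => z; rewrite !inE !negbK => /andP[/andP[-> hi]].
  apply: contraR; rewrite -leqNgt => -> /=; apply: leq_trans hi _; by rewrite leq_mul2r pq' orbT.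
apply: leq_trans (card_window_le b p' q'); apply: diff.
apply/subsetP => z; rewrite !inE !negbK => /andP[/andP[lo ->]]; rewrite andbT.
apply: contraR; rewrite -ltnNge => ->; rewrite andbT; apply: leq_trans lo.
by rewrite leq_mul2r pq orbT.
Qed.

Variable R : realFieldType.
Local Open Scope ring_scope.
(* [Lg] is to be the natural logarithm: [harm] is a lower Riemann sum of 1 / x. *)
Variables (Lg : R -> R) (H : R).
Hypothesis Lg_ge : forall x y : R, 0 < y -> y <= x -> (x - y) / x <= Lg x - Lg y.

Lemma harm_le F ys : (total bs ys)%:R < F -> harm bs F ys <= Lg F - Lg (F - (total bs ys)%:R).
Proof.
elim: ys F => [|y ys IH] F /=; first by rewrite /total big_nil subr0 subrr.
rewrite total_cons natrD => lt; rewrite opprD addrA.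
have H2 : (total bs ys)%:R < F - (bs y)%:R by rewrite ltrBrDl.
apply: le_trans (lerD (_ : _ <= Lg F - Lg (F - (bs y)%:R)) (IH _ H2)) _.
  have := @Lg_ge F (F - (bs y)%:R); rewrite subKr; apply.
    by apply: le_lt_trans H2; apply: ler0n.
  by rewrite lerBlDr lerDl ler0n.
by rewrite addrA subrK.
Qed.

Variable (G : nat) (Fmax : R).
Hypothesis H_ge : forall x y : R, G%:R <= y -> y <= x -> x <= Fmax -> Lg x - Lg y <= H.
Hypothesis G0 : (0 < G)%N.
Notation W := {ffun K -> 'S_D}.

Lemma harm_bound (x : nat) ys : (x + total bs ys + G <= D)%N -> D%:R - x%:R <= Fmax ->
  harm bs (D%:R - x%:R) ys <= H.
Proof.
move=> le lx; have xD : (x + total bs ys)%:R + G%:R <= D%:R :> R by rewrite -natrD ler_nat.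
have Gp : 0 < G%:R :> R by rewrite ltr0n.
apply: le_trans (harm_le _) _.
  rewrite ltrBrDl -natrD; apply: lt_le_trans xD; by rewrite ltrDl.
apply: H_ge => //; last by rewrite lerBlDr lerDl ler0n.
by rewrite -addrA -opprD -natrD lerBrDl.
Qed.

Lemma sum_moved_le ys O O' : uniq ys -> decreasing D' bs ys -> aligned_all bs ys O ->
    aligned_all bs ys O' -> O \subset O' -> (#|O'| + total bs ys + G <= D)%N -> D%:R - #|O|%:R <= Fmax ->
  \sum_(w : W) (moved bs w O O' ys)%:R <= #|{: W}|%:R * (#|O'| - #|O|)%:R * H.
Proof.
move=> u d al al' OO' le lF; have OO'c := subset_leq_card OO'.
apply: le_trans (sum_moved R u d al al' OO' (leq_trans (leq_addr _ _) le)) _.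
apply: ler_wpM2l; first by rewrite mulr_ge0 ?ler0n.
apply: harm_bound => //; apply: leq_trans le; by rewrite !leq_add2r.
Qed.

Lemma sum_moved_insert_le ys x zs O : uniq (ys ++ x :: zs) -> decreasing D' bs (ys ++ x :: zs) ->
    aligned_all bs (ys ++ x :: zs) O -> (#|O| + total bs (ys ++ x :: zs) + G <= D)%N ->
    D%:R - #|O|%:R <= Fmax ->
  \sum_(w : W) (moved_insert bs w O ys x zs)%:R <= #|{: W}|%:R * (bs x)%:R * H.
Proof.
move=> u d al le lF.
apply: le_trans (sum_moved_insert R u d al (leq_trans (leq_addr _ _) le)) _.
apply: ler_wpM2l; first by rewrite mulr_ge0 ?ler0n.
rewrite -addrA -opprD -natrD; apply: harm_bound.
  apply: leq_trans le; rewrite leq_add2r /total !big_cat big_cons /= -addnA !leq_add2l leq_addl //.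
apply: le_trans lF; rewrite lerD2l lerN2 ler_nat leq_addr //.
Qed.

(** [sum_moved] compares nested sets only, so the change passes through [O :&: O']: free the
    positions of the difference, insert the block, then occupy [O']. The intermediate stage has the
    most free space, hence the hypothesis on [Fmax]. *)
Lemma hash_step ys ys' O O' c :
    (ys' = ys /\ c = 0%N) \/ (exists l r x, [/\ ys = l ++ r, ys' = l ++ x :: r & c = bs x]) ->
    uniq ys' -> decreasing D' bs ys' -> aligned_all bs ys' O -> aligned_all bs ys' O' ->
    (#|O| + total bs ys' + G <= D)%N -> (#|O'| + total bs ys' + G <= D)%N ->
    D%:R - #|O :&: O'|%:R <= Fmax ->
  \sum_(w : W) (\sum_(k <- ys) bs k * (pos bs w O ys k != pos bs w O' ys' k))%N%:R <=
    #|{: W}|%:R * H * (#|O| - #|O :&: O'| + (#|O'| - #|O :&: O'|) + c)%:R.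
Proof.
move=> ins u' d' al al' le le' lF; set I := O :&: O'.
have IO : I \subset O by apply: subsetIl.
have IO' : I \subset O' by apply: subsetIr.
have alI : aligned_all bs ys' I.
  by move=> y yys z z' E; rewrite !inE => /andP[/(al y yys _ _ E)-> /(al' y yys _ _ E)->].
have sub : subseq ys ys'.
  case: ins => [[-> _]//|[l [r [x [-> -> _]]]]]; by rewrite cat_subseq // subseq_cons.
have u : uniq ys := subseq_uniq sub u'.
have d : decreasing D' bs ys.
  move: d' => /andP[d1 d2]; apply/andP; split; last exact: subseq_pairwise sub d2.
  by apply/allP => y /(mem_subseq sub) /(allP d1).
have alys (P : {set 'I_D}) : aligned_all bs ys' P -> aligned_all bs ys P.
  by move=> alP y /(mem_subseq sub) /alP.
have tot : (total bs ys <= total bs ys')%N.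
  by apply: leq_sum_sub => // y /(mem_subseq sub).
have leys : (#|O| + total bs ys + G <= D)%N by apply: leq_trans le; rewrite leq_add2r leq_add2l.
have H1 := sum_moved_le u d (alys I alI) (alys O al) IO leys lF.
have H2 := sum_moved_le u' d' alI al' IO' le' lF.
pose mid (w : W) := (\sum_(k <- ys) bs k * (pos bs w I ys k != pos bs w I ys' k))%N.
have H3 : \sum_(w : W) (mid w)%:R <= #|{: W}|%:R * c%:R * H.
  case: ins => [[E ->]|[l [r [x [E E' ->]]]]].
    rewrite mulr0 mul0r big1 // => w _; rewrite /mid E big1 // => k _; by rewrite eqxx muln0.
  rewrite /mid E E'; apply: sum_moved_insert_le; rewrite -?E' //.
  by apply: leq_trans le; rewrite !leq_add2r subset_leq_card.
apply: le_trans (_ : _ <= \sum_(w : W) ((moved bs w I O ys)%:R + (mid w)%:R + (moved bs w I O' ys')%:R)) _.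
  apply: ler_sum => w _; rewrite -!natrD ler_nat.
  have : (\sum_(k <- ys) bs k * (pos bs w I ys' k != pos bs w O' ys' k) <= moved bs w I O' ys')%N.
    by apply: leq_sum_sub => // y /(mem_subseq sub).
  rewrite -(leq_add2l (moved bs w I O ys + mid w)); apply: leq_trans.
  rewrite /moved /mid -!big_split; apply: leq_sum => k _ /=; rewrite -!mulnDr leq_mul2l.
  apply/orP; right; case: eqP => //= H0; case: eqP => //= E1; case: eqP => //= E2; case: eqP => //= E3.
  by case: H0; rewrite -E1 E2 E3.
rewrite !big_split /=; apply: le_trans (lerD (lerD H1 H3) H2) _.
by rewrite !natrD le_eqVlt; apply/orP; left; apply/eqP; ring.
Qed.

End HashStep.

(** * The allocator *)

Section Allocator.
Variables e kap Q : nat.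
Hypothesis e6 : 6 <= e.
Hypothesis kapP : e < 2 ^ kap.
(* The memory ['I_(2 ^ Q)] is written ['I_D'.+1] to be visibly inhabited. *)
Let D' := (2 ^ Q).-1.
Notation K := ('I_D'.+1 * 'I_D'.+1)%type.
Notation W := {ffun K -> 'S_D'.+1}.
Implicit Types (us : seq update) (theta : nat) (w : W).

Let DE : D'.+1 = 2 ^ Q. Proof. by rewrite prednK // expn_gt0. Qed.

Definition tiny_load X a := \sum_(x <- domf X | cls e X x < 2 ^ a) cls e X x.
Definition lam theta us := phase (load e (live_after us)) theta.
(** A common multiple of the lengths of all tiny blocks, so windows of whole pages are aligned for
    each of them. *)
Definition page a := 2 ^ (a + e + 3).
(** Eight times the gap 2^(l - e): it absorbs the waste of the slabs and the rounding to pages and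
    still leaves a gap free, without which [harm] would not be O(e). *)
Definition reserve l := 2 ^ (l - e + 3).
(** The extra page puts the start past the core although the shifted quotient is rounded down. *)
Definition page_lo theta us (a : nat) :=
  ((mass (core e (live_after us) a) + theta %% page a) %/ page a).+1.
Definition page_cnt theta us (l a : nat) :=
  (tiny_load (live_after us) a + reserve l + theta %% page a) %/ page a.
Definition page_hi theta us l a := page_lo theta us a + page_cnt theta us l a.
Definition tiny_region theta us : {set 'I_D'.+1} :=
  region D' (page (lvl e theta us)) (page_lo theta us (lvl e theta us))
    (page_hi theta us (lam theta us) (lvl e theta us)).
Definition tiny_blocks theta us : seq K :=
  blocks e D' (counts (roster e us)) theta (lvl e theta us).
Definition block_pos theta w us : K -> nat :=
  pos (bsize e (B':=D')) w (tiny_region theta us) (tiny_blocks theta us).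

Definition address theta w us (x : nat) : nat :=
  let v := cls e (live_after us) x in
  if 2 ^ lvl e theta us <= v then lpos (flat (layout_after e kap theta us)) x
  else tiny_address e theta (block_pos theta w us) (roster e us) v x.

Lemma load_split X a : load e X = mass (core e X a) + tiny_load X a.
Proof.
rewrite /load (bigID (fun x => 2 ^ a <= cls e X x)) /= /mass /core big_map big_filter; congr (_ + _).
by apply: eq_bigl => x; rewrite -ltnNge.
Qed.

(** * Space taken by the tiny objects *)

Section Capacity.
Variables (theta l : nat) (us : seq update).
Let a := l - 4 * e.
Let X := live_after us.
Let G := 2 ^ (l - e).
Let b := page a.
Hypothesis legal_us : legal_from [fmap]%fmap us.
Hypothesis a_gt0 : 0 < a.
Hypothesis load_lt : load e X < 2 ^ (l + 2).
Hypothesis lQ : l + 4 <= Q.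

Let lE : l = a + 4 * e. Proof. by rewrite /a subnK // ltnW // -subn_gt0. Qed.
Let le : e <= l. Proof. rewrite lE; clear; lia. Qed.

Lemma cap_gap : 2 ^ (l + 2) = 2 ^ (e + 2) * G.
Proof. by rewrite /G -expnD; congr (2 ^ _); move: le; clear; lia. Qed.

Lemma cap_page : b <= G.
Proof. by rewrite /b /page /G leq_exp2l // lE; move: e6; clear; lia. Qed.

Lemma cap_reserve : reserve l = 8 * G.
Proof. by rewrite /reserve expnD mulnC. Qed.

Lemma cap_page_gt0 : 0 < b. Proof. by rewrite expn_gt0. Qed.

Lemma cap_aQ : 2 ^ a <= D'.+1.
Proof. by rewrite DE leq_exp2l //; move: lE lQ; clear; lia. Qed.

Lemma cap_page_dvd : b %| D'.+1.
Proof. by rewrite DE dvdn_exp2l //; move: lE lQ e6; clear; lia. Qed.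

Lemma cap_tiny_lt : tiny_load X a < 2 ^ (l + 2).
Proof. by apply: leq_ltn_trans load_lt; rewrite (load_split X a) leq_addl. Qed.

Lemma cap_counts v : 0 < v -> counts (roster e us) v <= load e X.
Proof.
move=> v0; have := roster_sum (roster_live e legal_us) (isT : uniq [:: v]).
rewrite big_seq1 => E; apply: (@leq_trans (counts (roster e us) v * v)); first by rewrite leq_pmulr.
rewrite E; rewrite big_mkcond; apply: leq_sum => x _; by case: ifP.
Qed.

Lemma cap_nblocks v : nblocks e (counts (roster e us)) theta v <= D'.+1.
Proof.
rewrite /nblocks DE; have [->|v0] := posnP v; first by rewrite /per_block divn0 modn0 divn0 expn_gt0.
have q0 := per_block_gt0 e v0; apply: (@leq_trans (2 ^ (l + 2) + 2)).
  rewrite addn2 !ltnS; apply: leq_trans (_ : _ <= (counts (roster e us) v + per_block e v) %/ per_block e v) _.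
    by apply: leq_div2r; rewrite leq_add2l ltnW // ltn_pmod.
  rewrite (divnDr _ (dvdnn _)) divnn q0 addn1 ltnS.
  by apply: leq_trans (leq_div _ _) _; apply: leq_trans (cap_counts v0) (ltnW load_lt).
apply: (@leq_trans (2 ^ (l + 3))); last by rewrite leq_exp2l //; move: lQ; clear; lia.
by rewrite (addnS l 2) expnS mul2n -addnn leq_add2l -{1}(expn1 2) leq_exp2l // addn2.
Qed.

Lemma cap_tiny_sum : \sum_(v <- tiny_classes e a) counts (roster e us) v * v = tiny_load X a.
Proof.
rewrite (roster_sum (roster_live e legal_us)) ?tiny_classes_uniq // /tiny_load.
rewrite big_seq_cond [RHS]big_seq_cond; apply: eq_bigl => x; rewrite mem_tiny_classes.
case: (boolP (x \in _)) => //= xX; rewrite rup_rounded //; exact: live_positive legal_us _ xX.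
Qed.

(** In [total_blocks_le], before division by 2^(e + 2), the two waste terms are the tiny load, below
    2^(e + 2) * G, and 2^(a + 3 e + 7) = 2^7 * G. Each costs at most one [G]. *)
Lemma cap_total : total (bsize e (B':=D')) (blocks e D' (counts (roster e us)) theta a) <= tiny_load X a + 2 * G.
Proof.
have := @total_blocks_le e D' a cap_aQ (counts (roster e us)) theta.
rewrite cap_tiny_sum; have P0 : 0 < 2 ^ (e + 2) by rewrite expn_gt0.
move=> H; rewrite -(leq_pmul2l P0); apply: leq_trans H _.
have tl := cap_tiny_lt; rewrite cap_gap in tl.
have -> : 2 ^ (a + 3 * e + 7) = 2 ^ 7 * G by rewrite /G -expnD; congr (2 ^ _); move: lE; clear; lia.
have H7 : 2 ^ 7 * G <= 2 ^ (e + 2) * G by rewrite leq_mul2r leq_exp2l ?orbT //; move: e6; clear; lia.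
rewrite mulSn mulnDr (mulnCA _ 2); move: tl H7; move: (2 ^ (e + 2) * G) (2 ^ 7 * G) (2 ^ (e + 2) * _) (tiny_load X a).
by clear; lia.
Qed.

Lemma cap_cnt : tiny_load X a + 7 * G <= page_cnt theta us l a * b <= tiny_load X a + 9 * G.
Proof.
have aux P L r c H : P <= L + 8 * H + r -> L + 8 * H + r < c + P -> r < c -> c <= H ->
  L + 7 * H <= P <= L + 9 * H by clear; lia.
rewrite /page_cnt -/X -/b cap_reserve.
have b0 := cap_page_gt0; have bG := cap_page; have tb := ltn_pmod theta b0.
have H1 := leq_trunc_div (tiny_load X a + 8 * G + theta %% b) b.
have H2 := ltn_ceil (tiny_load X a + 8 * G + theta %% b) b0; rewrite mulSn in H2.
exact: aux H1 H2 tb bG.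
Qed.

Lemma cap_lo : mass (core e X a) <= page_lo theta us a * b <= mass (core e X a) + 2 * G.
Proof.
have aux P L r c H : P <= L + r -> L + r < c + P -> r < c -> c <= H ->
  L <= c + P <= L + 2 * H by clear; lia.
rewrite /page_lo -/X -/b; have b0 := cap_page_gt0; have bG := cap_page; have tb := ltn_pmod theta b0.
have H1 := leq_trunc_div (mass (core e X a) + theta %% b) b.
have H2 := ltn_ceil (mass (core e X a) + theta %% b) b0; rewrite mulSn in H2 *.
exact: aux H1 H2 tb bG.
Qed.

Lemma cap_hi : page_hi theta us l a * b <= load e X + 11 * G.
Proof.
have aux x y z : x + 2 * z + (y + 9 * z) <= x + y + 11 * z by clear; lia.
rewrite /page_hi mulnDl (load_split X a); have /andP[_ H1] := cap_cnt; have /andP[_ H2] := cap_lo.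
apply: leq_trans (leq_add H2 H1) _; exact: aux.
Qed.

Lemma cap_hiD : page_hi theta us l a * b <= D'.+1.
Proof.
apply: leq_trans cap_hi _; rewrite DE; apply: (@leq_trans (2 ^ (l + 3))); last first.
  by rewrite leq_exp2l //; move: lQ; clear; lia.
rewrite (addnS l 2) expnS mul2n -addnn; apply: leq_add; first exact: ltnW.
rewrite cap_gap leq_mul2r; apply/orP; right; apply: (@leq_trans (2 ^ 4)) => //.
by rewrite leq_exp2l //; move: e6; clear; lia.
Qed.

Lemma cap_region : #|region D' b (page_lo theta us a) (page_hi theta us l a)| =
  D'.+1 - page_cnt theta us l a * b.
Proof. by rewrite card_region ?leq_addr ?cap_hiD // /page_hi addKn. Qed.

Lemma cap_cntD : page_cnt theta us l a * b <= D'.+1.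
Proof. by apply: leq_trans cap_hiD; rewrite leq_mul2r leq_addl orbT. Qed.

End Capacity.

(** * Validity of the addresses *)

Section Valid.
Variables (theta : nat) (w : W) (us : seq update).
Hypothesis legal_us : legal_from [fmap]%fmap us.
Hypothesis Q5 : 5 <= Q.
Hypothesis load_Q : load e (live_after us) < 2 ^ (Q - 5).
Let X := live_after us.
Let a := lvl e theta us.
Let l := lam theta us.
Let b := page a.

Lemma lam_bounds : load e X < 2 ^ (l + 2) /\ l + 4 <= Q.
Proof.
rewrite /l /lam -/X; have [L0|L0] := posnP (load e X).
  have -> : phase (load e X) theta = 0 by rewrite L0 /phase trunc_log0; case: ifP.
  by rewrite L0; split=> //; apply: leq_trans Q5.
have /andP[lo ->] := phase_bounds theta L0; split=> //.
have : phase (load e X) theta < Q - 5 by rewrite -(@ltn_exp2l 2) //; apply: leq_ltn_trans lo load_Q.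
by move: Q5; clear; lia.
Qed.

Lemma blocks_aligned lo hi : 0 < a ->
  aligned_all (bsize e (B':=D')) (tiny_blocks theta us) (region D' b lo hi).
Proof.
move=> a0 k /mem_blocks[v [t [rv va _ ->]]].
have [H1 H2] := lam_bounds; rewrite (bsize_bkey e (cap_aQ a0 H2)) //.
by apply: region_aligned; [exact: block_size_gt0 | exact: block_size_tiny].
Qed.

Lemma blocks_ok : 0 < a ->
  [/\ uniq (tiny_blocks theta us), decreasing D' (bsize e (B':=D')) (tiny_blocks theta us) &
     #|tiny_region theta us| + total (bsize e (B':=D')) (tiny_blocks theta us) <= D'.+1].
Proof.
move=> a0; have [H1 H2] := lam_bounds; split.
- apply: blocks_uniq; first exact: cap_aQ a0 H2.
  by move=> v _; apply: cap_nblocks legal_us H1 H2 _.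
- by apply: blocks_decreasing; [exact: cap_aQ a0 H2 | exact: cap_page_dvd a0 H2].
have cD := cap_cntD theta a0 H1 H2.
rewrite /tiny_region (cap_region theta a0 H1 H2) -[X in _ <= X](subnK cD) leq_add2l.
apply: leq_trans (cap_total theta legal_us a0 H1 H2) _.
have /andP[H3 _] := cap_cnt theta us a0; apply: leq_trans H3.
by rewrite leq_add2l leq_mul2r orbT.
Qed.

Lemma block_pos_ok : 0 < a ->
  (forall k, k \in tiny_blocks theta us ->
     page_lo theta us a * b <= block_pos theta w us k /\
     block_pos theta w us k + bsize e k <= page_hi theta us l a * b) /\
  (forall k k' z, k \in tiny_blocks theta us -> k' \in tiny_blocks theta us ->
     block_pos theta w us k <= z < block_pos theta w us k + bsize e k ->
     block_pos theta w us k' <= z < block_pos theta w us k' + bsize e k' -> k = k').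
Proof.
move=> a0; have [u d c] := blocks_ok a0.
have [V1 V2] := pos_valid w u d (@blocks_aligned _ _ a0) c.
have inb k z : k \in tiny_blocks theta us ->
    block_pos theta w us k <= z < block_pos theta w us k + bsize e k ->
    z < D'.+1 /\ z %/ bsize e k = block_pos theta w us k %/ bsize e k.
  move=> kb; have [d1 d2 _] := V1 k kb; have /andP[/allP dec _] := d.
  have /andP[s0 sD] := dec k kb; move: d1 d2; rewrite -/(block_pos theta w us k).
  case/dvdnP => p ->; rewrite mulnK // => d2 /andP[z1 z2].
  have zp : z %/ bsize e k = p.
    apply/eqP; rewrite eqn_leq leq_divRL // z1 andbT -ltnS ltn_divLR // mulSn addnC.
    by rewrite z2.
  split=> //; apply: leq_trans z2 _; rewrite addnC -mulSn.
  by case/dvdnP: sD d2 => r ->; rewrite ltn_mul2r leq_mul2r => /andP[_ ->]; rewrite orbT.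
split=> [k kb|k k' z kb k'b zk zk'].
  have /andP[/allP dec _] := d; have /andP[s0 _] := dec k kb.
  have [_ _ V3] := V1 k kb.
  have out z : block_pos theta w us k <= z < block_pos theta w us k + bsize e k ->
      page_lo theta us a * b <= z < page_hi theta us l a * b.
    move=> zk; have [zD zE] := inb k z kb zk; have := V3 (Ordinal zD) zE.
    by rewrite /tiny_region !inE negbK.
  have /out/andP[-> _] : block_pos theta w us k <= block_pos theta w us k < block_pos theta w us k + bsize e k.
    by rewrite leqnn -{1}[block_pos _ _ _ _]addn0 ltn_add2l.
  have /out/andP[_] : block_pos theta w us k <= block_pos theta w us k + (bsize e k).-1 < block_pos theta w us k + bsize e k.
    by rewrite leq_addr ltn_add2l ltn_predL.
  by rewrite -addnS prednK.
have [zD zE] := inb k z kb zk; have [_ zE'] := inb k' z k'b zk'.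
exact: V2 (Ordinal zD) kb k'b zE zE'.
Qed.

Lemma class_gt0 x : x \in domf X -> rounded e (cls e X x) /\ 0 < cls e X x.
Proof.
move=> xX; have p := live_positive legal_us xX.
by rewrite rup_rounded //; split=> //; apply: rup_gt0.
Qed.

Lemma tiny_level x : x \in domf X -> cls e X x < 2 ^ a -> 0 < a.
Proof.
by move=> xX; have [_ c0] := class_gt0 xX; case: (a) => //; rewrite expn0 ltnS leqNgt c0.
Qed.

Lemma in_roster x : x \in domf X -> x \in roster e us (cls e X x).
Proof. by move=> xX; rewrite (roster_mem (roster_live e legal_us)) xX eqxx. Qed.

Lemma tiny_key_in x : x \in domf X -> cls e X x < 2 ^ a ->
  tiny_key e D' theta (roster e us) (cls e X x) x \in tiny_blocks theta us.
Proof.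
move=> xX xa; have a0 := tiny_level xX xa; have [_ H2] := lam_bounds.
by apply: tiny_key_mem => //; [exact: in_roster | case: (class_gt0 xX)].
Qed.

Lemma tiny_interval x : x \in domf X -> cls e X x < 2 ^ a ->
  let k := tiny_key e D' theta (roster e us) (cls e X x) x in
  block_pos theta w us k <= address theta w us x /\
  address theta w us x + cls e X x <= block_pos theta w us k + bsize e k.
Proof.
move=> xX xa; have a0 := tiny_level xX xa; have [_ H2] := lam_bounds.
rewrite /address -/X -/a (leqNgt (2 ^ a)) xa /= /tiny_address; split; first exact: leq_addr.
rewrite -addnA leq_add2l (bsize_bkey e (cap_aQ a0 H2)) //.
by apply: tiny_offset_le; case: (class_gt0 xX).
Qed.

Lemma core_interval x : x \in domf X -> 2 ^ a <= cls e X x ->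
  address theta w us x + cls e X x <= mass (core e X a).
Proof.
move=> xX ax; rewrite /address -/X -/a ax.
have I := layout_inv kapP theta legal_us; have p := inv_perm I.
rewrite -(perm_mass p); apply: (@lpos_le _ (x, cls e X x)).
  by rewrite (perm_uniq (perm_map _ p)) core_names_uniq.
by rewrite (perm_mem p); apply: map_f; rewrite mem_filter ax.
Qed.

(** The excess of 11 gaps in [cap_hi] is 11 * 2^(l - e) <= 11 * load / 2^e, as 2^l is at most the
    load. *)
Lemma address_le x : x \in domf X ->
  2 ^ e * (address theta w us x + cls e X x) <= (2 ^ e + 11) * load e X.
Proof.
move=> xX; have [ax|xa] := leqP (2 ^ a) (cls e X x).
  apply: leq_mul; first exact: leq_addr.
  apply: leq_trans (core_interval xX ax) _; exact: core_mass.
have a0 := tiny_level xX xa; have [H1 H2] := lam_bounds.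
have [V1 _] := block_pos_ok a0; have [_ Vhi] := V1 _ (tiny_key_in xX xa).
have [_ T2] := tiny_interval xX xa.
have H3 := leq_trans (leq_trans T2 Vhi) (cap_hi theta us a0).
apply: leq_trans (leq_mul (leqnn _) H3) _; rewrite mulnDr mulnDl leq_add2l mulnCA leq_mul2l /=.
have L0 : 0 < load e X.
  have [_ c0] := class_gt0 xX; apply: leq_trans c0 _; rewrite /load (big_rem x) //= leq_addr //.
rewrite -expnD subnKC; last by move: a0; rewrite /a /lvl -/(lam theta us) -/l; clear; lia.
by have /andP[] := phase_bounds theta L0.
Qed.

(** The window starts past the core. Tiny objects that overlap share a block, hence a class, and
    then their slots differ modulo [per_block]. *)
Lemma address_disjoint x y : x \in domf X -> y \in domf X -> x != y ->
  (address theta w us x + cls e X x <= address theta w us y) ||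
  (address theta w us y + cls e X y <= address theta w us x).
Proof.
wlog sym : x y / (2 ^ a <= cls e X x) || (cls e X y < 2 ^ a).
  move=> H xX yX xy; case: (boolP ((2 ^ a <= cls e X x) || (cls e X y < 2 ^ a))) => [Hx|]; first exact: H.
  rewrite negb_or -ltnNge -leqNgt => /andP[xa ya]; rewrite orbC; apply: H => //; last by rewrite eq_sym.
  by rewrite ya.
move=> xX yX xy; have [ax|xa] := leqP (2 ^ a) (cls e X x).
  have [ay|ya] := leqP (2 ^ a) (cls e X y).
    rewrite /address -/X -/a ax ay.
    have I := layout_inv kapP theta legal_us; have p := inv_perm I.
    apply: (@lpos_disjoint _ (x, cls e X x) (y, cls e X y)) => //.
    - by rewrite (perm_uniq (perm_map _ p)) core_names_uniq.
    - by rewrite (perm_mem p); apply: map_f; rewrite mem_filter ax.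
    - by rewrite (perm_mem p); apply: map_f; rewrite mem_filter ay.
  apply/orP; left; apply: leq_trans (core_interval xX ax) _.
  have a0 := tiny_level yX ya; have [V1 _] := block_pos_ok a0.
  have [Vlo _] := V1 _ (tiny_key_in yX ya); have [T1 _] := tiny_interval yX ya.
  have [H1 H2] := lam_bounds; have /andP[Hlo _] := cap_lo theta us a0.
  exact: leq_trans Hlo (leq_trans Vlo T1).
have ya : cls e X y < 2 ^ a by move: sym; rewrite leqNgt xa.
have a0 := tiny_level xX xa; have [_ H2] := lam_bounds; have [H1 _] := lam_bounds.
have [_ V2] := block_pos_ok a0.
have [X1 X2] := tiny_interval xX xa; have [Y1 Y2] := tiny_interval yX ya.
set kx := tiny_key _ _ _ _ _ x in X1 X2; set ky := tiny_key _ _ _ _ _ y in Y1 Y2.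
apply: contraT; rewrite negb_or -!ltnNge => /andP[c1 c2].
pose z := maxn (address theta w us x) (address theta w us y).
have [_ cx] := class_gt0 xX; have [_ cy] := class_gt0 yX.
have zx : address theta w us x <= z < address theta w us x + cls e X x.
  by rewrite leq_maxl gtn_max c1 andbT -{1}[address _ _ _ x]addn0 ltn_add2l.
have zy : address theta w us y <= z < address theta w us y + cls e X y.
  by rewrite leq_maxr gtn_max c2 /= -{1}[address _ _ _ y]addn0 ltn_add2l.
have kk : kx = ky.
  apply: (V2 kx ky z); [exact: tiny_key_in|exact: tiny_key_in| |].
    by case/andP: zx => z1 z2; rewrite (leq_trans X1 z1) (leq_trans z2 X2).
  by case/andP: zy => z1 z2; rewrite (leq_trans Y1 z1) (leq_trans z2 Y2).
have tlt v y' : y' \in roster e us v -> tiny_slot e theta (roster e us) v y' %/ per_block e v < D'.+1.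
  by move=> yr; apply: leq_trans (tiny_slot_lt e theta yr) _; apply: cap_nblocks legal_us H1 H2 _.
have [vE tE] := bkey_inj (cap_aQ a0 H2) xa ya (tlt _ _ (in_roster xX)) (tlt _ _ (in_roster yX)) kk.
have addrE t : cls e X t < 2 ^ a -> address theta w us t =
    block_pos theta w us (tiny_key e D' theta (roster e us) (cls e X t) t) +
    tiny_offset e theta (roster e us) (cls e X t) t.
  by move=> ta; rewrite /address -/X -/a (leqNgt (2 ^ a)) ta.
move: c1 c2; rewrite (addrE x) // (addrE y) // -/kx -/ky -kk -vE /tiny_offset; clear addrE zx zy X1 X2 Y1 Y2.
have yr := in_roster yX; rewrite -/X -vE in yr tE.
set v := cls e X x in yr tE cx *; set sx := tiny_slot _ _ _ _ x in tE *; set sy := tiny_slot _ _ _ _ y in tE *.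
have ne : sx %% per_block e v <> sy %% per_block e v.
  move=> E; move/negP: xy; apply; apply/eqP; apply: (@tiny_slot_inj e theta (roster e us) v) => //.
    exact: in_roster.
  by rewrite -/sx -/sy (divn_eq sx (per_block e v)) tE E -divn_eq.
move: (_ %% _) (sy %% _) ne => i j ne c1 c2.
have [ij|ji|//] := ltngtP i j.
  have : i.+1 * v <= j * v by rewrite leq_mul2r ij orbT.
  by rewrite mulSn => H; move: c1; rewrite -addnA ltn_add2l ltnNge addnC H.
have : j.+1 * v <= i * v by rewrite leq_mul2r ji orbT.
by rewrite mulSn => H; move: c2; rewrite -addnA ltn_add2l ltnNge addnC H.
Qed.

End Valid.
End Allocator.

(** * Expected volume of the moved objects *)

(** A tiny update pays for the object with a new slot, a page at the right end of the window and a
    new block. A core update shifts the window, so both ends move, hence the factor 2. [e + 5]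
    bounds the logarithm of the ratio of free spaces. *)
Definition tiny_bound e a core1 tiny1 n v theta :=
  if v < 2 ^ a then
    v + (e + 5) * (crossings (page e a) tiny1 v theta * page e a +
                   crossings (per_block e v) n 1 theta * block_size e v)
  else (e + 5) * (2 * crossings (page e a) core1 v theta * page e a).

Section Pair.
Variables (R : realFieldType) (Lg : R -> R).
Hypothesis Lg_ge : forall x y : R, (0 < y -> y <= x -> (x - y) / x <= Lg x - Lg y)%R.
Variables e kap Q : nat.
Hypothesis Lg_le : forall (G : nat) (x y : R), (0 < G)%N ->
  (G%:R <= y -> y <= x -> x <= (2 ^ (e + 5) * G)%:R -> Lg x - Lg y <= (e + 5)%:R)%R.
Hypothesis e6 : 6 <= e.
Notation D' := (2 ^ Q).-1.
Notation K := ('I_D'.+1 * 'I_D'.+1)%type.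
Notation W := {ffun K -> 'S_D'.+1}.
Variables (theta l x : nat) (us1 us2 : seq update).
Let X1 := live_after us1.
Let X2 := live_after us2.
Let a := l - 4 * e.
Let v := cls e X2 x.
Let b := page e a.
Let G := 2 ^ (l - e).
Hypothesis leg1 : legal_from [fmap]%fmap us1.
Hypothesis leg2 : legal_from [fmap]%fmap us2.
Hypothesis ext : roster_extends e X1 (roster e us1) x X2 (roster e us2).
Hypothesis lam1 : lam e theta us1 = l.
Hypothesis lam2 : lam e theta us2 = l.
Hypothesis load2 : load e X2 < 2 ^ (l + 2).
Hypothesis lQ : l + 4 <= Q.

Let lvl1 : lvl e theta us1 = a. Proof. by rewrite /lvl -/(lam e theta us1) lam1. Qed.
Let lvl2 : lvl e theta us2 = a. Proof. by rewrite /lvl -/(lam e theta us2) lam2. Qed.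

Let load_ext : load e X2 = v + load e X1. Proof. exact: extends_load (rext ext). Qed.

Let load1 : load e X1 < 2 ^ (l + 2).
Proof. by apply: leq_ltn_trans load2; rewrite load_ext leq_addl. Qed.

Let core_ext : mass (core e X2 a) = mass (core e X1 a) + (if 2 ^ a <= v then v else 0).
Proof.
rewrite (perm_mass (@extends_core e _ _ _ a (rext ext))) -/v; case: ifP; rewrite ?addn0 //.
by rewrite mass_cons addnC.
Qed.

Let tiny_ext : tiny_load e X2 a = tiny_load e X1 a + (if v < 2 ^ a then v else 0).
Proof.
have := load_ext; rewrite (load_split e X1 a) (load_split e X2 a) core_ext (ltnNge v); clear.
by case: (2 ^ a <= v); rewrite /=; lia.
Qed.

Let lo_le : page_lo e theta us1 a <= page_lo e theta us2 a.
Proof. by rewrite ltnS; apply: leq_div2r; rewrite leq_add2r core_ext leq_addr. Qed.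

Let cnt_le : page_cnt e theta us1 l a <= page_cnt e theta us2 l a.
Proof. by apply: leq_div2r; rewrite !leq_add2r tiny_ext leq_addr. Qed.

Let pages_diff :
  page_lo e theta us2 a - page_lo e theta us1 a + (page_hi e theta us2 l a - page_hi e theta us1 l a) =
  if v < 2 ^ a then crossings b (tiny_load e X1 a + reserve e l) v theta
  else 2 * crossings b (mass (core e X1 a)) v theta.
Proof.
have lo : page_lo e theta us2 a - page_lo e theta us1 a =
    crossings b (mass (core e X1 a)) (if 2 ^ a <= v then v else 0) theta.
  by rewrite -crossings_mod /page_lo subSS core_ext.
have cnt : page_cnt e theta us2 l a - page_cnt e theta us1 l a =
    crossings b (tiny_load e X1 a + reserve e l) (if v < 2 ^ a then v else 0) theta.
  by rewrite -crossings_mod /page_cnt -/X1 -/X2 tiny_ext (addnAC (tiny_load e X1 a)).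
have z y : crossings b y 0 theta = 0 by rewrite /crossings addn0 subnn.
rewrite /page_hi; move: lo cnt lo_le cnt_le; rewrite (leqNgt (2 ^ a)).
by case: (v < 2 ^ a); rewrite /= z; move: (crossings _ _ _ _); clear; lia.
Qed.

(** Only the permutations are averaged, [theta] being fixed. At least [G] positions stay free and at
    most 2^(e + 5) * [G] ever are, so the harmonic sum is at most e + 5. *)
Lemma tiny_sum :
  \sum_(w : W) \sum_(y <- domf X1 | (cls e X1 y < 2 ^ a) &&
     (address e kap theta w us1 y != address e kap theta w us2 y)) cls e X1 y <=
  #|{: W}| * tiny_bound e a (mass (core e X1 a)) (tiny_load e X1 a + reserve e l)
    (counts (roster e us1) v) v theta.
Proof.
have [a0|a0] := posnP a.
  rewrite big1 // => w _; rewrite big_seq_cond big_pred0 // => y.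
  apply/negbTE/negP => /andP[yX /andP[]]; rewrite a0 expn0 ltnS leqNgt.
  by rewrite rup_gt0 // (live_positive leg1).
have aD := cap_aQ a0 lQ; have bD := cap_page_dvd e6 a0 lQ.
have pX := live_positive leg1; have ok1 := roster_live e leg1.
have nB1 v' : v' < 2 ^ a -> nblocks e (counts (roster e us1)) theta v' <= D'.+1.
  by move=> _; apply: cap_nblocks leg1 load1 lQ _.
have nB2 v' : v' < 2 ^ a -> nblocks e (counts (roster e us2)) theta v' <= D'.+1.
  by move=> _; apply: cap_nblocks leg2 load2 lQ _.
set ys := blocks e D' (counts (roster e us1)) theta a.
set ys' := blocks e D' (counts (roster e us2)) theta a.
set O := region D' b (page_lo e theta us1 a) (page_hi e theta us1 l a).
set O' := region D' b (page_lo e theta us2 a) (page_hi e theta us2 l a).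
pose bs := bsize e (B' := D').
pose c := if v < 2 ^ a then crossings (per_block e v) (counts (roster e us1) v) 1 theta * block_size e v else 0.
have pw (w : W) : \sum_(y <- domf X1 | (cls e X1 y < 2 ^ a) &&
     (address e kap theta w us1 y != address e kap theta w us2 y)) cls e X1 y <=
   (if v < 2 ^ a then v else 0) + \sum_(k <- ys) bs k * (pos bs w O ys k != pos bs w O' ys' k).
  apply: leq_trans _ (tiny_moved_le aD (pos bs w O ys) (pos bs w O' ys') pX ok1 ext nB1).
  apply: leq_sum_cond => y yX /andP[ya]; rewrite ya leqnn andbT /=.
  rewrite /address lvl1 lvl2 -/X1 -/X2 (extends_cls e (rext ext) yX) (leqNgt (2 ^ a)) ya /=.
  by rewrite /block_pos /tiny_region /tiny_blocks lvl1 lvl2 lam1 lam2.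
have rv : rounded e v by rewrite rup_rounded // (ext_gt0 (rext ext)).
have ins : (ys' = ys /\ c = 0%N) \/ (exists ll r k, [/\ ys = ll ++ r, ys' = ll ++ k :: r & c = bs k]).
  rewrite /c; have same v' : v' != v -> counts (roster e us2) v' = counts (roster e us1) v'.
    by move=> ne; rewrite /counts (rext_same ext ne).
  have [va|av] := ltnP v (2 ^ a); last first.
    left; split=> //; rewrite /ys' /ys /blocks; congr flatten.
    apply/eq_in_map => v'; rewrite mem_tiny_classes => /andP[_ v'a].
    rewrite /class_blocks /nblocks same //; apply: contraTneq v'a => ->; by rewrite -leqNgt.
  have [[-> E]|[-> [ll [r [t [E1 E2]]]]]] := blocks_insert D' theta same (rext_size ext) rv va.
    by left.
  right; exists ll, r, (bkey D' v t); split=> //.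
  by rewrite mul1n /bs (bsize_bkey e aD).
have u' : uniq ys' by apply: blocks_uniq.
have d' : decreasing D' bs ys' by apply: blocks_decreasing.
have al lo hi : aligned_all bs ys' (region D' b lo hi).
  move=> k /mem_blocks[v' [t [rv' va' _ ->]]]; rewrite /bs (bsize_bkey e aD) //.
  by apply: region_aligned; [exact: block_size_gt0 | exact: block_size_tiny].
have G0 : 0 < G by rewrite expn_gt0.
have tl2 : tiny_load e X2 a <= tiny_load e X1 a + G.
  rewrite tiny_ext leq_add2l; case: ifP => // va; apply: ltnW; apply: leq_trans va _.
  apply: leq_trans (cap_page e6 a0); rewrite leq_exp2l // -addnA; exact: leq_addr.
have tot := cap_total e6 theta leg2 a0 load2 lQ.
have cnt1 := cap_cnt e6 theta us1 a0; have cnt2 := cap_cnt e6 theta us2 a0.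
have OE : #|O| = D'.+1 - page_cnt e theta us1 l a * b := cap_region e6 theta a0 load1 lQ.
have O'E : #|O'| = D'.+1 - page_cnt e theta us2 l a * b := cap_region e6 theta a0 load2 lQ.
have cD1 : page_cnt e theta us1 l a * b <= D'.+1 := cap_cntD e6 theta a0 load1 lQ.
have cD2 : page_cnt e theta us2 l a * b <= D'.+1 := cap_cntD e6 theta a0 load2 lQ.
have cap t1 t2 T P : t2 <= t1 + G -> t1 + 7 * G <= P -> T <= t2 + 2 * G -> P <= D'.+1 ->
    D'.+1 - P + T + G <= D'.+1 by clear; lia.
(* The longer list is measured against the smaller window, which costs one more [G]; the 7 gaps of
   [cap_cnt] suffice. *)
have le1 : #|O| + total bs ys' + G <= D'.+1.
  by rewrite OE; case/andP: cnt1 => H1 _; apply: cap tl2 H1 tot cD1.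
have le2 : #|O'| + total bs ys' + G <= D'.+1.
  by rewrite O'E; case/andP: cnt2 => H1 _; apply: cap (leq_addr _ _) H1 tot cD2.
have lF : (D'.+1%:R - #|O :&: O'|%:R <= (2 ^ (e + 5) * G)%:R :> R)%R.
  rewrite lerBlDr -natrD ler_nat.
  have aux I U P1 P2 t1 t2 A : U <= D'.+1 -> U + I = D'.+1 - P1 + (D'.+1 - P2) -> P1 <= D'.+1 -> P2 <= D'.+1 ->
      P1 <= t1 + 9 * G -> P2 <= t2 + 9 * G -> t1 <= A * G -> t2 <= A * G -> 2 ^ 6 * G <= A * G ->
      D'.+1 <= 8 * (A * G) + I by clear; lia.
  have -> : 2 ^ (e + 5) * G = 8 * (2 ^ (e + 2) * G) by rewrite (_ : e + 5 = e + 2 + 3) -?addnA // (addnA e 2 3) expnD mulnAC mulnC.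
  have gap : 2 ^ (l + 2) = 2 ^ (e + 2) * G := cap_gap a0.
  have /andP[_ P1] := cnt1; have /andP[_ P2] := cnt2.
  have t1 : tiny_load e X1 a <= 2 ^ (e + 2) * G by rewrite -gap; apply: ltnW (cap_tiny_lt load1).
  have t2 : tiny_load e X2 a <= 2 ^ (e + 2) * G by rewrite -gap; apply: ltnW (cap_tiny_lt load2).
  apply: (aux _ #|O :|: O'| _ _ _ _ _ _ _ cD1 cD2 P1 P2 t1 t2).
  - by rewrite -[X in _ <= X]card_ord max_card.
  - by rewrite cardsUI OE O'E.
  - by rewrite leq_mul2r leq_exp2l // orbC (leq_add2r 2 4) (leq_trans _ e6).
have step := hash_step Lg_ge (fun p q => @Lg_le G p q G0) G0 ins u' d' (al _ _) (al _ _) le1 le2 lF.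
have hi_le : page_hi e theta us1 l a <= page_hi e theta us2 l a by rewrite leq_add.
have diff := card_regionD D' b lo_le hi_le; rewrite pages_diff -/O -/O' in diff.
apply: (@leq_trans (#|{: W}| * ((if v < 2 ^ a then v else 0) + (e + 5) *
    (#|O| - #|O :&: O'| + (#|O'| - #|O :&: O'|) + c)))).
  rewrite mulnDr mulnA -sum_nat_const; apply: leq_trans (leq_sum _ (fun w _ => pw w)) _.
  rewrite big_split leq_add2l -(@ler_nat R) natr_sum; apply: le_trans step _.
  by rewrite !natrM.
rewrite leq_mul2l; apply/orP; right; rewrite /tiny_bound /c -/b; move: diff.
case: (v < 2 ^ a) => diff; rewrite ?leq_add2l ?add0n leq_mul2l; apply/orP; right; last by rewrite addn0.
by rewrite leq_add2r.
Qed.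

End Pair.

Definition step_bound e kap l core1 tiny1 n start v theta :=
  core_cost e kap (l - 4 * e) start v theta + tiny_bound e (l - 4 * e) core1 tiny1 n v theta.

Section SumBounds.
Variables e kap Q : nat.
(* A common multiple of all the periods in use. *)
Let Theta := (2 ^ Q)`!.
Let F := cost_const kap (levels e).

Lemma sum_crossings_le T x s : 0 < T -> T <= 2 ^ Q ->
  \sum_(theta < Theta) crossings T x s theta * T = Theta * s.
Proof. by move=> T0 TQ; rewrite -big_distrl /= sum_crossings // dvdn_fact ?T0. Qed.

(** A crossing at a level of period T costs 2 F T and there are v / T of them on average: every
    level costs 2 F v, whatever its period. *)
Lemma sum_core_cost a start v : a + levels e <= Q ->
  \sum_(theta < Theta) core_cost e kap a start v theta <= Theta * (2 * F * (levels e).+1 * v).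
Proof.
move=> aQ; rewrite /core_cost; case: (2 ^ a <= v); last by rewrite big1.
rewrite exchange_big /=; apply: (@leq_trans (\sum_(l < (levels e).+1) 2 * F * (Theta * v))); last first.
  by rewrite sum_nat_const card_ord; apply: eq_leq; move: Theta (2 * F) (levels e).+1; clear; lia.
apply: leq_sum => l _; rewrite -(@sum_crossings_le (period a (levels e) l) start v) ?expn_gt0 //.
  rewrite big_distrr; apply: leq_sum => theta _ /=; rewrite -/F; apply: eq_leq.
  by rewrite -!mulnA; congr (_ * (_ * _)); rewrite mulnC.
by rewrite leq_exp2l // (leq_trans _ aQ) // leq_add2l leq_subr.
Qed.

(** The page term averages to v and the block term to at most 2 v, a block being at most twice as
    long as the objects that fill it. *)
Lemma sum_tiny_bound a core1 tiny1 n v : 0 < v -> a + e + 3 <= Q ->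
  \sum_(theta < Theta) tiny_bound e a core1 tiny1 n v theta <= Theta * ((1 + 3 * (e + 5)) * v).
Proof.
move=> v0 aQ; rewrite /tiny_bound; have bQ : page e a <= 2 ^ Q by rewrite leq_exp2l.
have b0 : 0 < page e a by rewrite expn_gt0.
have [va|av] := ltnP v (2 ^ a).
  have q0 := per_block_gt0 e v0.
  have qQ : per_block e v <= 2 ^ Q.
    apply: leq_trans bQ; apply: (@leq_trans (block_size e v)); first exact: leq_div.
    by apply: dvdn_leq; [rewrite expn_gt0 | apply: block_size_tiny].
  rewrite big_split /= sum_nat_const card_ord mulnDl mul1n mulnDr leq_add2l.
  rewrite -big_distrr /= big_split /= sum_crossings_le //.
  rewrite [X in _ <= X](_ : _ = (e + 5) * (Theta * v + Theta * (2 * v))); last first.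
    by move: Theta; clear; lia.
  rewrite leq_mul2l leq_add2l; apply/orP; right.
  apply: (@leq_trans (\sum_(theta < Theta) crossings (per_block e v) n 1 theta * per_block e v * (2 * v))).
    by apply: leq_sum => theta _; rewrite -mulnA leq_mul2l block_size_le2 ?orbT.
  by rewrite -big_distrl /= sum_crossings_le // muln1.
rewrite -big_distrr /=; under eq_bigr do rewrite -mulnA.
rewrite -big_distrr /= sum_crossings_le // (mulnDl 1) (mulnDr Theta); apply: leq_trans (leq_addl _ _).
have -> : (e + 5) * (2 * (Theta * v)) = Theta * (2 * (e + 5) * v).
  by move: Theta; clear; lia.
by rewrite leq_mul2l leq_mul2r leq_mul2r !orbT.
Qed.

Lemma sum_step_bound l core1 tiny1 n start v : 0 < v -> 4 * e + 2 <= Q -> l + 4 <= Q ->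
  \sum_(theta < Theta) step_bound e kap l core1 tiny1 n start v theta <=
  Theta * ((1 + 2 * F * (levels e).+1 + 3 * (e + 5)) * v).
Proof.
move=> v0 eQ lQ; rewrite big_split /=.
have aux : l - 4 * e + levels e <= Q /\ (l - 4 * e + e + 3 <= Q).
  by rewrite /levels; move: eQ lQ; clear; lia.
rewrite [1 + _]addnC -addnA mulnDl mulnDr; apply: leq_add; first by apply: sum_core_cost; case: aux.
by apply: sum_tiny_bound => //; case: aux.
Qed.

End SumBounds.

(** * Expected change caused by one update *)

Section Step.
Variables (R : realFieldType) (Lg : R -> R).
Hypothesis Lg_ge : forall x y : R, (0 < y -> y <= x -> (x - y) / x <= Lg x - Lg y)%R.
Variables e kap Q : nat.
Hypothesis Lg_le : forall (G : nat) (x y : R), (0 < G)%N ->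
  (G%:R <= y -> y <= x -> x <= (2 ^ (e + 5) * G)%:R -> Lg x - Lg y <= (e + 5)%:R)%R.
Hypothesis e6 : 6 <= e.
Hypothesis kapP : e < 2 ^ kap.
Notation D' := (2 ^ Q).-1.
Notation K := ('I_D'.+1 * 'I_D'.+1)%type.
Notation W := {ffun K -> 'S_D'.+1}.
Let Theta := (2 ^ Q)`!.
Let F := cost_const kap (levels e).
Definition step_const := 5 + 4 * F * (levels e).+1 + 6 * (e + 5).

Variables (us us1 us2 : seq update) (u : update) (x : nat).
Let X1 := live_after us1.
Let X2 := live_after us2.
Hypothesis legal_u : legal_from [fmap]%fmap (rcons us u).
Hypothesis pair : (us1 = us /\ us2 = rcons us u) \/ (us1 = rcons us u /\ us2 = us).
Hypothesis ext : roster_extends e X1 (roster e us1) x X2 (roster e us2).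
Hypothesis size_u : update_size (live_after us) u = mu X2 x.
Hypothesis eQ : 4 * e + 5 <= Q.
Hypothesis load2 : load e X2 < 2 ^ (Q - 5).
Let v := cls e X2 x.
Let L := load e X1.

Let leg : legal_from [fmap]%fmap us.
Proof. by move: legal_u; rewrite legal_from_rcons => /andP[]. Qed.

Let leg1 : legal_from [fmap]%fmap us1. Proof. by case: pair => -[->]. Qed.
Let leg2 : legal_from [fmap]%fmap us2. Proof. by case: pair => -[_ ->]. Qed.
Let load_ext : load e X2 = v + L. Proof. exact: extends_load (rext ext). Qed.
Let v0 : 0 < v. Proof. by rewrite rup_gt0 // (ext_gt0 (rext ext)). Qed.

(** [X1] is the smaller of the two sets, so it contains exactly the objects live both before and
    after the update. *)
Definition change theta (w : W) := \sum_(y <- domf X1 |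
  address e kap theta w us1 y != address e kap theta w us2 y) cls e X1 y.

Lemma change_le_load theta w : change theta w <= L.
Proof. by rewrite /change big_mkcond; apply: leq_sum => y _; case: ifP. Qed.

Lemma core_change theta (w : W) a : lvl e theta us1 = a -> lvl e theta us2 = a ->
  \sum_(y <- domf X1 | (2 ^ a <= cls e X1 y) &&
     (address e kap theta w us1 y != address e kap theta w us2 y)) cls e X1 y <=
  core_cost e kap a (wsum e a (rev us)) v theta.
Proof.
move=> lv1 lv2; have lvu : lvl e theta us = a by case: pair => -[E1 E2]; [rewrite -lv1 E1 | rewrite -lv2 E2].
have lvu' : lvl e theta (rcons us u) = a by case: pair => -[E1 E2]; [rewrite -lv2 E2 | rewrite -lv1 E1].
have := layout_cost kapP legal_u (etrans lvu (esym lvu')).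
rewrite lvu /update_class size_u; apply: leq_trans.
have E := rext ext.
rewrite /core_moved /core big_map big_filter_cond /=.
apply: (@leq_trans (\sum_(y <- domf X1 | (2 ^ a <= cls e X1 y) &&
  (lpos (flat (layout_after e kap theta us1)) y != lpos (flat (layout_after e kap theta us2)) y)) cls e X1 y)).
  apply: leq_sum_cond => y yX /andP[ay]; rewrite ay leqnn andbT /= /address -/X1 -/X2 lv1 lv2.
  by rewrite (extends_cls e E yX) ay.
have mem2 y : y \in domf X1 -> y \in domf X2 by rewrite (perm_mem (ext_perm E)) inE orbC => ->.
move: mem2; rewrite /X1 /X2; case: pair => -[E1 E2]; rewrite E1 E2 => mem2.
  by apply: leq_sum_cond => y yX /andP[-> ->]; rewrite (mem2 y yX) /=.
have p := ext_perm E; rewrite /X1 /X2 E1 E2 in p.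
rewrite (perm_big _ p) big_cons; set S := (X in _ <= X).
apply: (@leq_trans (\sum_(j <- domf (live_after (rcons us u)) | (2 ^ a <= cls e (live_after us) j) &&
   ((j \in domf (live_after (rcons us u))) &&
    (lpos (flat (layout_after e kap theta us)) j != lpos (flat (layout_after e kap theta (rcons us u))) j)))
   cls e (live_after us) j)); last by rewrite /S; case: ifP => _; rewrite ?leq_addl.
apply: leq_sum_cond => y yX /andP[ay]; rewrite yX /= eq_sym => ->.
have yE : cls e (live_after us) y = cls e (live_after (rcons us u)) y.
  by have := extends_cls e E; rewrite /X1 /X2 E1 E2; apply.
by rewrite yE ay leqnn.
Qed.

Let bound l theta := step_bound e kap l (mass (core e X1 (l - 4 * e)))
  (tiny_load e X1 (l - 4 * e) + reserve e l) (counts (roster e us1) v)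
  (wsum e (l - 4 * e) (rev us)) v theta.

Lemma change_same_phase theta l : lam e theta us1 = l -> lam e theta us2 = l ->
  \sum_(w : W) change theta w <= #|{: W}| * bound l theta.
Proof.
move=> lam1 lam2; have lv1 : lvl e theta us1 = l - 4 * e by rewrite /lvl -lam1.
have lv2 : lvl e theta us2 = l - 4 * e by rewrite /lvl -lam2.
have Q5 : 5 <= Q by apply: leq_trans eQ; apply: leq_addl.
have [] := lam_bounds theta Q5 load2; rewrite lam2 => loadl lQ.
apply: (@leq_trans (\sum_(w : W) (core_cost e kap (l - 4 * e) (wsum e (l - 4 * e) (rev us)) v theta +
   \sum_(y <- domf X1 | (cls e X1 y < 2 ^ (l - 4 * e)) &&
     (address e kap theta w us1 y != address e kap theta w us2 y)) cls e X1 y))).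
  apply: leq_sum => w _; apply: leq_trans (leq_add (core_change w lv1 lv2) (leqnn _)).
  rewrite /change (bigID (fun y => 2 ^ (l - 4 * e) <= cls e X1 y)) /=; apply: leq_add; apply: eq_leq.
    by apply: eq_bigl => y; rewrite andbC.
  by apply: eq_bigl => y; rewrite andbC -ltnNge.
rewrite big_split /= sum_nat_const /bound /step_bound mulnDr leq_add2l.
exact: (tiny_sum Lg_ge kap Lg_le e6 leg1 leg2 ext lam1 lam2 loadl lQ).
Qed.

Let l0 := trunc_log 2 L.

(** A change of phase may move the whole load [L], but forces a crossing. Otherwise the phase is one
    of two values fixed by [L]; the bounds for both are added, because conditioning on the phase
    would bias [theta]. *)
Lemma change_sum theta : v < L ->
  \sum_(w : W) change theta w <= #|{: W}| * (L * (crossings (2 ^ l0) L v theta +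
    crossings (2 ^ l0.+1) L v theta) + (bound l0 theta + bound l0.-1 theta)).
Proof.
move=> vL; have [E|ne] := eqVneq (lam e theta us1) (lam e theta us2); last first.
  apply: (@leq_trans (\sum_(w : W) L)); first by apply: leq_sum => w _; apply: change_le_load.
  rewrite sum_nat_const leq_mul2l; apply/orP; right; apply: leq_trans (leq_addr _ _).
  rewrite leq_pmulr //; apply: phase_change => //; move: ne; rewrite /lam load_ext addnC //.
apply: leq_trans (change_same_phase E (erefl _)) _; rewrite leq_mul2l; apply/orP; right.
apply: leq_trans (leq_addl _ _); rewrite -E.
have [] := phase_near L theta; rewrite -/(lam e theta us1) -/l0 => ->; first exact: leq_addr.
exact: leq_addl.
Qed.

(** If [v >= L], the update pays for moving everything. Otherwise changes of phase cost at most 3 v: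
    L < 2^(l0 + 1), and the crossings of 2^l0 and 2^(l0 + 1) contribute 2 v and v. *)
Lemma expected_change :
  \sum_(theta < Theta) \sum_(w : W) change theta w <= Theta * #|{: W}| * (step_const * v).
Proof.
have [Lv|vL] := leqP L v.
  apply: (@leq_trans (\sum_(theta < Theta) \sum_(w : W) v)).
    by do 2!apply: leq_sum => ? _; apply: leq_trans (change_le_load _ _) Lv.
  rewrite !sum_nat_const card_ord mulnA leq_mul2l leq_pmull ?orbT //.
apply: leq_trans (leq_sum _ (fun (theta : 'I_Theta) _ => @change_sum theta vL)) _.
have L0 : 0 < L by apply: leq_ltn_trans vL.
have /andP[lo hi] := trunc_log_bounds (isT : 1 < 2) L0.
have l0Q : l0 < Q - 5.
  rewrite -(@ltn_exp2l 2) //; apply: leq_ltn_trans lo _; apply: leq_ltn_trans load2.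
  by rewrite load_ext leq_addl.
have [Q1 [Q2 [Q3 Q4]]] : l0.+1 <= Q /\ l0 + 4 <= Q /\ l0.-1 + 4 <= Q /\ 4 * e + 2 <= Q.
  by move: l0Q eQ; clear; lia.
rewrite -big_distrr /= [Theta * _]mulnC -mulnA leq_mul2l; apply/orP; right.
rewrite big_split /= big_split /=.
pose c := 1 + 2 * F * (levels e).+1 + 3 * (e + 5).
have B1 : \sum_(theta < Theta) bound l0 theta <= Theta * (c * v) by apply: sum_step_bound.
have B2 : \sum_(theta < Theta) bound l0.-1 theta <= Theta * (c * v) by apply: sum_step_bound.
have B3 : \sum_(theta < Theta) L * (crossings (2 ^ l0) L v theta + crossings (2 ^ l0.+1) L v theta) <= Theta * (3 * v).
  apply: (@leq_trans (\sum_(theta < Theta) (crossings (2 ^ l0) L v theta * 2 ^ l0 * 2 +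
     crossings (2 ^ l0.+1) L v theta * 2 ^ l0.+1))).
    apply: leq_sum => theta _; rewrite mulnC -mulnA -expnSr -mulnDl leq_mul2l (ltnW hi) orbT //.
  rewrite big_split /= -big_distrl /= !sum_crossings_le ?expn_gt0 // ?leq_exp2l //; last exact: ltnW.
  by rewrite -mulnA -mulnDr [v * 2]mulnC -mulSnr.
apply: leq_trans (leq_add B3 (leq_add B1 B2)) _.
have -> : step_const = 3 + (c + c).
  rewrite /step_const /c; move: F (levels e).+1 => f m; rewrite -!mulnA; move: (f * m); clear; lia.
by clear; move: Theta c v => T k m; rewrite !mulnDl !mulnDr.
Qed.

End Step.
From HB Require Import structures.
From mathcomp Require Import all_classical all_reals all_analysis.
From mathcomp Require Import lra.
Local Open Scope ring_scope.

(** * Probabilities and constants *)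

Section UniformOutcome.
Variables (R : realType) (N : nat).

Lemma uniform_weight_ge0 : 0 <= N.+1%:R^-1 :> R. Proof. by rewrite invr_ge0. Qed.

(** The finitely many outcomes are coded by the first natural numbers. All sets of natural numbers
    are measurable, so every allocation is a measurable function of the outcome. *)
Definition uniform_outcome : set nat -> \bar R :=
  mscale (NngNum uniform_weight_ge0) (msum (fun k => \d_k) N.+1).

HB.instance Definition _ := Measure.on uniform_outcome.

Lemma uniform_outcome_setT : uniform_outcome setT = 1%E.
Proof.
rewrite /uniform_outcome /mscale /= /msum (eq_bigr (fun=> 1%E)); last by move=> k _; exact: diracT.
by rewrite sumEFin sumr_const card_ord -EFinM mulVf // pnatr_eq0.
Qed.

HB.instance Definition _ :=
  Measure_isProbability.Build _ _ _ uniform_outcome uniform_outcome_setT.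

Lemma expectation_uniform (f : nat -> R) : (forall k, 0 <= f k) ->
  expectation uniform_outcome f = ((\sum_(k < N.+1) f k) / N.+1%:R)%:E.
Proof.
move=> f0; rewrite unlock /uniform_outcome ge0_integral_mscale //=; last by move=> k _; rewrite lee_fin.
rewrite ge0_integral_measure_sum //=; last by move=> k _; rewrite lee_fin.
rewrite (eq_bigr (fun k : 'I_N.+1 => (f k)%:E)); last first.
  by move=> k _; rewrite integral_dirac // diracT mul1e.
by rewrite sumEFin -EFinM mulrC.
Qed.

End UniformOutcome.

(** * Logarithms *)

Section Logarithms.
Variable R : realType.
Implicit Types x y : R.

(** This is ln t <= t - 1 at t = y / x. *)
Lemma ln_drop x y : 0 < y -> y <= x -> (x - y) / x <= ln x - ln y.
Proof.
move=> y0 yx; have x0 := lt_le_trans y0 yx.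
have := @le_ln1Dx R (y / x - 1); rewrite addrCA subrr addr0 ltrBrDl subrr divr_gt0 // => /(_ isT).
rewrite ln_div ?posrE // mulrBl divff ?gt_eqF //; lra.
Qed.

Lemma ln2_le1 : ln 2 <= 1 :> R.
Proof. by have := @le_ln1Dx R 1; apply; lra. Qed.

Lemma ln2_gt0 : 0 < ln 2 :> R. Proof. by rewrite ln_gt0 // ltr1n. Qed.

Lemma ln_ratio (h G : nat) x y : (0 < G)%N -> G%:R <= y -> y <= x -> x <= (2 ^ h * G)%:R ->
  ln x - ln y <= h%:R.
Proof.
move=> G0 Gy yx xG; have Gp : 0 < G%:R :> R by rewrite ltr0n.
have y0 := lt_le_trans Gp Gy; have x0 := lt_le_trans y0 yx.
have hy : ln x <= ln (2 ^+ h * y).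
  rewrite ler_ln ?posrE ?mulr_gt0 ?exprn_gt0 //.
  by apply: le_trans xG _; rewrite natrM natrX ler_wpM2l // exprn_ge0.
rewrite lnM ?posrE ?exprn_gt0 // lnXn // in hy.
have : ln 2 *+ h <= h%:R :> R by rewrite lerMn2r ln2_le1 orbT.
lra.
Qed.

Lemma log2X (n : nat) : log2 (2 ^+ n) = n%:R :> R.
Proof. by rewrite /log2 lnXn // mulrnAl divff // gt_eqF // ln2_gt0. Qed.

Lemma ler_log2 x y : 0 < x -> x <= y -> log2 x <= log2 y.
Proof.
move=> x0 xy; rewrite /log2 ler_pM2r ?invr_gt0 ?ln2_gt0 // ler_ln ?posrE //.
exact: lt_le_trans xy.
Qed.

Lemma log2M x y : 0 < x -> 0 < y -> log2 (x * y) = log2 x + log2 y.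
Proof. by move=> x0 y0; rewrite /log2 lnM ?posrE // mulrDl. Qed.

End Logarithms.

(** * Size of the constants *)

Lemma cost_const_le e kap : (6 <= e)%N ->
  (cost_const kap (levels e) <= 7 * 1000 * (e * e * spread_const kap))%N.
Proof.
move=> e6; rewrite /cost_const /key_bound /levels; have : (0 < spread_const kap)%N.
  by rewrite /spread_const !muln_gt0 !expn_gt0.
move: (spread_const kap) => r r0; set m := (4 * e + 2)%N.
have m5 : (m <= 5 * e)%N by rewrite /m; move: e6; clear; lia.
have H1 : (m * m * r <= 5 * e * (5 * e) * r)%N by rewrite leq_mul2r leq_mul ?orbT.
have H2 : (m * r <= 5 * e * r)%N by rewrite leq_mul2r m5 orbT.
have H3 : (e * r <= e * e * r)%N by rewrite leq_mul2r leq_pmulr ?orbT //; apply: leq_trans e6.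
have H4 : (0 < e * r)%N by rewrite muln_gt0 r0 andbT; apply: leq_trans e6.
by move: H1 H2 H3 H4; clear; move: m => m; lia.
Qed.

Lemma step_const_le e kap : (6 <= e)%N -> (2 ^ kap <= 2 * e)%N ->
  (step_const e kap <= 2 ^ 29 * (e ^ 4 * kap.+1 ^ 2))%N.
Proof.
move=> e6 ke; have e0 : (0 < e)%N by apply: leq_trans e6.
rewrite /step_const; have := cost_const_le kap e6.
have : (0 < spread_const kap)%N by rewrite /spread_const !muln_gt0 !expn_gt0.
have : (spread_const kap <= 2 ^ 11 * (e * kap.+1 ^ 2))%N.
  rewrite /spread_const mulnA leq_mul2r; apply/orP; right.
  by rewrite (expnS 2 10) [(2 * _)%N]mulnC -mulnA leq_mul2l ke orbT.
move: (spread_const kap) (cost_const kap _) => r f re r0 fe.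
have H1 : (f * (levels e).+1 <= 7 * 1000 * (e * e * r) * (5 * e))%N.
  by apply: leq_mul => //; rewrite /levels; move: e6; clear; lia.
have H2 : (e <= e * e * r * e)%N by rewrite leq_pmull // !muln_gt0 e0.
have H3 : (e * e * e * r <= e * e * e * (2 ^ 11 * (e * kap.+1 ^ 2)))%N by rewrite leq_mul2l re orbT.
have H4 : (e ^ 4 * kap.+1 ^ 2 = e * e * e * (e * kap.+1 ^ 2))%N by rewrite !expnS expn0 muln1 !mulnA.
apply: (@leq_trans (141 * 1000 * (e * e * e * r))%N).
  have -> : (e * e * e * r = e * e * r * e)%N by rewrite mulnAC.
  have -> : (4 * f * (levels e).+1 = 4 * (f * (levels e).+1))%N by rewrite mulnA.
  have H5 : (7 * 1000 * (e * e * r) * (5 * e) = 35 * 1000 * (e * e * r * e))%N by rewrite mulnACA.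
  by rewrite H5 in H1; move: e6 H1 H2; move: (f * _)%N (e * e * r * e)%N; clear; lia.
apply: (@leq_trans (2 ^ 8 * 2 ^ 10 * (e * e * e * r))%N); first by rewrite leq_mul2r leq_mul ?orbT.
have -> : (2 ^ 29 = 2 ^ 8 * 2 ^ 10 * 2 ^ 11)%N by rewrite -!expnD.
rewrite H4; move: H3; move: (2 ^ 8 * 2 ^ 10)%N (2 ^ 11)%N (e * kap.+1 ^ 2)%N => P S z H3.
by rewrite -(mulnA P S) leq_mul2l [(S * _)%N]mulnCA H3 orbT.
Qed.

Section Exponent.
Variable R : realType.
Implicit Types eps : R.

Lemma log2_ge (n : nat) (x : R) : 2 ^+ n <= x -> n%:R <= log2 x.
Proof. by move=> nx; rewrite -(log2X R n); apply: ler_log2; rewrite ?exprn_gt0. Qed.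

(** The least [e] with 16 / eps <= 2^e; since 16 / eps >= 64, it is at least 6. *)
Lemma exponent_exists eps : 0 < eps -> eps <= 4^-1 ->
  exists e : nat, [/\ (6 <= e)%N, 16 <= eps * 2 ^+ e & e%:R <= 5 + log2 eps^-1].
Proof.
move=> e0 e4; have x0 : 0 < 16 / eps by rewrite divr_gt0.
have ex : exists n, 16 / eps <= 2 ^+ n.
  exists (Num.bound (16 / eps)); apply: ltW; apply: lt_le_trans (archi_boundP (ltW x0)) _.
  by rewrite -natrX ler_nat ltnW // ltn_expl.
have [e ee emin] := ex_minnP ex; exists e; split.
- rewrite leqNgt; apply/negP => e5; have : 16 / eps <= 2 ^+ 5.
    by apply: le_trans ee _; rewrite ler_weXn2l // ler1n.
  rewrite ler_pdivrMr // => H; have := le_trans H (_ : 2 ^+ 5 * eps <= 2 ^+ 5 * 4^-1).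
  by rewrite ler_wpM2l ?exprn_ge0 // => /(_ isT); rewrite -natrX; lra.
- by move: ee; rewrite ler_pdivrMr // mulrC.
case: e ee emin => [|e] ee emin.
  by rewrite addr_ge0 // (@log2_ge 0) // expr0 invf_ge1 //; lra.
have : 2 ^+ e <= 16 / eps by rewrite leNgt; apply/negP => /ltW /emin; rewrite ltnn.
move=> /log2_ge; rewrite log2M ?invr_gt0 // (_ : 16 = 2 ^+ 4) ?log2X; last by rewrite -natrX.
by rewrite -natr1; lra.
Qed.

(** With l = log2 (1 / eps) >= 2, e <= 4 l and kap + 1 <= 5 log2 l. The constant is 2^29 * 2^13 * 4,
    where 2^13 bounds 4^4 * 5^2 and 4 covers the leading 1 and the factor 2. *)
Lemma final_bound eps e : 0 < eps -> eps <= 4^-1 -> (6 <= e)%N -> e%:R <= 5 + log2 eps^-1 ->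
  1 + 2 * (step_const e (trunc_log 2 e).+1)%:R <=
  2 ^+ 44 * log2 eps^-1 ^+ 4 * log2 (log2 eps^-1) ^+ 2 :> R.
Proof.
move=> e0 e4 e6 eb; set l := log2 eps^-1 in eb *; set la := log2 l.
have l2 : 2 <= l.
  have H4 : 4 <= eps^-1 by rewrite -[leLHS]invrK lef_pV2 ?posrE ?invr_gt0.
  by apply: (@log2_ge 2); rewrite expr2 (_ : 2 * 2 = 4) //; lra.
have la1 : 1 <= la by apply: (@log2_ge 1); rewrite expr1.
have l0 : 0 < l by apply: lt_le_trans l2.
have en : e%:R <= 4 * l by lra.
have egt0 : (0 < e)%N by apply: leq_trans e6.
set T := trunc_log 2 e.
have TT : (2 ^ T <= e)%N by apply: trunc_logP.
have Tla : T.+2%:R <= 5 * la.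
  have : T%:R <= log2 (e%:R : R) by apply: log2_ge; rewrite -natrX ler_nat.
  have : log2 (e%:R : R) <= log2 (4 * l) by apply: ler_log2 => //; rewrite ltr0n.
  rewrite log2M // (_ : 4 = 2 ^+ 2) ?log2X -/la; last by rewrite expr2; lra.
  rewrite -addn2 natrD; lra.
have TK : (2 ^ T.+1 <= 2 * e)%N by rewrite expnS leq_mul2l TT.
move: (step_const e T.+1) (step_const_le e6 TK) => S.
rewrite -(ler_nat R) (natrM R (2 ^ 29)) (natrM R (e ^ 4)) (natrX R 2 29) => SP.
have H1 : (e ^ 4)%:R * (T.+2 ^ 2)%:R <= (4 * l) ^+ 4 * (5 * la) ^+ 2.
  have l4 : 0 <= 4 * l by lra.
  have la5 : 0 <= 5 * la by lra.
  by rewrite !natrX ler_pM ?exprn_ge0 // lerXn2r ?nnegrE.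
set z := l ^+ 4 * la ^+ 2; have z1 : 1 <= z by rewrite mulr_ege1 // exprn_ege1 //; lra.
have H2 : (4 * l) ^+ 4 * (5 * la) ^+ 2 <= 2 ^+ 13 * z.
  rewrite (exprMn 4 4 l) (exprMn 2 5 la) mulrACA -/z ler_wpM2r ?(le_trans _ z1) //.
  rewrite -!natrX -natrM ler_nat.
  apply: (@leq_trans (2 ^ 8 * 2 ^ 5)%N); last by rewrite -expnD.
  by rewrite leq_mul.
have P1 : 1 <= 2 ^+ 29 :> R by rewrite exprn_ege1 // ler1n.
have B1 : 1 <= 2 ^+ 13 :> R by rewrite exprn_ege1 // ler1n.
rewrite -mulrA -/z.
have -> : 2 ^+ 44 = 2 ^+ 29 * (2 ^+ 13 * 4) :> R by rewrite (_ : 4 = 2 ^+ 2) -?exprD // expr2; lra.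
move: P1 B1 SP H2 H1 z1; move: (2 ^+ 29) (2 ^+ 13 : R) z (_ * (5 * la) ^+ 2) ((e ^ 4)%:R * _) => P B z' y x.
clear=> P1 B1 SP H2 H1 z1.
have H3 : P * x <= P * (B * z') by rewrite ler_wpM2l ?(le_trans H1) //; lra.
have H4 : 1 <= P * (B * z') by rewrite !mulr_ege1.
by rewrite -mulrA -(mulrA B) (mulrCA B 4) (mulrCA P 4); lra.
Qed.

End Exponent.

Section Footprint.
Variables e : nat.
Implicit Types X : objects.

Lemma load_le_total_size X : positive X -> (2 ^ e * load e X <= (2 ^ e).+1 * total_size X)%N.
Proof.
move=> pX; rewrite /load /total_size !big_distrr /=; apply: leq_sum_seq => x xX _.
have H := rup_excess e (pX x xX); rewrite mulnBl leq_subLR in H.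
by rewrite mulnC mulSn addnC (mulnC (2 ^ e)%N).
Qed.

Lemma load_le_double X : positive X -> (load e X <= 2 * total_size X)%N.
Proof.
move=> pX; rewrite /load /total_size big_distrr /=; apply: leq_sum_seq => x xX _.
by rewrite mul2n -addnn; apply: rup_le2 (pX x xX).
Qed.

End Footprint.

(** * The randomized allocator *)

Section RandomAllocator.
Variables (R : realType) (e kap Q : nat).
Notation D' := (2 ^ Q).-1.
Notation K := ('I_D'.+1 * 'I_D'.+1)%type.
Notation W := {ffun K -> 'S_D'.+1}.
Notation Omega := ('I_((2 ^ Q)`!) * W)%type.

Definition outcome0 : Omega := (Ordinal (fact_gt0 (2 ^ Q)), [ffun=> 1%g]).

Definition decode (k : nat) : Omega := nth outcome0 (enum {: Omega}) k.

Lemma card_outcomes : #|{: Omega}|.-1.+1 = #|{: Omega}|.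
Proof. by rewrite prednK //; apply/card_gt0P; exists outcome0. Qed.

Lemma sum_decode (f : Omega -> R) :
  \sum_(k < #|{: Omega}|.-1.+1) f (decode k) = \sum_theta \sum_w f (theta, w).
Proof.
rewrite card_outcomes; transitivity (\sum_(p <- enum {: Omega}) f p).
  by rewrite (big_nth outcome0) big_mkord -cardE.
by rewrite big_enum /= pair_big /=; apply: eq_bigr => -[].
Qed.

Definition allocator : rand_allocator R :=
  @RandAllocator R _ nat (uniform_outcome R #|{: Omega}|.-1)
    (fun k us x => address e kap (decode k).1 (decode k).2 us x)
    (fun us x mD Y mY => I).

Hypothesis e6 : (6 <= e)%N.
Hypothesis kapP : (e < 2 ^ kap)%N.
Hypothesis eQ : (4 * e + 5 <= Q)%N.

Let Q5 : (5 <= Q)%N. Proof. by apply: leq_trans eQ; apply: leq_addl. Qed.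

(** The factor 1 + 11 / 2^e comes from the window and 1 + 1 / 2^e from rounding the sizes. *)
Lemma footprint us w x : legal_from [fmap]%fmap us ->
  (load e (live_after us) < 2 ^ (Q - 5))%N -> x \in domf (live_after us) ->
  (2 ^ e * 2 ^ e * (allocator w us x + mu (live_after us) x) <=
   (2 ^ e + 11) * ((2 ^ e).+1 * total_size (live_after us)))%N.
Proof.
move=> leg ld xX; have H1 := address_le e6 kapP (decode w).1 (decode w).2 leg Q5 ld xX.
have H2 := load_le_total_size e (live_positive leg).
apply: leq_trans (leq_mul (leqnn _) H2); rewrite -mulnA [leqRHS]mulnCA leq_mul2l; apply/orP; right.
by apply: leq_trans H1; rewrite leq_mul2l leq_add2l /= rup_ge orbT.
Qed.

Lemma allocator_disjoint us w x y : legal_from [fmap]%fmap us ->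
  (load e (live_after us) < 2 ^ (Q - 5))%N -> x \in domf (live_after us) -> y \in domf (live_after us) ->
  x != y ->
  (allocator w us x + mu (live_after us) x <= allocator w us y)%N ||
  (allocator w us y + mu (live_after us) y <= allocator w us x)%N.
Proof.
move=> leg ld xX yX xy.
have := address_disjoint e6 kapP (decode w).1 (decode w).2 leg Q5 ld xX yX xy.
have H v z : (allocator w us z + mu (live_after us) z <= allocator w us z + cls e (live_after us) z)%N.
  by rewrite leq_add2l rup_ge.
by case/orP => H1; apply/orP; [left|right]; apply: leq_trans H1; apply: H.
Qed.

(** The overhead divides by the true size, whereas the expected change is bounded through the
    rounded size, at most twice as large; this gives the factor 2. *)
Lemma expected_overhead us u : legal_from [fmap]%fmap (rcons us u) ->
  (load e (live_after us) < 2 ^ (Q - 5))%N -> (load e (live_after (rcons us u)) < 2 ^ (Q - 5))%N ->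
  (expectation (alloc_prob allocator)
     (fun w => overhead R (live_after us) u (allocator w us) (allocator w (rcons us u)))
   <= (1 + 2 * (step_const e kap)%:R)%:E)%E.
Proof.
move=> legu ld ldu; have leg : legal_from [fmap]%fmap us by move: legu; rewrite legal_from_rcons => /andP[].
have [_ [x ext]] := roster_step legu (roster_live e leg).
have [us1 [us2 [prs rx sz ld2]]] : exists us1 us2, [/\
    (us1 = us /\ us2 = rcons us u) \/ (us1 = rcons us u /\ us2 = us),
    roster_extends e (live_after us1) (roster e us1) x (live_after us2) (roster e us2),
    update_size (live_after us) u = mu (live_after us2) x &
    (load e (live_after us2) < 2 ^ (Q - 5))%N].
  case: ext => -[H1 H2]; first by exists us, (rcons us u); split=> //; left.
  by exists (rcons us u), us; split=> //; right.
have EC := expected_change (@ln_drop R) (fun G y z => @ln_ratio R (e + 5) G y z) e6 kapP legu prs rx sz eQ ld2.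
have s0 : (0 < mu (live_after us2) x)%N := ext_gt0 (rext rx).
set s := mu (live_after us2) x in s0 sz.
have vs : (cls e (live_after us2) x <= 2 * s)%N by rewrite mul2n -addnn; apply: rup_le2.
pose f w := overhead R (live_after us) u (allocator w us) (allocator w (rcons us u)).
pose g (o : Omega) : R := 1 + s%:R^-1 * (change e kap us1 us2 o.1 o.2)%:R.
have fg w : f w <= g (decode w).
  rewrite /f /g /overhead sz lerD2l ler_wpM2l ?invr_ge0 // ler_nat.
  rewrite -live_rcons; set X := live_after us; set Y := live_after (rcons us u); set X1 := live_after us1.
  have XY1 y : y \in (domf X `&` domf Y)%fset -> y \in domf X1.
    by rewrite in_fsetI => /andP[yX yY]; rewrite /X1; case: prs => -[-> _].
  have muE y : y \in domf X1 -> mu X y = mu X1 y.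
    rewrite /X /X1 => yX; case: prs => -[E1 E2]; first by rewrite E1.
    by rewrite -E2 (ext_mu (rext rx)).
  rewrite /change -/X1; apply: leq_trans _ (leq_sum_sub _ _ (fset_uniq (domf X `&` domf Y)%fset) XY1).
  apply: leq_sum_cond => y /XY1 yX1 ne; rewrite muE // rup_ge andbT.
  by move: ne; case: prs => -[-> ->] //; rewrite eq_sym.
have f0 w : 0 <= f w.
  by rewrite /f /overhead addr_ge0 // mulr_ge0 ?invr_ge0.
rewrite -/f expectation_uniform // lee_fin ler_pdivrMr ?ltr0n //.
have S1 : \sum_(k < #|{: Omega}|.-1.+1) f k <= \sum_(k < #|{: Omega}|.-1.+1) g (decode k).
  by apply: ler_sum => k _; apply: fg.
apply: le_trans S1 _.
rewrite (sum_decode g) card_outcomes.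
rewrite pair_big /= big_split /= sumr_const -big_distrr /= mulrDl mul1r.
have -> : #|[pred p : Omega | predT p.1 & predT p.2]| = #|{: Omega}| by apply: eq_card => -[].
apply: lerD => //; rewrite mulrC ler_pdivrMr ?ltr0n // -natr_sum.
rewrite -natrM -!natrM ler_nat.
have -> : (\sum_(p : Omega) change e kap us1 us2 p.1 p.2 = \sum_(theta < (2 ^ Q)`!) \sum_(w : W) change e kap us1 us2 theta w)%N.
  by rewrite pair_big.
apply: leq_trans EC _; rewrite card_prod card_ord.
move: vs; move: (step_const _ _) (2 ^ Q)`! #|_| (cls _ _ _) => c T N v; clear => vs.
apply: (@leq_trans (T * N * (c * (2 * s)))%N); first by rewrite !leq_mul2l vs !orbT.
by apply: eq_leq; lia.
Qed.

End RandomAllocator.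

(** * Admissible update sequences *)

Section Admissible.
Variables (R : realType) (M : nat) (eps : R).
Hypothesis eps0 : 0 < eps.
Hypothesis eps4 : eps <= 4^-1.

Lemma eps_le : 4 * eps <= 1.
Proof. by rewrite -ler_pdivlMl // mulr1. Qed.

Implicit Types us : seq update.

Lemma admissible_total us : admissible M (1 - eps) us ->
  (total_size (live_after us))%:R <= (1 - eps) * M%:R.
Proof. by case=> _ /(_ (size us)); rewrite take_size. Qed.

(** The hash space of 2^Q positions, Q = 2 M + 4 e + 5, is far larger than M and only has to contain
    every window; that addresses stay below M follows from the footprint. *)
Lemma admissible_load e us : admissible M (1 - eps) us ->
  (load e (live_after us) < 2 ^ (2 * M + 4 * e + 5 - 5))%N.
Proof.
move=> adm; have totM : (total_size (live_after us) <= M)%N.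
  rewrite -(ler_nat R); apply: le_trans (admissible_total adm) _.
  by rewrite ler_piMl // gerBl ltW.
apply: leq_ltn_trans (load_le_double e (live_positive adm.1)) _.
rewrite addnK; apply: (@leq_ltn_trans (2 * M)); first by rewrite leq_mul2l totM.
apply: leq_trans (ltn_expl (2 * M) (isT : (1 < 2)%N)) _.
by rewrite leq_exp2l; [exact: leq_addr | exact: isT].
Qed.

Lemma admissible_cat us vs : admissible M (1 - eps) (us ++ vs) -> admissible M (1 - eps) us.
Proof.
case=> leg fac; split.
  by elim: us [fmap]%fmap leg {fac} => //= v us IH X /andP[-> /IH].
move=> t; have [ts|/ltnW/take_oversize ->] := leqP t (size us).
  by have := fac t; rewrite takel_cat.
by have := fac (size us); rewrite take_size_cat.
Qed.

(** For E = 2^e >= 64, (1 + 11 / E) (1 + 1 / E) is at most 1 + 16 / E <= 1 + eps <= 1 / (1 - eps);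
    this is the origin of the 16. *)
Lemma prefix_bound (e p s : nat) : 16 <= eps * 2 ^+ e ->
  (2 ^ e * 2 ^ e * p <= (2 ^ e + 11) * ((2 ^ e).+1 * s))%N -> p%:R <= (1 - eps)^-1 * s%:R.
Proof.
move=> eE; rewrite -(ler_nat R) !natrM !natrX natrD -[(2 ^ e).+1%:R]natr1 natrX.
move: eE; set E := 2 ^+ e => eE H.
have e1 : 0 < 1 - eps by have := eps_le; lra.
have E64 : 64 <= E.
  rewrite leNgt; apply/negP => E64.
  have : 4 * eps * E <= 1 * E by rewrite ler_wpM2r ?eps_le // exprn_ge0.
  lra.
have Ep : 0 < E by lra.
have eEE : 16 * E <= eps * E * E by rewrite ler_wpM2r // ltW.
have s0 : 0 <= s%:R :> R by [].
rewrite -(ler_pM2l (mulr_gt0 Ep Ep)); apply: le_trans H _.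
rewrite -(ler_pM2l e1) (mulrCA (E * E)) mulVKf ?gt_eqF // !mulrA ler_wpM2r //.
nra.
Qed.

End Admissible.

Theorem theorem1p1 (R : realType) :
  exists C : R, 0 < C /\
  forall (eps : R) (M : nat), 0 < eps -> eps <= 4^-1 -> (0 < M)%N ->
  exists A : rand_allocator R,
    [/\ solves_memory_reallocation M (1 - eps) A,
        resizable M (1 - eps) A &
        worst_case_expected_overhead_le M (1 - eps) A
          (C * log2 eps^-1 ^+ 4 * log2 (log2 eps^-1) ^+ 2)].
Proof.
exists (2 ^+ 44); split=> [|eps M eps0 eps4 _]; first exact: exprn_gt0.
have [e [e6 e16 eb]] := exponent_exists eps0 eps4.
have kapP := trunc_log_ltn e (isT : (1 < 2)%N).
have eQ : (4 * e + 5 <= 2 * M + 4 * e + 5)%N by rewrite leq_add2r leq_addl.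
exists (allocator R e (trunc_log 2 e).+1 (2 * M + 4 * e + 5)).
have near us w x : admissible M (1 - eps) us -> x \in domf (live_after us) ->
    (allocator R e (trunc_log 2 e).+1 (2 * M + 4 * e + 5) w us x + mu (live_after us) x)%:R
      <= (1 - eps)^-1 * (total_size (live_after us))%:R.
  move=> adm xX; have ld := admissible_load eps0 e adm.
  apply: (prefix_bound eps4 e16); exact: (footprint e6 kapP eQ w adm.1 ld xX).
split=> [us adm w|us adm w x xX|us u vs adm].
- have ld := admissible_load eps0 e adm; split=> [x xX|x y /= xX yX [z [/=]]].
    (* Validity follows from resizability: by the load factor the allowed prefix has length at most
       [M]. *)
    have H : (allocator R e (trunc_log 2 e).+1 (2 * M + 4 * e + 5) w us x + mu (live_after us) x <= M)%N.
      rewrite -(ler_nat R); apply: le_trans (near us w x adm xX) _.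
      by rewrite ler_pdivrMl ?admissible_total // subr_gt0; have := eps_le eps4; lra.
    split=> //; apply: leq_trans H; rewrite -addn1 leq_add2l.
    exact: live_positive adm.1 _ xX.
  move=> /andP[x1 x2] /andP[y1 y2]; apply/eqP; apply: contraT => xy.
  have [] := orP (allocator_disjoint e6 kapP eQ w adm.1 ld xX yX xy) => H.
    by have := leq_ltn_trans (leq_trans H y1) x2; rewrite ltnn.
  by have := leq_ltn_trans (leq_trans H x1) y2; rewrite ltnn.
- exact: near.
rewrite -cat_rcons in adm; have adm1 := admissible_cat adm.
have adm0 : admissible M (1 - eps) us by apply: (@admissible_cat _ _ _ _ [:: u]); rewrite cats1.
apply: le_trans (expected_overhead R e6 kapP eQ adm1.1 (admissible_load eps0 e adm0) (admissible_load eps0 e adm1)) _.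
by rewrite lee_fin; apply: final_bound.
Qed.
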